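(* Let $r_P\ge1$ be an integer. For $1\le i\le r_P$, let $(X_i,\omega_i)$ be a compact Kähler manifold of complex dimension $n_i\ge1$, let $dV_i$ be a smooth positive volume form on $X_i$, and let $\varphi_{i,t}$ be the maximal weak solution (with respect to $\omega_i$, $dV_i$) from $\varphi_{i,0}\in\operatorname{PSH}(X_i,\omega_i)$. Assume that all factor flows are defined on a common interval $0\le t<T$. Put $X=\prod_{i=1}^{r_P}X_i$ and $n=\sum_{i=1}^{r_P}n_i$. Let $\operatorname{pr}_i:X\to X_i$ be the $i$-th projection, define the Kähler form $\omega:=\sum_{i=1}^{r_P}\operatorname{pr}_i^*\omega_i$ on $X$, and the product volume form $$dV=\frac{n!}{\prod_{i=1}^{r_P}n_i!}\bigwedge_{i=1}^{r_P}\operatorname{pr}_i^*dV_i .$$ Then, for $0\le t<T$, $$\Phi_t=\sum_{i=1}^{r_P}\operatorname{pr}_i^*\varphi_{i,t}$$ is the maximal weak solution (with respect to $\omega$, $dV$) from $\Phi_0=\sum_{i=1}^{r_P}\operatorname{pr}_i^*\varphi_{i,0}\in\operatorname{PSH}(X,\omega)$. At every $x=(x_1,\ldots,x_{r_P})\in X$, $$c(\Phi_t,x)=\min_{1\le i\le r_P}c(\varphi_{i,t},x_i),\qquad \lambda(\Phi_t,x)=\max_{1\le i\le r_P}\lambda(\varphi_{i,t},x_i).$$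
   Context: Conventions: $dd^c=\frac{i}{2\pi}\partial\bar\partial$. For a compact Kähler manifold $(X,\omega)$ of complex dimension $n$, $\operatorname{PSH}(X,\omega)$ is the set of upper semicontinuous, locally integrable functions $u\not\equiv-\infty$ with $\omega+dd^c u\ge 0$ as currents. Maximal weak solution: let $dV_X$ be a fixed smooth positive volume form on $X$ (no relation to $\omega^n$ is assumed) and $\varphi_0\in\operatorname{PSH}(X,\omega)$. Choose smooth $\omega$-psh functions $\varphi_{0,j}$ decreasing pointwise to $\varphi_0$ and let $\varphi_{t,j}$ be the smooth solutions of $(\omega+dd^c\varphi_t)^n=\exp(\partial_t\varphi_t)\,dV_X$ with initial value $\varphi_{0,j}$. The maximal weak solution $(\varphi_t)$ from $\varphi_0$ is the pointwise decreasing limit $\varphi_t=\lim_{j}\varphi_{t,j}$; it does not depend on the approximating sequence. Arnold multiplicity: for a quasi-psh function $u$, $c(u,x)=\sup\{q>0:\exp(-qu)\in L^1_{\rm loc}\text{ near }x\}$ and $\lambda(u,x)=1/c(u,x)$, with $1/(+\infty)=0$. *)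

(* Defs.v *)
From HB Require Import structures.
From mathcomp Require Import all_boot all_order all_algebra all_fingroup.
From mathcomp Require Import complex.
From mathcomp Require Import all_classical all_reals all_analysis.
Set Implicit Arguments.
Unset Strict Implicit.
Unset Printing Implicit Defensive.
Import Order.TTheory GRing.Theory Num.Theory.
Import numFieldNormedType.Exports.
Local Open Scope classical_set_scope.
Local Open Scope ring_scope.

(* R[i] with its usual topology, as a normed module over itself; being
   differentiable over R[i] on an open set is then being holomorphic. *)
HB.instance Definition _ (R : realType) := NormedModule.copy R[i] R[i]^o.

Section lebesgue_tuple.
Context {R : realType}.
Notation R_ := (measurableTypeR R).

Definition tuple_cons k (p : R_ * k.-tuple R_) : k.+1.-tuple R_ :=
  [tuple of p.1 :: p.2].

Lemma measurable_tuple_cons k : measurable_fun setT (@tuple_cons k).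
Proof. exact: measurable_cons. Qed.

Section lebesgue_cons.
Variables (k : nat) (m : {sigma_finite_measure set (k.-tuple R_) -> \bar R}).

Definition lebesgue_cons : set (k.+1.-tuple R_) -> \bar R :=
  pushforward (@lebesgue_measure R \x m)%E (@tuple_cons k).

Let lebesgue_cons0 : lebesgue_cons set0 = 0%E.
Proof. by rewrite /lebesgue_cons/pushforward preimage_set0 measure0. Qed.

Let lebesgue_cons_ge0 A : (0 <= lebesgue_cons A)%E.
Proof. by rewrite /lebesgue_cons/pushforward measure_ge0. Qed.

Let lebesgue_cons_sigma_additive : semi_sigma_additive lebesgue_cons.
Proof.
move=> F mF tF mUF; rewrite /lebesgue_cons /pushforward preimage_bigcup.
apply: measure_semi_sigma_additive.
- by move=> n; rewrite -[X in measurable X]setTI; exact: measurable_tuple_cons.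
- apply/trivIsetP => i j _ _ ij; rewrite -preimage_setI.
  by move/trivIsetP : tF => /(_ _ _ _ _ ij) ->//; rewrite preimage_set0.
- rewrite -preimage_bigcup -[X in measurable X]setTI.
  exact: measurable_tuple_cons.
Qed.

HB.instance Definition _ := isMeasure.Build _ _ _ lebesgue_cons
  lebesgue_cons0 lebesgue_cons_ge0 lebesgue_cons_sigma_additive.

Let lebesgue_cons_sigma_finite : sigma_finite setT lebesgue_cons.
Proof.
have /sigma_finiteP[F [FT Fnd Foo]] := sigma_finiteT (@lebesgue_measure R).
have /sigma_finiteP[G [GT Gnd Goo]] := sigma_finiteT m.
pose u (t : k.+1.-tuple R_) : R_ * k.-tuple R_ := (thead t, [tuple of behead t]).
have uK : cancel (@tuple_cons k) u.
  by case=> x t; congr pair; apply/val_inj.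
have mu : measurable_fun setT u.
  apply/measurable_fun_pair => //=; first exact: measurable_tnth.
  exact: measurable_behead.
exists (fun i => u @^-1` (F i `*` G i)).
  rewrite -preimage_bigcup -[LHS](preimage_setT u); congr (u @^-1` _).
  apply/seteqP; split=> // -[x y] _.
  have [[i _ Fx] [j _ Gy]] : (\bigcup_i F i) x /\ (\bigcup_i G i) y.
    by rewrite -FT -GT.
  exists (maxn i j) => //; split.
    by move: x Fx; exact/subsetPset/Fnd/leq_maxl.
  by move: y Gy; exact/subsetPset/Gnd/leq_maxr.
move=> i; have [mF Fi] := Foo i; have [mG Gi] := Goo i; split.
  by rewrite -[X in measurable X]setTI; apply: mu => //; exact: measurableX.
rewrite /lebesgue_cons /pushforward -comp_preimage.
rewrite (_ : u \o _ = id); last by apply/funext => p /=; rewrite uK.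
by rewrite preimage_id product_measure1E// lte_mul_pinfty// ge0_fin_numE.
Qed.

HB.instance Definition _ := Measure_isSigmaFinite.Build _ _ _ lebesgue_cons
  lebesgue_cons_sigma_finite.

End lebesgue_cons.

Fixpoint lebesgue_tuple k : {sigma_finite_measure set (k.-tuple R_) -> \bar R} :=
  if k is k'.+1 then lebesgue_cons (lebesgue_tuple k') else \d_[tuple].

End lebesgue_tuple.

Section calculus.
Context {R : realType}.
Local Notation C := R[i].
Implicit Types n k : nat.

Definition ofreal n (t : (n * 2).-tuple (measurableTypeR R)) : 'rV[C]_n :=
  \row_j (nth 0 t j.*2 +i* nth 0 t j.*2.+1)%C.

(* The derivative of f at z in the real direction v of C^n. *)
Definition rderive n (v : 'rV[C]_n) (f : 'rV[C]_n -> R) (z : 'rV[C]_n) : R :=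
  derive1 (fun s : R => f (z + s%:C%C *: v)) 0.

Definition cderive n (v : 'rV[C]_n) (f : 'rV[C]_n -> C) (z : 'rV[C]_n) : C :=
  (rderive v (@complex.Re R \o f) z +i* rderive v (@complex.Im R \o f) z)%C.

Definition dz n (j : 'I_n) (f : 'rV[C]_n -> C) (z : 'rV[C]_n) : C :=
  (cderive (delta_mx 0 j) f z
   - 'i%C * cderive ('i%C *: delta_mx 0 j) f z) / 2.

Definition dzbar n (j : 'I_n) (f : 'rV[C]_n -> C) (z : 'rV[C]_n) : C :=
  (cderive (delta_mx 0 j) f z
   + 'i%C * cderive ('i%C *: delta_mx 0 j) f z) / 2.

Definition tline n (d : R * 'rV[C]_n) (p : R * 'rV[C]_n) (s : R) :=
  (p.1 + s * d.1, p.2 + s%:C%C *: d.2).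

Definition tderive n (d : R * 'rV[C]_n) (f : R * 'rV[C]_n -> R)
    (p : R * 'rV[C]_n) : R :=
  derive1 (f \o tline d p) 0.

(* C^oo on the open set U of R x C^n: iterated directional derivatives of all
   orders exist and are continuous on U. *)
Definition smooth_on n (U : set (R * 'rV[C]_n)) (f : R * 'rV[C]_n -> R) :=
  forall (ds : seq (R * 'rV[C]_n)) p, U p ->
    let g := foldr (@tderive n) f ds in
    {for p, continuous g} /\ forall d, derivable (g \o tline d p) 0 1.

Definition smooth n (U : set 'rV[C]_n) (f : 'rV[C]_n -> R) :=
  smooth_on (setT `*` U) (f \o snd).

(* A form of degree k at a point of C^n, as a function of k tangent vectors
   (the rows of a matrix). *)
Definition form k n := 'M[C]_(k, n) -> C.

(* R-multilinear (not C-multilinear) and alternating *)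
Definition is_form k n (a : form k n) : Prop :=
  (forall (A B B' : 'M[C]_(k, n)) (i : 'I_k) (b b' : R),
     row i A = b%:C%C *: row i B + b'%:C%C *: row i B' ->
     row' i B = row' i A -> row' i B' = row' i A ->
     a A = b%:C%C * a B + b'%:C%C * a B') /\
  (forall (A : 'M[C]_(k, n)) (i i' : 'I_k),
     i != i' -> row i A = row i' A -> a A = 0).

Definition pullback k m n (f : 'rV[C]_n -> 'rV[C]_m) (a : form k m) :
    form k n :=
  fun M => a (\matrix_(l < k) f (row l M)).

(* Normalized so that (al /\ be)(v, w) = al(v) be(w) - al(w) be(v) on 1-forms. *)
Definition wedge k l n (a : form k n) (b : form l n) : form (k + l) n :=
  fun M => (k`! * l`!)%:R^-1 * \sum_(s : 'S_(k + l))
    (-1) ^+ s * (a (usubmx (row_perm s M)) * b (dsubmx (row_perm s M))).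

Fixpoint wedge_pow n (a : form 2 n) (m : nat) : form (m * 2) n :=
  if m is m'.+1 then wedge a (@wedge_pow n a m') else fun=> 1.

(* The iterated product a_0 /\ ... /\ a_(r-1), as a single sum over permutations
   with the same normalization. *)
Definition big_wedge r (k : 'I_r -> nat) n (a : forall i, form (k i) n) :
    form (\sum_i k i) n :=
  fun M => (\prod_i (k i)`!)%:R^-1 * \sum_(s : 'S_(\sum_i k i))
    (-1) ^+ s * \prod_i a i (submxcol (row_perm s M) i).

Definition ext_d k n (a : 'rV[C]_n -> form k n) (z : 'rV[C]_n) :
    form k.+1 n :=
  fun M => \sum_(l < k.+1)
    (-1) ^+ l * cderive (row l M) (fun w => a w (row' l M)) z.

(* dd^c u = i/(2 pi) \sum_(j, k) (d^2 u / dz_j dzbar_k) dz_j /\ dzbar_k *)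
Definition ddc n (u : 'rV[C]_n -> R) (z : 'rV[C]_n) : form 2 n :=
  fun M => 'i%C / (2 * (pi : R)%:C%C) * \sum_j \sum_k
    dz j (dzbar k (fun w => (u w)%:C%C)) z *
    wedge (fun v : 'rV[C]_n => v 0 j) (fun v : 'rV[C]_n => (v 0 k)^*) M.

(* The positively oriented real frame e_0, i e_0, e_1, i e_1, ... of C^n. *)
Definition real_frame n : 'M[C]_(n * 2, n) :=
  \matrix_(l, j) if l./2 == j :> nat then (if odd l then 'i%C else 1) else 0.

End calculus.

Arguments wedge_pow {R n} a m.

(* A Hausdorff complex manifold of pure dimension cm_dim; inv a is meaningful
   only on the image of the chart a. *)
Record complex_manifold (R : realType) := ComplexManifold {
  cm_space :> topologicalType;
  cm_dim : nat;
  cm_index : Type;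
  cm_dom : cm_index -> set cm_space;
  cm_chart : cm_index -> cm_space -> 'rV[R[i]]_cm_dim;
  cm_inv : cm_index -> 'rV[R[i]]_cm_dim -> cm_space;
  cm_hausdorff : hausdorff_space cm_space;
  cm_cover : forall x, exists a, cm_dom a x;
  cm_open_dom : forall a, open (cm_dom a);
  cm_open_img : forall a, open (cm_chart a @` cm_dom a);
  cm_chartK : forall a x, cm_dom a x -> cm_inv a (cm_chart a x) = x;
  cm_chart_cont : forall a x, cm_dom a x -> {for x, continuous (cm_chart a)};
  cm_inv_cont : forall a z, (cm_chart a @` cm_dom a) z ->
    {for z, continuous (cm_inv a)};
  cm_holo : forall a b z, (cm_chart a @` (cm_dom a `&` cm_dom b)) z ->
    differentiable (cm_chart b \o cm_inv a) z }.

Arguments cm_dom {R c}.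
Arguments cm_chart {R c}.
Arguments cm_inv {R c}.

Section kahler.
Context {R : realType}.
Local Notation C := R[i].
Variable X : complex_manifold R.
Local Notation n := (cm_dim X).

Definition cm_img (a : cm_index X) : set 'rV[C]_n := cm_chart a @` cm_dom a.

(* A differential form on X, given by its expression in every chart. *)
Definition diff_form k := cm_index X -> 'rV[C]_n -> form (R := R) k n.

Definition smooth_real_form k (al : diff_form k) : Prop :=
  [/\ forall a z, cm_img a z -> is_form (al a z),
      forall a z M, cm_img a z -> al a z M \is Num.real,
      forall a M, smooth (cm_img a) (fun z => complex.Re (al a z M)) &
      forall a b z, (cm_chart a @` (cm_dom a `&` cm_dom b)) z ->
        al a z = pullback ('d (cm_chart b \o cm_inv a) z)
                          (al b (cm_chart b (cm_inv a z)))].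

(* A closed real (1,1)-form om with om(v, iv) > 0 for v != 0. *)
Definition kahler_form (om : diff_form 2) : Prop :=
  [/\ smooth_real_form om,
      forall a z M, cm_img a z -> om a z ('i%C *: M) = om a z M,
      forall a z (v : 'rV[C]_n), cm_img a z -> v != 0 ->
        0 < om a z (col_mx v ('i%C *: v)) &
      forall a z M, cm_img a z -> ext_d (om a) z M = 0].

Definition compact_kahler (om : diff_form 2) : Prop :=
  compact [set: X] /\ kahler_form om.

Definition volume_form (dV : diff_form (n * 2)) : Prop :=
  smooth_real_form dV /\
  forall a z, cm_img a z -> 0 < dV a z (real_frame n).

Definition smooth_fun (u : X -> R) : Prop :=
  forall a, smooth (cm_img a) (u \o cm_inv a).

(* f is integrable near x, with respect to Lebesgue measure in charts. *)
Definition L1loc_at (f : X -> \bar R) (x : X) : Prop :=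
  forall a, cm_dom a x -> exists U : set 'rV[C]_n,
    [/\ open U, U (cm_chart a x), U `<=` cm_img a &
        (lebesgue_tuple (n * 2)).-integrable (@ofreal R n @^-1` U)
          (f \o cm_inv a \o @ofreal R n)].

(* chi is a test function with support in the chart a. *)
Definition test_fun (a : cm_index X) (chi : 'rV[C]_n -> R) : Prop :=
  smooth setT chi /\
  exists K : set 'rV[C]_n,
    [/\ compact K, K `<=` cm_img a & forall z, ~ K z -> chi z = 0].

(* om + dd^c u >= 0 as a (1,1)-current: for every constant vector v the
   distribution (om + dd^c u)(v, iv) is nonnegative on test functions; dd^c is
   moved to the test function. *)
Definition positive_current (om : diff_form 2) (u : X -> \bar R) : Prop :=
  forall a (v : 'rV[C]_n) chi, test_fun a chi -> (forall z, 0 <= chi z) ->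
  let V := col_mx v ('i%C *: v) in
  (0 <= \int[lebesgue_tuple (n * 2)]_t
     let z := ofreal t in
     ((chi z * complex.Re (om a z V))%:E
      + u (cm_inv a z) * (complex.Re (ddc chi z V))%:E))%E.

Definition PSH (om : diff_form 2) (u : X -> \bar R) : Prop :=
  [/\ forall x, (u x < +oo)%E,
      lower_semicontinuous (fun x => - u x)%E,
      forall x, L1loc_at u x,
      exists x, u x != -oo%E &
      positive_current om u].

(* psi is the smooth solution of (om + dd^c psi_t)^n = exp(d psi_t / dt) dV
   on 0 < t < T, continuous up to t = 0 with value psi0 there. *)
Definition smooth_solution (om : diff_form 2) (dV : diff_form (n * 2))
    (T : \bar R) (psi0 : X -> R) (psi : R -> X -> R) : Prop :=
  [/\ psi 0 = psi0,
      {within [set p : R * X | 0 <= p.1 /\ (p.1%:E < T)%E],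
        continuous (fun p : R * X => psi p.1 p.2)},
      forall a, smooth_on [set p | [/\ 0 < p.1, (p.1%:E < T)%E & cm_img a p.2]]
        (fun p => psi p.1 (cm_inv a p.2)) &
      forall a t z M, 0 < t -> (t%:E < T)%E -> cm_img a z ->
        wedge_pow (fun N => om a z N + ddc (psi t \o cm_inv a) z N) n M =
        (expR (derive1 (psi ^~ (cm_inv a z)) t))%:C%C * dV a z M].

Definition maximal_weak_solution (om : diff_form 2) (dV : diff_form (n * 2))
    (T : \bar R) (phi0 : X -> \bar R) (phi : R -> X -> \bar R) : Prop :=
  PSH om phi0 /\
  exists (phi0_ : nat -> X -> R) (phi_ : nat -> R -> X -> R),
    [/\ forall j, smooth_fun (phi0_ j) /\ PSH om (EFin \o phi0_ j),
        forall x, nonincreasing_seq (phi0_ ^~ x) /\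
          (phi0_ j x)%:E @[j --> \oo] --> phi0 x,
        forall j, smooth_solution om dV T (phi0_ j) (phi_ j) &
        forall t x, 0 <= t -> (t%:E < T)%E ->
          nonincreasing_seq (fun j => phi_ j t x) /\
          (phi_ j t x)%:E @[j --> \oo] --> phi t x].

(* c(u, x): the supremum is taken in [0, +oo], hence the extra 0 (otherwise
   ereal_sup would give -oo if no q > 0 worked). *)
Definition sing_exponent (u : X -> \bar R) (x : X) : \bar R :=
  ereal_sup ([set 0%E] `|` [set q%:E | q in [set q : R | 0 < q /\
    L1loc_at (fun y => expeR (- (q%:E * u y))%E) x]]).

(* lambda(u, x); 0^-1 = +oo and +oo^-1 = 0 in \bar R *)
Definition arnold_mult (u : X -> \bar R) (x : X) : \bar R :=
  ((sing_exponent u x)^-1)%E.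

End kahler.

Section product_manifold.
Context {R : realType}.
Variables (r : nat) (X : 'I_r -> complex_manifold R).
Local Notation C := R[i].
Local Notation N := (\sum_(i < r) cm_dim (X i)).

Definition prod_space : topologicalType :=
  prod_topology (fun i => X i : topologicalType).

Definition prod_index := forall i, cm_index (X i).

Definition prod_dom (a : prod_index) : set prod_space :=
  [set x | forall i, cm_dom (a i) (x i)].

Definition prod_chart (a : prod_index) (x : prod_space) : 'rV[C]_N :=
  \mxrow_i cm_chart (a i) (x i).

Definition prod_inv (a : prod_index) (z : 'rV[C]_N) : prod_space :=
  fun i => cm_inv (a i) (submxrow z i).

Let prod_proj_continuous i : continuous (fun x : prod_space => x i).
Proof. exact: (@proj_continuous 'I_r (fun i => X i : topologicalType) i). Qed.

Let mx_continuous (E : topologicalType) m n (f : E -> 'M[C]_(m, n)) (p : E) :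
  (forall k l, {for p, continuous (fun q => f q k l)}) -> {for p, continuous f}.
Proof.
move=> fc A [P Pf PA].
have H : \forall q \near p, forall k l, P k l (f q k l).
  by apply: filter_forall => k; apply: filter_forall => l; exact: fc.
by apply: filterS H => q Hq; exact: PA.
Qed.

Let mulmxr_continuous m n (A : 'M[C]_(m, n)) :
  continuous (fun z : 'rV[C]_m => z *m A).
Proof.
move=> z; apply: mx_continuous => k l.
rewrite (_ : (fun q : 'rV[C]_m => _) =
    \sum_j (fun q : 'rV[C]_m => q k j * A j l)); last first.
  by apply/funext => q; rewrite mxE fct_sumE.
apply: (big_ind (fun f : 'rV[C]_m -> C => {for z, continuous f})).
- exact: cst_continuous.
- move=> f g cf cg; exact: (@cvgD C C _ (nbhs z) _ f g (f z) (g z) cf cg).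
- move=> j _; apply: (@cvgM C _ (nbhs z) _ (fun q : 'rV[C]_m => q k j)
    (fun=> A j l)); last exact: cvg_cst.
  exact: (@coord_continuous C 1 m k j).
Qed.

Let submxrowE n (z : 'M[C]_(n, N)) i : submxrow z i = z *m submxrow 1%:M i.
Proof. by rewrite mul_submxrow mulmx1. Qed.

Let submxrow_continuous i : continuous (fun z : 'rV[C]_N => submxrow z i).
Proof.
rewrite (_ : (fun z : 'rV[C]_N => _) = (fun z => z *m submxrow 1%:M i)).
  exact: mulmxr_continuous.
by apply/funext => z; rewrite submxrowE.
Qed.

Let mxrowE (B : forall i, 'rV[C]_(cm_dim (X i))) :
  \mxrow_i B i = \sum_i B i *m submxcol (1%:M : 'M[C]_N) i.
Proof. by rewrite -mul_mxrow_mxcol submxcolK mulmx1. Qed.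

Lemma prod_imgE a :
  prod_chart a @` prod_dom a = [set z | forall i, cm_img (a i) (submxrow z i)].
Proof.
apply/seteqP; split=> [_ [x ax <-] i|z /= az].
  by rewrite /prod_chart mxrowK; exists (x i).
exists (prod_inv a z).
  by move=> i; rewrite /prod_inv; have [x ax <-] := az i; rewrite cm_chartK.
rewrite -[RHS]submxrowK; apply: eq_mxrow => i; rewrite /prod_inv.
by have [x ax <-] := az i; rewrite cm_chartK.
Qed.

Lemma prod_hausdorff : hausdorff_space prod_space.
Proof.
exact: (@hausdorff_product 'I_r (fun i => X i : topologicalType)
  (fun i => @cm_hausdorff R (X i))).
Qed.

Lemma prod_cover (x : prod_space) : exists a, prod_dom a x.
Proof.
exists (fun i => projT1 (cid (cm_cover (x i)))) => i.
exact: projT2 (cid (cm_cover (x i))).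
Qed.

Lemma prod_open_dom a : open (prod_dom a).
Proof.
rewrite openE => x ax.
suff: \forall y \near x, forall i, cm_dom (a i) (y i) by [].
apply: (@filter_forall prod_space _ _ _ (nbhs_filter x)) => i.
apply: (@prod_proj_continuous i x); apply: open_nbhs_nbhs; split; last exact: ax.
exact: cm_open_dom.
Qed.

Lemma prod_open_img a : open (prod_chart a @` prod_dom a).
Proof.
rewrite prod_imgE openE => z az.
suff: \forall w \near z, forall i, cm_img (a i) (submxrow w i) by [].
apply: (@filter_forall _ _ _ _ (nbhs_filter z)) => i.
apply: (@submxrow_continuous i z); apply: open_nbhs_nbhs; split; last exact: az.
exact: cm_open_img.
Qed.

Lemma prod_chartK a x : prod_dom a x -> prod_inv a (prod_chart a x) = x.
Proof.
move=> ax; apply: functional_extensionality_dep => i.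
by rewrite /prod_inv /prod_chart mxrowK cm_chartK.
Qed.

Lemma prod_chart_cont a x :
  prod_dom a x -> {for x, continuous (prod_chart a)}.
Proof.
move=> ax.
apply: mx_continuous => k l.
rewrite (_ : (fun y => _) = fun y : prod_space =>
    cm_chart (a (tagnat.sig1 l)) (y (tagnat.sig1 l)) k (tagnat.sig2 l)); last first.
  by apply/funext => y; rewrite /prod_chart mxE.
apply: (@continuous_comp _ _ _
  (fun y : prod_space => cm_chart (a (tagnat.sig1 l)) (y (tagnat.sig1 l)))
  (fun M : 'M[C]_(_, _) => M k (tagnat.sig2 l))); last exact: coord_continuous.
apply: (@continuous_comp _ _ _ (fun y : prod_space => y (tagnat.sig1 l))).
  exact: prod_proj_continuous.
exact: cm_chart_cont.
Qed.

Lemma prod_inv_cont a z : (prod_chart a @` prod_dom a) z ->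
  {for z, continuous (prod_inv a)}.
Proof.
rewrite prod_imgE => az.
have ci i : {for z, continuous (fun w : 'rV[C]_N => cm_inv (a i) (submxrow w i))}.
  apply: (@continuous_comp _ _ _ (fun w : 'rV[C]_N => submxrow w i)
    (cm_inv (a i)) z).
    exact: submxrow_continuous.
  exact: (cm_inv_cont (az i)).
apply/(@cvg_sup _ _ (fun i => Topological.class
  (initial_topology (fun f : (forall i, X i) => f i))) _ _
  (fmap_filter _ (nbhs_filter z))) => i A.
have /= -> := @nbhsE (initial_topology (fun x : prod_space => x i)).
case=> B [[D oD <-] Dz] /filterS; apply.
by apply: (ci i); exact: open_nbhs_nbhs.
Qed.

Lemma prod_holo a b z : (prod_chart a @` (prod_dom a `&` prod_dom b)) z ->
  differentiable (prod_chart b \o prod_inv a) z.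
Proof.
move=> [x [ax bx] <-]; set z0 := prod_chart a x.
pose h i := (mulmxr (submxcol (1%:M : 'M[C]_N) i)
  \o (cm_chart (b i) \o cm_inv (a i)))
  \o (mulmxr (submxrow (1%:M : 'M[C]_N) i)) : 'rV[C]_N -> 'rV[C]_N.
have -> : prod_chart b \o prod_inv a = \sum_(i < r) h i.
  apply/funext => w; rewrite /= /prod_chart mxrowE fct_sumE.
  by apply: eq_bigr => i _; rewrite /h /= /prod_inv submxrowE.
apply: differentiable_sum => i; apply: differentiable_comp.
  exact/linear_differentiable/mulmxr_continuous.
apply: differentiable_comp; last first.
  exact/linear_differentiable/mulmxr_continuous.
by rewrite /= -submxrowE mxrowK; apply: cm_holo; exists (x i).
Qed.

Definition prod_manifold : complex_manifold R :=
  ComplexManifold prod_hausdorff prod_cover prod_open_dom prod_open_img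
    prod_chartK prod_chart_cont prod_inv_cont prod_holo.

(* The projection onto the i-th factor reads submxrow _ i in product charts;
   it is linear, hence equal to its own differential. *)
Definition pr_pullback k i (al : diff_form (X i) k) :
    diff_form prod_manifold k :=
  fun a z => pullback (fun w : 'rV[C]_N => submxrow w i)
               (al (a i) (submxrow z i)).

Definition prod_kahler (om : forall i, diff_form (X i) 2) :
    diff_form prod_manifold 2 :=
  fun a z M => \sum_i pr_pullback (om i) a z M.

Lemma prod_dim2 : (N * 2 = \sum_(i < r) cm_dim (X i) * 2)%N.
Proof. exact: big_distrl. Qed.

Definition prod_volume (dV : forall i, diff_form (X i) (cm_dim (X i) * 2)) :
    diff_form prod_manifold (cm_dim prod_manifold * 2) :=
  fun a z M => N`!%:R / (\prod_(i < r) (cm_dim (X i))`!)%:R *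
    big_wedge (fun i => pr_pullback (dV i) a z) (castmx (prod_dim2, erefl) M).

End product_manifold.

(* Main.v *)
Require Import Defs.
From HB Require Import structures.
From mathcomp Require Import all_boot all_order all_algebra all_fingroup.
From mathcomp Require Import complex ring lra.
From mathcomp Require Import finmap.
From mathcomp Require Import all_classical all_reals all_analysis.
From mathcomp Require Import measurable_realfun lebesgue_integral_under.
Set Implicit Arguments.
Unset Strict Implicit.
Unset Printing Implicit Defensive.
Import Order.TTheory GRing.Theory Num.Theory.
Import numFieldNormedType.Exports.
Local Open Scope ring_scope.

(** The projections of the product become, in product charts, the linear
    projections of C^N onto blocks of coordinates, and every assertion reduces to
    a statement on functions and forms of separate blocks of variables.

    The product equation. The forms omega_i + dd^c phi_i of different factors
    commute and only their top powers survive in the top power of their sum, with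
    the multinomial coefficient n! / prod n_i!, which is the constant in dV. Hence
    sums of smooth solutions of the factors solve the equation of the product: the
    right hand sides multiply, and the time derivatives add up under the
    exponential. The combinatorial core is pfsum_block_diagonal, the resulting
    identity of forms is wedge_pow_product, and monge_ampere_product draws the
    conclusion. Summing the approximants of the factors and passing to decreasing
    limits gives the weak solution (maximal_weak_solution_sum).

    Quasi-plurisubharmonicity of sums. Positivity of the current omega_i + dd^c u_i,
    pulled back to the product, is tested on a function chi of all variables. By
    Fubini this is the current of the factor tested on the integral of chi over the
    other variables, which is again a nonnegative test function because fibre
    integration commutes with derivatives (fiber_derive, Re_ddc_fiber,
    block_current). Adding the factors gives PSH_sum.

    Exponents. The function exp(-q Phi) is the product of the exp(-q phi_i), which
    depend on separate variables. By Tonelli its integral over a product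
    neighbourhood is the product of the integrals, all of them positive, so it is
    locally integrable at x exactly when every factor is so at x_i
    (L1loc_weight_sum). The admissible q of a factor form an interval starting at
    0, hence the supremum for the product is the least of the suprema, and inverses
    exchange minimum and maximum. *)

(** * Permutations of a set divided into blocks *)

Section extend_perm.
Variables (S T : finType) (iota : S -> T).
Hypothesis iota_inj : injective iota.

Definition extend_fun (tau : {perm S}) (t : T) : T :=
  if [pick j | iota j == t] is Some j then iota (tau j) else t.

Lemma extend_fun_in tau j : extend_fun tau (iota j) = iota (tau j).
Proof.
rewrite /extend_fun; case: pickP => [j' /eqP /iota_inj -> //|/(_ j)].
by rewrite eqxx.
Qed.

Lemma extend_fun_out tau t : (forall j, iota j != t) -> extend_fun tau t = t.
Proof.
by rewrite /extend_fun => h; case: pickP => // j; rewrite (negbTE (h j)).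
Qed.

Lemma extend_fun_inj tau : injective (extend_fun tau).
Proof.
apply: (can_inj (g := extend_fun tau^-1)) => t.
have [j /eqP <-|h] := pickP (fun j => iota j == t).
  by rewrite !extend_fun_in permK.
by rewrite !extend_fun_out // => j; rewrite h.
Qed.

(** Extending a permutation along an injection by the identity keeps its sign, so
    sums of signed permutations can be compared blockwise. *)
Definition extend_perm tau : {perm T} := perm (@extend_fun_inj tau).

Lemma extend_perm_in tau j : extend_perm tau (iota j) = iota (tau j).
Proof. by rewrite permE extend_fun_in. Qed.

Lemma extend_perm_out tau t : (forall j, iota j != t) -> extend_perm tau t = t.
Proof. by rewrite permE; exact: extend_fun_out. Qed.

Lemma extend_permM tau tau' :
  extend_perm (tau * tau')%g = (extend_perm tau * extend_perm tau')%g.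
Proof.
apply/permP => t; rewrite permM.
have [j /eqP <-|h] := pickP (fun j => iota j == t).
  by rewrite !extend_perm_in permM.
by rewrite !extend_perm_out // => j; rewrite h.
Qed.

Lemma odd_extend_perm tau : odd_perm (extend_perm tau) = odd_perm tau.
Proof.
have [ts -> tsP] := prod_tpermP tau.
elim: ts tsP => [_|[x y] ts IH /= /andP[xy /IH]].
  rewrite big_nil odd_perm1 (_ : extend_perm 1 = 1%g) ?odd_perm1//.
  apply/permP => t; rewrite perm1.
  have [j /eqP <-|h] := pickP (fun j => iota j == t).
    by rewrite !extend_perm_in perm1.
  by rewrite !extend_perm_out // => j; rewrite h.
rewrite big_cons extend_permM !odd_permM => ->; congr (_ (+) _).
rewrite (_ : extend_perm _ = tperm (iota x) (iota y)).
  by rewrite !odd_tperm (inj_eq iota_inj).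
apply/permP => t.
have [j /eqP <-|h] := pickP (fun j => iota j == t).
  by rewrite extend_perm_in inj_tperm.
by rewrite !extend_perm_out ?tpermD ?h // => j; rewrite h.
Qed.

End extend_perm.

Lemma card_Sn_type n : #|{: 'S_n}| = n`!.
Proof. by rewrite -card_Sn; apply: eq_card => t; rewrite !inE. Qed.

Lemma sum_Sn_const (V : zmodType) n (c : V) : \sum_(t : 'S_n) c = c *+ n`!.
Proof. by rewrite big_const iter_addr_0 card_Sn_type. Qed.

Section blocks.
Variables (I T : finType) (k : I -> nat) (iota : forall i, 'I_(k i) -> T).
Arguments iota : clear implicits.

(** The maps iota i cut T into pieces of sizes k i. Keeping the
    maps abstract lets the same lemmas serve for complex coordinates, for their
    real and imaginary parts, and for the rows of a matrix of tangent vectors. *)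
Definition blocks := bijective (fun p : {i & 'I_(k i)} => iota (tag p) (tagged p)).

Hypothesis iotaP : blocks.

Lemma blocks_inj i : injective (iota i).
Proof.
move=> j j' e; have [g gK _] := iotaP.
have /= e1 := gK (Tagged (fun i => 'I_(k i)) j).
have /= e2 := gK (Tagged (fun i => 'I_(k i)) j').
by move: e1; rewrite e e2 => /eqP; rewrite eq_Tagged => /eqP /= ->.
Qed.

Lemma blocks_cover t : {p : {i & 'I_(k i)} | iota (tag p) (tagged p) = t}.
Proof.
have : exists p : {i & 'I_(k i)}, iota (tag p) (tagged p) == t.
  by have [g _ hK] := iotaP; exists (g t); apply/eqP; exact: hK.
by move=> /sigW[p /eqP]; exists p.
Qed.

Definition block t : I := tag (sval (blocks_cover t)).

Lemma block_iota i j : block (iota i j) = i.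
Proof.
rewrite /block; case: (blocks_cover _) => -[i' j'] /= e.
have [g gK _] := iotaP.
have /= e1 := gK (Tagged (fun i => 'I_(k i)) j).
have /= e2 := gK (Tagged (fun i => 'I_(k i)) j').
by move: e1; rewrite -e e2 => /(congr1 tag).
Qed.

Lemma blockP t : {j | t = iota (block t) j}.
Proof. by rewrite /block; case: (blocks_cover _) => -[i j] /= <-; exists j. Qed.

Lemma big_blocks (R : Type) (idx : R) (op : Monoid.com_law idx) (F : T -> R) :
  \big[op/idx]_t F t = \big[op/idx]_i \big[op/idx]_(j : 'I_(k i)) F (iota i j).
Proof.
by rewrite sig_big_dep /= (reindex _ (onW_bij _ iotaP)).
Qed.

Definition block_preserving : pred {perm T} :=
  [pred s : {perm T} | [forall t, block (s t) == block t]].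

Lemma block_preservingP (s : {perm T}) :
  reflect (forall t, block (s t) = block t) (s \in block_preserving).
Proof. exact: 'forall_eqP. Qed.

(** A permutation that preserves every block is the same thing as a family of
    permutations, one for each block; the next lemmas make this a bijection that
    multiplies signs. *)
Definition block_perm (sg : fprod (fun i => {perm 'I_(k i)})) : {perm T} :=
  (\prod_i extend_perm (@blocks_inj i) (sg i))%g.

Lemma block_perm_iota sg i j : block_perm sg (iota i j) = iota i (sg i j).
Proof.
rewrite /block_perm.
have H (r : seq I) (j' : 'I_(k i)) : uniq r ->
  (\prod_(i' <- r) extend_perm (@blocks_inj i') (sg i'))%g (iota i j') =
  if i \in r then iota i (sg i j') else iota i j'.
  elim: r j' => [j' _|i' r IH j' /= /andP[i'r ur]]; first by rewrite big_nil perm1.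
  rewrite big_cons permM in_cons; case: (eqVneq i i') => [e|ii'] /=.
    by subst i'; rewrite extend_perm_in IH // (negbTE i'r).
  rewrite extend_perm_out ?IH // => jj; apply: contra ii' => /eqP e.
  by rewrite -(block_iota j') -e block_iota.
by rewrite H ?index_enum_uniq // mem_index_enum.
Qed.

Lemma sign_block_perm (R : pzRingType) sg :
  (-1) ^+ block_perm sg = \prod_i (-1) ^+ (sg i : bool) :> R.
Proof.
have -> : block_perm sg = \big[addb/false]_i (sg i : bool) :> bool.
  rewrite /block_perm; elim/big_ind2 : _ => [||i _]; rewrite ?odd_perm1 //.
    by move=> ? ? ? ? <- <-; rewrite odd_permM.
  exact: odd_extend_perm.
by elim/big_ind2 : _ => //= b1 x1 b2 x2 <- <-; rewrite signr_addb.
Qed.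

Lemma block_perm_preserving sg : block_perm sg \in block_preserving.
Proof.
apply/block_preservingP => t; have [j ->] := blockP t.
by rewrite block_perm_iota !block_iota.
Qed.

Section restrict.
Variables (s : {perm T}) (sP : s \in block_preserving).

Definition restrict_fun i (j : 'I_(k i)) : 'I_(k i) :=
  odflt j [pick j' | iota i j' == s (iota i j)].

Lemma restrict_funE i j : iota i (@restrict_fun i j) = s (iota i j).
Proof.
rewrite /restrict_fun; case: pickP => [j' /eqP //|].
have [j' e] := blockP (s (iota i j)).
have b : block (s (iota i j)) = i by rewrite (block_preservingP _ sP) block_iota.
by rewrite b in j' e * => /(_ j'); rewrite e eqxx.
Qed.

Lemma restrict_fun_inj i : injective (@restrict_fun i).
Proof.
move=> j j' e; apply: (@blocks_inj i); apply: (@perm_inj _ s).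
by rewrite -!restrict_funE e.
Qed.

Definition block_restrict : fprod (fun i => {perm 'I_(k i)}) :=
  [fprod i => perm (@restrict_fun_inj i)].

Lemma block_restrictK : block_perm block_restrict = s.
Proof.
apply/permP => t; have [j tE] := blockP t.
by rewrite [in LHS]tE block_perm_iota fprodE permE restrict_funE -tE.
Qed.

End restrict.

Lemma block_perm_bij :
  {on [in block_preserving], bijective block_perm}.
Proof.
pose g s := if [pick sg | block_perm sg == s] is Some sg then sg
            else [fprod i => 1%g].
have inj sg sg' : block_perm sg = block_perm sg' -> sg = sg'.
  move=> e; apply/fprodP => i; apply/permP => j; apply: (@blocks_inj i).
  by rewrite -!block_perm_iota e.
exists g => [sg _|s sP]; rewrite /g; case: pickP => [sg' /eqP //|h].
- exact: inj.
- by have := h sg; rewrite eqxx.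
- by have := h (block_restrict sP); rewrite block_restrictK eqxx.
Qed.

(** The sum over block-preserving permutations factors because a product of sums
    over the blocks is one sum over families of permutations. *)
Lemma sum_block_preserving (R : comPzRingType)
    (F : forall i, {perm 'I_(k i)} -> R) (G : {perm T} -> R) :
  (forall sg : fprod (fun i => {perm 'I_(k i)}),
     G (block_perm sg) = \prod_i F i (sg i)) ->
  \sum_(s in block_preserving) G s = \prod_i \sum_t F i t.
Proof.
move=> GE; rewrite (reindex _ block_perm_bij) /=.
under eq_bigl do rewrite block_perm_preserving.
under eq_bigr do rewrite GE.
pose P i := [ffun t : {perm 'I_(k i)} => F i t].
transitivity (\prod_i
    \sum_(j in tagged_with (fun i => {perm 'I_(k i)}) i) untag 0 (P i) j).
  rewrite bigA_distr_big_dep.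
  have X := @big_fprod R 0 1 *%R +%R I _ P.
  transitivity (\sum_(sg : fprod (fun i => {perm 'I_(k i)}))
                  \prod_(i in I) P i (sg i)); last by rewrite X; exact: eq_bigl.
  by apply: eq_bigr => sg _; apply: eq_bigr => i _; rewrite ffunE.
apply: eq_bigr => i _.
transitivity (\sum_t P i t); last by apply: eq_bigr => t _; rewrite ffunE.
by rewrite (big_tag P).
Qed.

Lemma card_block_preserving : #|block_preserving| = (\prod_i (k i)`!)%N.
Proof.
rewrite -(on_card_preimset block_perm_bij).
rewrite (_ : _ @^-1: _ = [set: _]%SET); last first.
  by apply/setP => sg; rewrite inE block_perm_preserving inE.
rewrite cardsT card_fprod; apply: eq_bigr => i _.
by rewrite -card_Sn; apply: eq_card => t; rewrite !inE.
Qed.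

End blocks.

(** Two maps whose fibres have the same cardinals differ by a permutation of the
    source: match the fibres one by one. *)
Lemma permutation_of_fibers (I : eqType) m (f g : 'I_m -> I) :
  (forall i, #|[pred l | f l == i]| = #|[pred l | g l == i]|) ->
  exists p : 'S_m, forall l, f (p l) = g l.
Proof.
move=> fg; have : perm_eq [tuple g l | l < m] [tuple f l | l < m].
  apply/allP => i _ /=; rewrite !count_map; apply/eqP.
  by have := fg i; rewrite !cardE /enum_mem !size_filter => ->.
move=> /tuple_permP[p /val_inj e]; exists p => l.
by have := congr1 (fun t : m.-tuple I => tnth t l) e; rewrite !tnth_mktuple.
Qed.

Section pairing.
Variable m : nat.

Lemma dbl_subproof (e : bool) (l : 'I_m) : (l.*2 + e < m * 2)%N.
Proof.
by rewrite -muln2 (leq_trans (n := (l.+1 * 2)%N)) ?leq_mul2r ?ltn_ord ?orbT //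
  mulSn addnC ltn_add2r; case: e.
Qed.

Definition dbl (e : bool) (l : 'I_m) : 'I_(m * 2) := Ordinal (dbl_subproof e l).

Lemma half_subproof (t : 'I_(m * 2)) : (t./2 < m)%N.
Proof. by rewrite ltn_half_double -muln2 ltn_ord. Qed.

Definition half_ord (t : 'I_(m * 2)) : 'I_m := Ordinal (half_subproof t).

Lemma dbl_half (t : 'I_(m * 2)) : dbl (odd t) (half_ord t) = t.
Proof. by apply: val_inj; rewrite /= addnC odd_double_half. Qed.

Lemma half_dbl e l : half_ord (dbl e l) = l.
Proof. by apply: val_inj; rewrite /= addnC half_bit_double. Qed.

Lemma odd_dbl e l : odd (dbl e l) = e.
Proof. by rewrite /= oddD odd_double /=; case: e. Qed.

Lemma dbl_inj e : injective (dbl e).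
Proof. by apply: (can_inj (g := half_ord)) => l; exact: half_dbl. Qed.

Lemma big_pairs (R : Type) (idx : R) (op : Monoid.com_law idx)
    (F : 'I_(m * 2) -> R) :
  \big[op/idx]_t F t = \big[op/idx]_l op (F (dbl false l)) (F (dbl true l)).
Proof.
rewrite big_split (bigID (fun t : 'I_(m * 2) => odd t)) /=.
rewrite Monoid.mulmC /=; congr (op _ _).
- rewrite (reindex_onto (dbl false) half_ord).
    by apply: eq_bigl => l; rewrite odd_dbl half_dbl eqxx.
  by move=> t ot; rewrite -[RHS]dbl_half (negbTE ot).
- rewrite (reindex_onto (dbl true) half_ord).
    by apply: eq_bigl => l; rewrite odd_dbl half_dbl eqxx.
  by move=> t ot; rewrite -[RHS]dbl_half ot.
Qed.

(** Permuting whole pairs repeats the same permutation twice, hence is even; this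
    is why the powers of a 2-form do not depend on the order of the factors. *)
Definition pair_perm (p : 'S_m) : 'S_(m * 2) :=
  (extend_perm (@dbl_inj false) p * extend_perm (@dbl_inj true) p)%g.

Lemma pair_permE p e l : pair_perm p (dbl e l) = dbl e (p l).
Proof.
have ne (l1 l2 : 'I_m) e1 : dbl e1 l1 != dbl (~~ e1) l2.
  by apply/eqP => /(congr1 (fun t : 'I_(m * 2) => odd t)); rewrite !odd_dbl; case: e1.
rewrite /pair_perm permM; case: e.
  by rewrite (extend_perm_out (iota := dbl false)) ?extend_perm_in // => j.
by rewrite extend_perm_in extend_perm_out // => j.
Qed.

Lemma odd_pair_perm p : odd_perm (pair_perm p) = false.
Proof. by rewrite odd_permM !odd_extend_perm addbb. Qed.

End pairing.

(** For antisymmetric A this is, up to the factor 2 ^ m * m!, the Pfaffian of A;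
    a power of a 2-form is such a sum in the values of the form on pairs of rows. *)
Definition pfsum (C : comPzRingType) m (A : 'I_(m * 2) -> 'I_(m * 2) -> C) : C :=
  \sum_(s : 'S_(m * 2)) (-1) ^+ s *
    \prod_(l < m) A (s (dbl false l)) (s (dbl true l)).

Section block_diagonal.
Variables (C : comPzRingType) (I : finType) (n_ : I -> nat) (m : nat).
Variables (iota1 : forall i, 'I_(n_ i) -> 'I_m).
Variables (iota2 : forall i, 'I_(n_ i * 2) -> 'I_(m * 2)).
Hypotheses (iota1P : blocks iota1) (iota2P : blocks iota2).
Hypothesis iota2E : forall i e (l : 'I_(n_ i)), iota2 (dbl e l) = dbl e (iota1 l) .
Variable A : 'I_(m * 2) -> 'I_(m * 2) -> C.
Hypothesis A0 : forall p q, block iota2P p != block iota2P q -> A p q = 0.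

Let term (s : 'S_(m * 2)) := (-1) ^+ s *
  \prod_(l < m) A (s (dbl false l)) (s (dbl true l)).

Let term_pair_perm p s : term (pair_perm p * s)%g = term s.
Proof.
rewrite /term odd_permM odd_pair_perm /=; congr (_ * _).
rewrite [RHS](reindex_inj (@perm_inj _ p)); apply: eq_bigr => l _.
by rewrite !(permM (pair_perm p)) !pair_permE.
Qed.

Let block_dbl e l : block iota2P (dbl e l) = block iota1P l.
Proof. by have [j lE] := blockP iota1P l; rewrite {1}lE -iota2E block_iota. Qed.

Let sorting_perms s : term s != 0 ->
  #|[pred p : 'S_m | (pair_perm p * s)%g \in block_preserving iota2P]| =
  (\prod_i (n_ i)`!)%N.
Proof.
move=> ts0; pose f l := block iota2P (s (dbl false l)).
have sf e l : block iota2P (s (dbl e l)) = f l.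
  case: e => //; apply/eqP; apply: contraNT ts0 => /eqP ne.
  by rewrite /term (bigD1 l) //= A0 ?mul0r ?mulr0 // eq_sym; apply/eqP.
have fibers i : #|[pred l | f l == i]| = #|[pred l | block iota1P l == i]|.
  have H (g : 'I_m -> I) (h : 'I_(m * 2) -> I) : (forall e l, h (dbl e l) = g l) ->
      #|[pred t | h t == i]| = (#|[pred l | g l == i]| * 2)%N.
    move=> hg; rewrite -!sum1_card big_mkcond /= big_pairs big_split /=.
    rewrite [in RHS]big_mkcond /=.
    have twice (a b c : nat) : a = c -> b = c -> (a + b = c * 2)%N.
      by move=> -> ->; rewrite muln2 addnn.
    by apply: twice; apply: eq_bigr => l _; rewrite !inE hg.
  apply/eqP; rewrite -(@eqn_pmul2r 2) //; apply/eqP.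
  apply: etrans (esym (H f (fun t => block iota2P (s t)) sf)) _.
  apply: etrans (H (block iota1P) (block iota2P) block_dbl).
  rewrite -!sum1_card; rewrite [RHS](reindex_inj (@perm_inj _ s)).
  exact: eq_bigl.
have [p0 p0E] := permutation_of_fibers fibers.
rewrite -(card_block_preserving iota1P) -!sum1_card.
rewrite (reindex_inj (mulIg p0)) /=; apply: eq_bigl => p; rewrite !inE.
apply/forallP/forallP => h t.
  have := h (dbl false t); rewrite permM pair_permE permM.
  by rewrite -/(f _) p0E block_dbl.
rewrite -(dbl_half t) permM pair_permE permM sf p0E !block_dbl.
exact: h.
Qed.

(** The multinomial identity behind the formula for the volume of a product. A
    nonzero term pairs only indices of a common block, so that for exactly
    prod n_i! of the m! permutations p of the pairs, pair_perm p sends the term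
    to a block-preserving one of equal value. Double counting the couples (s, p)
    gives the factor m! / prod n_i!. *)
Lemma pfsum_block_diagonal :
  pfsum A * (\prod_i (n_ i)`!)%:R =
  m`!%:R * \prod_i pfsum (fun p q : 'I_(n_ i * 2) => A (iota2 p) (iota2 q)).
Proof.
have blockwise : \sum_(s in block_preserving iota2P) term s =
    \prod_i pfsum (fun p q : 'I_(n_ i * 2) => A (iota2 p) (iota2 q)).
  apply: (sum_block_preserving (F := fun i (t : 'S_(n_ i * 2)) =>
    (-1) ^+ t * \prod_(l < n_ i)
      A (iota2 (t (dbl false l))) (iota2 (t (dbl true l))))) => sg.
  rewrite /term (sign_block_perm iota2P) big_split /=; congr (_ * _).
  rewrite (big_blocks iota1P); apply: eq_bigr => i _; apply: eq_bigr => l _.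
  by rewrite -!iota2E !block_perm_iota.
rewrite -blockwise /pfsum mulr_suml.
transitivity (\sum_(s : 'S_(m * 2)) \sum_(p : 'S_m |
    (pair_perm p * s)%g \in block_preserving iota2P) term s).
  apply: eq_bigr => s _; rewrite -/(term s) sumr_const mulr_natr.
  by have [->|/sorting_perms <-] := eqVneq (term s) 0; rewrite ?mul0rn.
rewrite (exchange_big_dep xpredT) //=.
rewrite mulr_natl -card_Sn -sumr_const /=.
apply: eq_big => [p|p _]; first by rewrite !inE.
rewrite [RHS](reindex_inj (mulgI (pair_perm p))) /=.
by apply: eq_bigr => s _; rewrite term_pair_perm.
Qed.

End block_diagonal.

(** * Alternating forms *)

Section forms.
Context {R : realType}.
Local Notation C := R[i].
Implicit Types k n : nat.

Definition real_multilinear k n (a : Defs.form (R := R) k n) : Prop :=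
  forall (A B B' : 'M[C]_(k, n)) (i : 'I_k) (b b' : R),
     row i A = b%:C%C *: row i B + b'%:C%C *: row i B' ->
     row' i B = row' i A -> row' i B' = row' i A ->
     a A = b%:C%C * a B + b'%:C%C * a B'.

Definition set_row k n (M : 'M[C]_(k, n)) (l : 'I_k) (v : 'rV[C]_n) :
    'M[C]_(k, n) :=
  \matrix_(i, j) if i == l then v 0 j else M i j.

Lemma row_set_row k n (M : 'M[C]_(k, n)) l v : row l (set_row M l v) = v.
Proof. by apply/rowP => j; rewrite !mxE eqxx. Qed.

Lemma row_set_row_neq k n (M : 'M[C]_(k, n)) l i v :
  i != l -> row i (set_row M l v) = row i M.
Proof. by move=> il; apply/rowP => j; rewrite !mxE (negbTE il). Qed.

Lemma row'_set_row k n (M : 'M[C]_(k, n)) l v : row' l (set_row M l v) = row' l M.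
Proof. by apply/matrixP => i j; rewrite !mxE eq_sym (negbTE (neq_lift _ _)). Qed.

Lemma set_row_id k n (M : 'M[C]_(k, n)) l : set_row M l (row l M) = M.
Proof. by apply/matrixP => i j; rewrite !mxE; case: eqP => [->|]. Qed.

Section multilinear.
Variables (k n : nat) (a : Defs.form (R := R) k n) (aP : real_multilinear a).

Lemma multilinear_set_row M l (b b' : R) v v' :
  a (set_row M l (b%:C%C *: v + b'%:C%C *: v')) =
  b%:C%C * a (set_row M l v) + b'%:C%C * a (set_row M l v').
Proof. by apply: (aP (i := l)); rewrite ?row_set_row ?row'_set_row. Qed.

Lemma multilinear_set_rowD M l v v' :
  a (set_row M l (v + v')) = a (set_row M l v) + a (set_row M l v').
Proof.
by have := multilinear_set_row M l 1 1 v v'; rewrite !scale1r !mul1r.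
Qed.

Lemma multilinear_row0 (M : 'M[C]_(k, n)) l : row l M = 0 -> a M = 0.
Proof.
move=> M0; have := aP (A := M) (B := M) (B' := M) (i := l) (b := 0) (b' := 0).
by rewrite !scale0r !mul0r !addr0; apply.
Qed.

Lemma multilinear_set_row_sum M l (J : finType) (c : J -> R) (v : J -> 'rV[C]_n) :
  a (set_row M l (\sum_j (c j)%:C%C *: v j)) =
  \sum_j (c j)%:C%C * a (set_row M l (v j)).
Proof.
elim/big_rec2: _ => [|j x y _ IH].
  by apply: (multilinear_row0 (l := l)); rewrite row_set_row.
have := multilinear_set_row M l (c j) 1 (v j) y.
by rewrite scale1r mul1r => ->; rewrite IH.
Qed.

End multilinear.

Section alternating.
Variables (k n : nat) (a : Defs.form (R := R) k n) (aP : is_form a).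

Lemma form_swap (M : 'M[C]_(k, n)) (i j : 'I_k) :
  i != j -> a (row_perm (tperm i j) M) = - a M.
Proof.
case: aP => aL aA ij.
pose V v w := set_row (set_row M i v) j w.
have VE v w : V v w = set_row (set_row M j w) i v.
  apply/matrixP => x y; rewrite !mxE; case: (eqVneq x j) => [->|//].
  by rewrite eq_sym (negbTE ij).
pose v := row i M; pose w := row j M.
have VM : V v w = M by rewrite /V set_row_id set_row_id.
have VM' : V w v = row_perm (tperm i j) M.
  apply/matrixP => x y; rewrite !mxE; case: tpermP => [->|->|/eqP xi /eqP xj].
  - by rewrite (negbTE ij) eqxx.
  - by rewrite eqxx.
  - by rewrite (negbTE xi) (negbTE xj).
have V0 u : a (V u u) = 0.
  by apply: (aA _ i j ij); rewrite /V row_set_row row_set_row_neq ?row_set_row.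
have := V0 (v + w).
rewrite {1}/V multilinear_set_rowD // -!/(V _ _) !VE !multilinear_set_rowD //.
by rewrite -!VE !V0 add0r addr0 VM VM' => /eqP; rewrite addr_eq0 => /eqP.
Qed.

Lemma form_row_perm (M : 'M[C]_(k, n)) (s : 'S_k) :
  a (row_perm s M) = (-1) ^+ s * a M.
Proof.
have [ts -> tsP] := prod_tpermP s.
elim: ts tsP => [_|[x y] ts IH /= /andP[xy /IH {}IH]].
  by rewrite big_nil odd_perm1 row_perm1 mul1r.
rewrite big_cons row_permM form_swap // IH odd_mul_tperm xy.
by rewrite signr_addb /= expr1 mulN1r mulNr.
Qed.

End alternating.

Lemma frame_span n (v : 'rV[C]_n) :
  exists c : 'I_(n * 2) -> R, v = \sum_q (c q)%:C%C *: row q (real_frame n).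
Proof.
pose c (q : 'I_(n * 2)) := if odd q then complex.Im (v 0 (half_ord q))
                           else complex.Re (v 0 (half_ord q)).
exists c; rewrite big_pairs; apply/rowP => j; rewrite summxE (bigD1 j) //=.
rewrite big1 ?addr0; last first.
  move=> l lj; rewrite !mxE /= !addn0 addn1 /= uphalf_double doubleK.
  by rewrite val_eqE (negbTE lj) !mulr0 addr0.
rewrite !mxE /= addn0 addn1 /= uphalf_double doubleK eqxx.
rewrite /c !half_dbl !odd_dbl odd_double /= mulr1.
by case: (v 0 j) => x y; simpc.
Qed.

(** A top degree form is a multiple of the determinant: expanding the rows one by
    one on the real frame leaves rows that are frame vectors, which either repeat
    or are a permutation of the frame. *)
Lemma top_form_eq n (a b : Defs.form (R := R) (n * 2) n) :
  is_form a -> is_form b -> a (real_frame n) = b (real_frame n) ->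
  forall M, a M = b M.
Proof.
move=> aP bP ab.
suff H j : (j <= n * 2)%N -> forall M : 'M[C]_(n * 2, n),
    (exists h : 'I_(n * 2) -> 'I_(n * 2),
      forall i : 'I_(n * 2), (j <= i)%N -> row i M = row (h i) (real_frame n)) ->
    a M = b M.
  move=> M; apply: (H (n * 2)%N) => //; exists id => i.
  by rewrite leqNgt ltn_ord.
elim: j => [_ M [h hM]|j IH jn M [h hM]].
  have -> : M = rowsub h (real_frame n).
    by apply/row_matrixP => i; rewrite hM // row_rowsub.
  have [/injectiveP h_inj|/injectivePn[i [j ij hij]]] := boolP (injectiveb h).
    pose s := perm h_inj.
    have -> : rowsub h (real_frame n) = row_perm s (real_frame n) :> 'M[C]_(_, _).
      by apply/matrixP => x y; rewrite !mxE permE.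
    by rewrite !form_row_perm // ab.
  have e : row i (rowsub h (real_frame n)) = row j (rowsub h (real_frame n)) :>
      'rV[C]_n by rewrite !row_rowsub hij.
  by rewrite (aP.2 _ _ _ ij e) (bP.2 _ _ _ ij e).
pose l := Ordinal jn; have [c cE] := frame_span (row l M).
rewrite -(set_row_id M l) cE !multilinear_set_row_sum; [|exact: bP.1|exact: aP.1].
apply: eq_bigr => q _; congr (_ * _); apply: (IH (ltnW jn)).
exists (fun i => if i == l then q else h i) => i ji.
case: eqP => [->|/eqP il]; first by rewrite row_set_row.
rewrite row_set_row_neq // hM // ltn_neqAle ji andbT.
by apply: contraNneq il => e; apply/eqP/val_inj.
Qed.

Definition antisymmetrize k n (g : Defs.form (R := R) k n) : Defs.form (R := R) k n :=
  fun M => \sum_(s : 'S_k) (-1) ^+ s * g (row_perm s M).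

Lemma is_form_scale k n (c : C) (g : Defs.form (R := R) k n) :
  is_form g -> is_form (fun M => c * g M).
Proof.
move=> [gL gA]; split=> [A B B' i b b' h1 h2 h3|A i i' ii' h].
  by rewrite (gL _ _ _ _ _ _ h1 h2 h3) mulrDr !(mulrCA c).
by rewrite (gA _ _ _ ii' h) mulr0.
Qed.

Lemma row'_row_perm k n (s : 'S_k) (A B : 'M[C]_(k, n)) i :
  row' i B = row' i A ->
  row' (s^-1 i)%g (row_perm s B) = row' (s^-1 i)%g (row_perm s A).
Proof.
move=> e; apply/matrixP => x y; rewrite !mxE.
have : i != s (lift (s^-1 i)%g x).
  by rewrite -(inj_eq (@perm_inj _ s^-1)) permK neq_lift.
by move=> /unlift_some[z -> _]; have /matrixP/(_ z y) := e; rewrite !mxE.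
Qed.

Lemma is_form_antisymmetrize k n (g : Defs.form (R := R) k n) :
  real_multilinear g -> is_form (antisymmetrize g).
Proof.
move=> gL; split=> [A B B' i b b' h1 h2 h3|A i i' ii' h].
  rewrite /antisymmetrize !mulr_sumr -big_split /=; apply: eq_bigr => s _.
  rewrite (gL _ (row_perm s B) (row_perm s B') (s^-1 i)%g b b').
  - by rewrite mulrDr !(mulrCA ((-1) ^+ s)).
  - by apply/rowP => j; have /rowP/(_ j) := h1; rewrite !mxE permKV.
  - exact: row'_row_perm.
  - exact: row'_row_perm.
have /eqP : antisymmetrize g A = - antisymmetrize g A.
  rewrite {1}/antisymmetrize (reindex_inj (mulIg (tperm i i'))) -sumrN.
  apply: eq_bigr => s _; rewrite odd_permM odd_tperm ii' addbT signrN mulNr.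
  congr (- (_ * g _)); apply/matrixP => x y; rewrite !mxE permM.
  by have /rowP/(_ y) := h; rewrite !mxE => e; case: tpermP => [->|->|].
by rewrite -addr_eq0 -mulr2n mulrn_eq0 => /eqP.
Qed.

Lemma row'_eq k n (A B : 'M[C]_(k, n)) l :
  row' l B = row' l A -> forall x, x != l -> row x B = row x A.
Proof.
move=> /matrixP e x; rewrite eq_sym => /unlift_some[z -> _].
by apply/rowP => y; have := e z y; rewrite !mxE.
Qed.

Lemma eq_row' k n (A B : 'M[C]_(k, n)) l :
  (forall x, x != l -> row x B = row x A) -> row' l B = row' l A.
Proof.
move=> e; apply/matrixP => x y; rewrite !mxE.
have nx : lift l x != l by rewrite eq_sym neq_lift.
by have /rowP/(_ y) := e _ nx; rewrite !mxE.
Qed.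

(** Each row of the matrix enters exactly one factor, since the blocks partition
    the rows. *)
Lemma multilinear_prod (I : finType) (k_ : I -> nat) k n
    (iota : forall i, 'I_(k_ i) -> 'I_k) (a : forall i, Defs.form (R := R) (k_ i) n) :
  blocks iota -> (forall i, real_multilinear (a i)) ->
  real_multilinear (fun M => \prod_i a i (rowsub (iota i) M)).
Proof.
move=> bP aP A B B' l b b' h1 h2 h3.
have [j lE] := blockP bP l; set i0 := block bP l in j lE.
rewrite !(bigD1 (P := xpredT) i0) //=.
have rest M : row' l M = row' l A ->
    \prod_(i | i != i0) a i (rowsub (iota i) M) =
    \prod_(i | i != i0) a i (rowsub (iota i) A).
  move=> /row'_eq e; apply: eq_bigr => i ii0; congr (a i _).
  apply/row_matrixP => x; rewrite !row_rowsub e //.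
  by apply: contra ii0 => /eqP xl; rewrite -(block_iota bP x) xl.
rewrite !rest // !mulrA -mulrDl; congr (_ * _).
have sub M : row' l M = row' l A ->
    row' j (rowsub (iota i0) M) = row' j (rowsub (iota i0) A).
  move=> /row'_eq e; apply: eq_row' => x xj; rewrite !row_rowsub e //.
  by rewrite lE; apply: contra xj => /eqP/(blocks_inj bP) ->.
by apply: (aP i0 _ _ _ j); rewrite ?sub // !row_rowsub -lE.
Qed.

Lemma multilinear_pullback k m n (L : {linear 'rV[C]_n -> 'rV[C]_m})
    (a : Defs.form (R := R) k m) :
  real_multilinear a -> real_multilinear (pullback L a).
Proof.
move=> aP A B B' l b b' h1 h2 h3; apply: (aP _ _ _ l).
- by rewrite !rowK h1 linearD !linearZ.
- by apply: eq_row' => x xl; rewrite !rowK (row'_eq h2).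
- by apply: eq_row' => x xl; rewrite !rowK (row'_eq h3).
Qed.

Lemma multilinear_sum (I : finType) k n (a : I -> Defs.form (R := R) k n) :
  (forall i, real_multilinear (a i)) ->
  real_multilinear (fun M => \sum_i a i M).
Proof.
move=> aP A B B' l b b' h1 h2 h3; rewrite !mulr_sumr -big_split /=.
by apply: eq_bigr => i _; exact: aP h1 h2 h3.
Qed.

Lemma col_mx_rows k n (p q : 'I_k) (M : 'M[C]_(k, n)) :
  col_mx (row p M) (row q M) = rowsub (fun j : 'I_2 => if j == 1 then q else p) M.
Proof.
apply/matrixP => x y; rewrite [RHS]mxE mxE.
case: splitP => x' xE; rewrite mxE; congr (M _ _).
  by rewrite -val_eqE /= xE ord1.
by rewrite -val_eqE /= xE ord1.
Qed.

Section wedge_pow.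
Variables (n : nat) (a : Defs.form (R := R) 2 n).

(** Unfolding the recursion gives nested sums over permutations; each inner
    permutation is absorbed in the outer one, which cancels the factorials of the
    normalization and leaves a single signed sum over pairings of the rows. *)
Lemma wedge_powE m (M : 'M[C]_(m * 2, n)) :
  wedge_pow a m M =
  (2 ^+ m)^-1 * pfsum (fun p q => a (col_mx (row p M) (row q M))).
Proof.
elim: m M => [|m IH] M.
  rewrite /= expr0 invr1 mul1r /pfsum (big_pred1 1%g); last first.
    by move=> s; rewrite /=; apply/esym/eqP/permP => -[].
  by rewrite odd_perm1 big_ord0 mulr1.
rewrite /= /wedge.
pose G (s : 'S_(2 + m * 2)) := a (usubmx (row_perm s M)) *
  \prod_(l < m) a (col_mx (row (s (rshift 2 (dbl false l))) M)
                          (row (s (rshift 2 (dbl true l))) M)).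
have GE s : G s = \prod_(l < m.+1) a (col_mx (row (s (dbl false l)) M)
                                             (row (s (dbl true l)) M)).
  rewrite big_ord_recl; congr (_ * _).
    congr a; apply/matrixP => x y; rewrite !mxE.
    case: splitP => x' xE; rewrite !mxE; congr (M (s _) _); apply: val_inj => /=.
      by rewrite xE ord1.
    by rewrite xE ord1.
  apply: eq_bigr => l _; congr (a (col_mx (row (s _) _) (row (s _) _)));
    exact: val_inj.
pose ext (t : 'S_(m * 2)) : 'S_(2 + m * 2) := extend_perm (@rshift_inj 2 (m * 2)) t.
transitivity ((2`! * (m * 2)`!)%:R^-1 * \sum_(s : 'S_(2 + m * 2))
    \sum_(t : 'S_(m * 2)) (2 ^+ m)^-1 * ((-1) ^+ (ext t * s)%g * G (ext t * s)%g)).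
  congr (_ * _); apply: eq_bigr => s _; rewrite IH /pfsum !mulr_sumr.
  apply: eq_bigr => t _; rewrite /G.
  have -> : usubmx (row_perm (ext t * s)%g M) = usubmx (row_perm s M).
    apply/matrixP => x y; rewrite !mxE permM extend_perm_out // => j.
    by rewrite eq_rlshift.
  rewrite odd_permM signr_addb odd_extend_perm.
  under [in RHS]eq_bigr => l _ do rewrite !permM !extend_perm_in.
  have rE p : row p (dsubmx (row_perm s M)) = row (s (rshift 2 p)) M.
    by apply/rowP => y; rewrite !mxE.
  under [in LHS]eq_bigr => l _ do rewrite !rE.
  have shuffle (u v w y x : C) : u * (y * (v * (w * x))) = v * (w * u * (y * x)).
    by ring.
  exact: shuffle.
rewrite exchange_big /=.
pose S := \sum_(s : 'S_(2 + m * 2)) (-1) ^+ s * G s.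
transitivity ((2`! * (m * 2)`!)%:R^-1 * \sum_(t : 'S_(m * 2)) (2 ^+ m)^-1 * S).
  congr (_ * _); apply: eq_bigr => t _; rewrite -mulr_sumr; congr (_ * _).
  by rewrite /S [RHS](reindex_inj (mulgI (ext t))).
rewrite sum_Sn_const.
rewrite (_ : pfsum _ = S); last by apply: eq_bigr => s _; rewrite GE.
rewrite -[_ * S *+ _]mulr_natl natrM (_ : 2`! = 2%N) // exprS !invfM.
have f0 : (m * 2)`!%:R != 0 :> C by rewrite pnatr_eq0 -lt0n fact_gt0.
move: ((m * 2)`!%:R : C) f0 => f f0.
have cancel (x y : C) : 2^-1 * f^-1 * (f * (x * y)) = 2^-1 * x * y.
  by rewrite -!mulrA (mulrA _ f) mulVf // mul1r.
exact: cancel.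
Qed.

Lemma is_form_wedge_pow m : real_multilinear a -> is_form (wedge_pow a m).
Proof.
move=> aP.
pose iota (l : 'I_m) (j : 'I_2) : 'I_(m * 2) := dbl (j == 1) l.
pose g (M : 'M[C]_(m * 2, n)) := \prod_l a (rowsub (iota l) M).
have iotaP : blocks iota.
  pose bit (e : bool) : 'I_2 := if e then 1 else 0.
  exists (fun t : 'I_(m * 2) => existT (fun=> 'I_2) (half_ord t) (bit (odd t))).
    move=> [l j] /=; rewrite -/(iota l j) /iota half_dbl odd_dbl; congr existT.
    by case: j => -[|[|//]] j; apply: val_inj.
  move=> t /=; rewrite /iota (_ : (bit _ == 1) = odd t) ?dbl_half //.
  by case: (odd t).
have -> : wedge_pow a m = fun M => (2 ^+ m)^-1 * antisymmetrize g M.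
  apply/funext => M; rewrite wedge_powE /pfsum; congr (_ * _).
  apply: eq_bigr => s _; congr (_ * _); apply: eq_bigr => l _.
  rewrite col_mx_rows; congr a; apply/matrixP => x y; rewrite !mxE /iota.
  by case: (x == 1).
apply/is_form_scale/is_form_antisymmetrize.
exact: (multilinear_prod (a := fun _ : 'I_m => a) iotaP).
Qed.

End wedge_pow.

Section big_wedge.
Variables (r : nat) (k_ : 'I_r -> nat) (n : nat).
Variable a : forall i, Defs.form (R := R) (k_ i) n.
Arguments a : clear implicits.
Hypothesis aP : forall i, real_multilinear (a i).

Lemma blocks_Rank : blocks (@tagnat.Rank r k_).
Proof.
exists (@tagnat.sig r k_) => [[i j]|t] /=; first by rewrite /tagnat.Rank tagnat.rankK.
by rewrite -tagnat.rankE tagnat.sigK.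
Qed.

Lemma is_form_big_wedge : is_form (big_wedge a).
Proof.
apply: (is_form_scale _ (@is_form_antisymmetrize _ _
  (fun M => \prod_i a i (rowsub (@tagnat.Rank r k_ i) M)) _)).
by apply: multilinear_prod => //; exact: blocks_Rank.
Qed.

(** When the row t of M is annihilated by the forms of all other blocks, only the
    block-preserving permutations contribute, and alternation makes all their
    contributions equal. *)
Lemma big_wedge_diag (M : 'M[C]_(\sum_i k_ i, n)) :
  (forall i, is_form (a i)) ->
  (forall i t l (B : 'M[C]_(k_ i, n)), block blocks_Rank t != i ->
     row l B = row t M -> a i B = 0) ->
  big_wedge a M = \prod_i a i (submxcol M i).
Proof.
move=> aF a0; rewrite /big_wedge.
rewrite (bigID (block_preserving blocks_Rank)) /= [X in _ + X]big1 ?addr0; last first.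
  move=> s; rewrite negb_forall => /existsP[t /negP st].
  have [j tE] := blockP blocks_Rank t; set i := block _ t in st j tE.
  apply/eqP; rewrite mulf_eq0; apply/orP; right; apply/prodf_eq0; exists i => //.
  apply/eqP/(a0 i (s t) j); first exact/negP.
  by apply/rowP => y; rewrite !mxE -tE.
rewrite (sum_block_preserving (F := fun i (t : 'S_(k_ i)) => a i (submxcol M i))).
  rewrite (_ : \prod_i \sum_t _ = (\prod_i (k_ i)`!)%:R * \prod_i a i (submxcol M i)).
    rewrite mulrA mulVf ?mul1r // pnatr_eq0 -lt0n prodn_gt0 // => i.
    exact: fact_gt0.
  rewrite natr_prod -big_split /=; apply: eq_bigr => i _.
  by rewrite sum_Sn_const mulr_natl.
move=> sg; rewrite sign_block_perm -big_split /=; apply: eq_bigr => i _.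
rewrite (_ : submxcol _ _ = row_perm (sg i) (submxcol M i)).
  by rewrite form_row_perm // mulrA -signr_addb addbb mul1r.
by apply/matrixP => x y; rewrite !mxE block_perm_iota.
Qed.

End big_wedge.

End forms.

(** * Forms pulled back from the factors *)

Section product_forms.
Context {R : realType}.
Local Notation C := R[i].

Lemma is_form_pullback k m n (L : {linear 'rV[C]_n -> 'rV[C]_m})
    (a : Defs.form (R := R) k m) : is_form a -> is_form (pullback L a).
Proof.
move=> [aL aA]; split; first exact: multilinear_pullback.
by move=> A i i' ii' e; apply: (aA _ i i' ii'); rewrite !rowK e.
Qed.

(** The degrees N * 2 and sum (n_i * 2) are equal but not convertible. *)
Lemma is_form_castmx k k' n (E : k = k') (a : Defs.form (R := R) k' n) :
  is_form a -> is_form (fun M => a (castmx (E, erefl) M)).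
Proof.
case: _ / E a => a aF.
by rewrite (_ : (fun M => _) = a) //; apply/funext => M; rewrite castmx_id.
Qed.

Variables (r : nat) (n_ : 'I_r -> nat).
Local Notation N := (\sum_(i < r) n_ i)%N.

Definition proj i : 'rV[C]_N -> 'rV[C]_(n_ i) := fun w => submxrow w i.

Lemma proj_is_linear i : linear (@proj i).
Proof. by move=> c u v; apply/rowP => j; rewrite !mxE. Qed.

HB.instance Definition _ i :=
  GRing.isLinear.Build C 'rV[C]_N 'rV[C]_(n_ i) _ (@proj i) (@proj_is_linear i).

(** The real coordinates of the block i among those of the product; real and
    imaginary parts are interleaved, so a coordinate is a pair (complex
    coordinate, parity). *)
Definition iota2 i (q : 'I_(n_ i * 2)) : 'I_(N * 2) :=
  dbl (odd q) (@tagnat.Rank r n_ i (half_ord q)).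

Lemma iota2_dbl i e (l : 'I_(n_ i)) : iota2 (dbl e l) = dbl e (tagnat.Rank i l).
Proof. by rewrite /iota2 odd_dbl half_dbl. Qed.

Lemma blocks_iota2 : blocks iota2.
Proof.
pose g (t : 'I_(N * 2)) := (fun p : {i & 'I_(n_ i)} =>
  Tagged (fun i => 'I_(n_ i * 2)) (dbl (odd t) (tagged p))) (tagnat.sig (half_ord t)).
exists g => [[i q]|t] /=.
  by rewrite /g /iota2 half_dbl odd_dbl /tagnat.Rank tagnat.rankK /= dbl_half.
by rewrite iota2_dbl -tagnat.rankE tagnat.sigK dbl_half.
Qed.

Lemma Rank_cast (E : (N * 2 = \sum_(i < r) n_ i * 2)%N) i (q : 'I_(n_ i * 2)) :
  tagnat.Rank i q = cast_ord E (iota2 q).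
Proof.
apply: ord_inj; rewrite tagnat.RankEsum.
have -> : cast_ord E (iota2 q) = ((tagnat.Rank i (half_ord q)).*2 + odd q)%N :> nat.
  by [].
rewrite tagnat.RankEsum -big_distrl /= muln2 doubleD -addnA (addnC _./2.*2).
by rewrite odd_double_half.
Qed.

Lemma proj_frame_diag i (q : 'I_(n_ i * 2)) :
  proj i (row (iota2 q) (real_frame N)) = row q (real_frame (n_ i)) :> 'rV[C]__.
Proof.
apply/rowP => j; rewrite !mxE /= addnC half_bit_double oddD odd_double.
by rewrite addbF oddb tagnat.eq_Rank eqxx.
Qed.

Lemma proj_frame_off i i' (q : 'I_(n_ i * 2)) : i != i' ->
  proj i' (row (iota2 q) (real_frame N)) = 0 :> 'rV[C]__.
Proof.
move=> ii'; apply/rowP => j; rewrite !mxE /= addnC half_bit_double.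
by rewrite tagnat.eq_Rank (negbTE ii').
Qed.

Section wedge.
Variable a : forall i, Defs.form (R := R) (n_ i * 2) (n_ i).
Arguments a : clear implicits.
Hypothesis aF : forall i, is_form (a i).
Variable E : (N * 2 = \sum_(i < r) n_ i * 2)%N.

Lemma is_form_big_wedge_proj : is_form (fun M : 'M[C]_(N * 2, N) =>
  big_wedge (fun i => pullback (@proj i) (a i)) (castmx (E, erefl) M)).
Proof.
apply/is_form_castmx/is_form_big_wedge => i.
by have [] := is_form_pullback (@proj i) (aF i).
Qed.

(** On the product frame each vector lives in one factor, so the wedge product is
    diagonal. *)
Lemma big_wedge_frame :
  big_wedge (fun i => pullback (@proj i) (a i))
    (castmx (E, erefl) (real_frame N)) = \prod_i a i (real_frame (n_ i)).
Proof.
have rowE i q : row (tagnat.Rank i q) (castmx (E, erefl) (real_frame N)) =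
    row (iota2 q) (real_frame N) :> 'rV[C]_N.
  rewrite (Rank_cast E); apply/rowP => j; rewrite mxE [RHS]mxE castmxE /=.
  by rewrite cast_ordK cast_ord_id.
rewrite big_wedge_diag.
- apply: eq_bigr => i _; congr (a i _); apply/row_matrixP => q; rewrite rowK.
  by rewrite row_rowsub rowE proj_frame_diag.
- by move=> i; exact: is_form_pullback.
move=> i t l B bt lt; apply: (@multilinear_row0 _ _ _ _ (aF i).1 _ l).
have [q tE] := blockP (blocks_Rank (fun i => n_ i * 2)%N) t.
by rewrite rowK lt tE rowE proj_frame_off.
Qed.

End wedge.

Lemma pullback_col_mx m n (f : 'rV[C]_n -> 'rV[C]_m) (a : Defs.form (R := R) 2 m)
    (u v : 'rV[C]_n) :
  pullback f a (col_mx u v) = a (col_mx (f u) (f v)).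
Proof.
rewrite /pullback; congr a; apply/matrixP => x y; rewrite mxE [RHS]mxE.
case: splitP => j xE; rewrite ord1; congr (f _ 0 y); apply/rowP => k;
  rewrite !mxE; case: splitP => j' xE'; rewrite ?[j']ord1 //;
  by move: xE'; rewrite xE !ord1.
Qed.

Lemma wedge_pow_frame (b : forall i, Defs.form (R := R) 2 (n_ i)) :
  (forall i, real_multilinear (b i)) ->
  wedge_pow (fun M => \sum_i pullback (@proj i) (b i) M) N (real_frame N) =
  N`!%:R / (\prod_i (n_ i)`!)%:R *
    \prod_i wedge_pow (b i) (n_ i) (real_frame (n_ i)).
Proof.
move=> bL.
pose F t := row t (real_frame N) : 'rV[C]_N.
pose A (p q : 'I_(N * 2)) := \sum_i b i (col_mx (proj i (F p)) (proj i (F q))).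
have row0u i (v : 'rV[C]_(n_ i)) : b i (col_mx (0 : 'rV[C]_(n_ i)) v) = 0.
  apply: (@multilinear_row0 _ _ _ _ (bL i) _ 0); apply/rowP => j.
  by rewrite mxE [LHS]mxE; case: splitP => x; rewrite ?ord1 // !mxE.
have row0d i (v : 'rV[C]_(n_ i)) : b i (col_mx v (0 : 'rV[C]_(n_ i))) = 0.
  apply: (@multilinear_row0 _ _ _ _ (bL i) _ 1); apply/rowP => j.
  by rewrite mxE [LHS]mxE; case: splitP => x; rewrite ?ord1 // !mxE.
have A0 p q : block blocks_iota2 p != block blocks_iota2 q -> A p q = 0.
  have [p' ->] := blockP blocks_iota2 p; have [q' ->] := blockP blocks_iota2 q.
  rewrite !block_iota => pq; rewrite /A big1 // => i _.
  have [e|pi] := eqVneq (block blocks_iota2 p) i; last by rewrite proj_frame_off.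
  by rewrite [X in col_mx _ X]proj_frame_off // -e eq_sym.
have AE i p q : A (iota2 p) (iota2 q) =
    b i (col_mx (row p (real_frame (n_ i))) (row q (real_frame (n_ i)))).
  rewrite /A (bigD1 i) //= !proj_frame_diag big1 ?addr0 // => j ji.
  by rewrite proj_frame_off // eq_sym.
rewrite wedge_powE (_ : pfsum _ = pfsum A); last first.
  apply: eq_bigr => s _; congr (_ * _); apply: eq_bigr => l _.
  by apply: eq_bigr => i _; rewrite pullback_col_mx.
have := pfsum_block_diagonal (blocks_Rank n_) iota2_dbl A0.
have f0 : (\prod_i (n_ i)`!)%:R != 0 :> C.
  by rewrite pnatr_eq0 -lt0n prodn_gt0 // => i; exact: fact_gt0.
move=> /(canRL (mulfK f0)) ->.
pose B i (p q : 'I_(n_ i * 2)) :=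
  b i (col_mx (row p (real_frame (n_ i))) (row q (real_frame (n_ i)))).
have -> : \prod_i wedge_pow (b i) (n_ i) (real_frame (n_ i)) =
    (2 ^+ N)^-1 * \prod_i pfsum (@B i).
  rewrite expr_sum -prodfV -big_split /=; apply: eq_bigr => i _.
  exact: wedge_powE.
have -> : \prod_i pfsum (fun p q : 'I_(n_ i * 2) => A (iota2 p) (iota2 q)) =
    \prod_i pfsum (@B i).
  apply: eq_bigr => i _; apply: eq_bigr => s _; congr (_ * _).
  by apply: eq_bigr => l _; rewrite AE.
have shuffle (x y z w : C) : x * (y * z * w) = y * w * (x * z) by ring.
exact: shuffle.
Qed.

(** The form-theoretic core: if each b_i has top power c_i a_i, then the sum of
    the pulled back b_i has top power prod c_i times the product volume. Both
    sides are top degree forms, so it suffices to compare them on the real frame,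
    where the matrix of values is block diagonal and pfsum_block_diagonal gives
    the multinomial factor. *)
Lemma wedge_pow_product (b : forall i, Defs.form (R := R) 2 (n_ i))
    (a : forall i, Defs.form (R := R) (n_ i * 2) (n_ i)) (c : 'I_r -> C)
    (E : (N * 2 = \sum_(i < r) n_ i * 2)%N) :
  (forall i, real_multilinear (b i)) -> (forall i, is_form (a i)) ->
  (forall i M, wedge_pow (b i) (n_ i) M = c i * a i M) ->
  forall M, wedge_pow (fun M => \sum_i pullback (@proj i) (b i) M) N M =
    \prod_i c i * (N`!%:R / (\prod_i (n_ i)`!)%:R *
      big_wedge (fun i => pullback (@proj i) (a i)) (castmx (E, erefl) M)).
Proof.
move=> bL aF ba; apply: top_form_eq.
- apply: is_form_wedge_pow; apply: multilinear_sum => i.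
  exact: multilinear_pullback.
- by do 2![apply: is_form_scale]; exact: is_form_big_wedge_proj.
rewrite wedge_pow_frame // big_wedge_frame //.
rewrite [X in _ * X = _](_ : _ = \prod_i (c i * a i (real_frame (n_ i)))).
  by rewrite big_split /= mulrCA.
by apply: eq_bigr => i _; exact: ba.
Qed.

End product_forms.

Local Open Scope classical_set_scope.
Local Open Scope ring_scope.

(** * Lebesgue measure on real coordinates *)

Section boxes.
Context {R : realType}.
Notation R_ := (measurableTypeR R).
Local Notation leb := (@lebesgue_measure R).

Definition box k (A : 'I_k -> set R_) : set (k.-tuple R_) :=
  [set t | forall i, A i (tnth t i)].

Lemma box_bigcap k (A : 'I_k -> set R_) :
  box A = \bigcap_(i in [set: 'I_k]) ((fun t : k.-tuple R_ => tnth t i) @^-1` A i).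
Proof. by apply/seteqP; split=> t /= tA i => [_|]; exact: tA. Qed.

Lemma measurable_box k (A : 'I_k -> set R_) :
  (forall i, measurable (A i)) -> measurable (box A).
Proof.
move=> mA; rewrite box_bigcap; apply: fin_bigcap_measurable => // i _.
by rewrite -[X in measurable X]setTI; apply: measurable_tnth.
Qed.

Lemma measurable_boxes k : @measurable _ (k.-tuple R_) =
  <<s [set B | exists A : 'I_k -> set R_, (forall i, measurable (A i)) /\ B = box A] >>.
Proof.
apply/seteqP; split; last first.
  by apply: smallest_sub => [|_ [A [mA ->]]];
    [exact: sigma_algebra_measurable|exact: measurable_box].
apply: smallest_sub; first exact: smallest_sigma_algebra.
move=> B; rewrite -bigcup_seq => -[i _ [Y mY <-]]; rewrite setTI.
apply: sub_sigma_algebra; exists (fun j => if j == i then Y else setT); split.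
  by move=> j; case: ifP.
by apply/seteqP; split=> t /= tY; [move=> j; case: eqP => [->|]//|have := tY i; rewrite eqxx].
Qed.

Lemma lebesgue_tuple_box k (A : 'I_k -> set R_) : (forall i, measurable (A i)) ->
  lebesgue_tuple k (box A) = (\prod_(i < k) leb (A i))%E.
Proof.
elim: k A => [|k IH] A mA.
  rewrite big_ord0 /= diracE mem_set // => -[].
  by [].
rewrite big_ord_recl -IH; last by move=> i; exact: mA.
rewrite -product_measure1E //; last exact: measurable_box.
rewrite /= /lebesgue_cons /pushforward; congr (_ _).
apply/seteqP; split=> -[x t] /= => [tA|[xA tA] i].
  by split; [have := tA ord0|move=> i; have := tA (lift ord0 i); rewrite tnthS].
by case: (unliftP ord0 i) => [j ->|->]; rewrite ?tnthS.
Qed.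

(** Boxes form a pi-system that generates the product sigma-algebra and contains
    an exhaustion of finite measure. *)
Lemma lebesgue_tuple_unique k (m' : {measure set (k.-tuple R_) -> \bar R}) :
  (forall A : 'I_k -> set R_, (forall i, measurable (A i)) ->
     m' (box A) = (\prod_(i < k) leb (A i))%E) ->
  forall X, measurable X -> lebesgue_tuple k X = m' X.
Proof.
move=> m'E X mX.
pose g n := box (fun _ : 'I_k => `[- n%:R, n%:R]%classic : set R_).
apply: (measure_unique _ g (measurable_boxes k)) => //.
- move=> _ _ [A [mA ->]] [B [mB ->]]; exists (fun i => A i `&` B i); split.
    by move=> i; exact: measurableI.
  apply/seteqP; split=> t /=; first by move=> [tA tB] i; split.
  by move=> tAB; split=> i; have [] := tAB i.
- by move=> n; exists (fun=> `[- n%:R, n%:R]%classic); split => // i; exact: measurable_itv.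
- apply/seteqP; split=> // t _.
  have [n _ tn] : exists2 n : nat, True & forall i, `|tnth t i| <= n%:R.
    exists (\max_(i < k) (Num.trunc `|tnth t i|).+1)%N => // i.
    apply: (le_trans (ltW (truncnS_gt _))); rewrite ler_nat.
    exact: (leq_bigmax_cond (F := fun i => (Num.trunc `|tnth t i|).+1)).
  by exists n => // i /=; rewrite in_itv /= -ler_norml.
- by move=> A [B [mB ->]]; rewrite m'E //; exact: lebesgue_tuple_box.
move=> n; rewrite /= lebesgue_tuple_box; last by move=> i; exact: measurable_itv.
suff /andP[] : (0 <= \prod_(i < k) leb (`[(- n%:R)%R, n%:R%R]%classic : set R_) < +oo)%E.
  by [].
elim/big_ind: _ => [|x y /andP[x0 xoo] /andP[y0 yoo]|i _].
- by rewrite lee01 ltry.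
- by rewrite mule_ge0 // lte_mul_pinfty // ge0_fin_numE.
- rewrite measure_ge0 lebesgue_measure_itv /=; case: ifP => // _.
  by rewrite -EFinB ltry.
Qed.

Section merge.
Variables (a b k : nat) (iota : 'I_a -> 'I_k) (kappa : 'I_b -> 'I_k).
Variable e : 'I_k -> 'I_a + 'I_b.
Hypothesis e_iota : forall x, e (iota x) = inl x.
Hypothesis e_kappa : forall y, e (kappa y) = inr y.
Hypothesis eK : forall j, match e j with inl x => iota x | inr y => kappa y end = j.

(** Coordinates are split along an arbitrary bijection e of the index set, so a
    factor of the product need not occupy consecutive coordinates. *)
Definition merge (x : a.-tuple R_) (y : b.-tuple R_) : k.-tuple R_ :=
  [tuple match e j with inl l => tnth x l | inr l => tnth y l end | j < k].

Lemma tnth_merge_l x y l : tnth (merge x y) (iota l) = tnth x l.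
Proof. by rewrite tnth_mktuple e_iota. Qed.

Lemma tnth_merge_r x y l : tnth (merge x y) (kappa l) = tnth y l.
Proof. by rewrite tnth_mktuple e_kappa. Qed.

Lemma measurable_merge :
  measurable_fun setT (fun p : a.-tuple R_ * b.-tuple R_ => merge p.1 p.2).
Proof.
apply/measurable_fun_tnthP => j; case: (e j) (eK j) => l <-.
- rewrite (_ : _ \o _ = (fun t => tnth t l) \o fst).
    by apply: measurableT_comp => //; exact: measurable_tnth.
  by apply/funext => p; rewrite /= tnth_merge_l.
- rewrite (_ : _ \o _ = (fun t => tnth t l) \o snd).
    by apply: measurableT_comp => //; exact: measurable_tnth.
  by apply/funext => p; rewrite /= tnth_merge_r.
Qed.

Lemma big_merge (T : Type) (idx : T) (op : Monoid.com_law idx) (F : 'I_k -> T) :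
  \big[op/idx]_j F j = op (\big[op/idx]_x F (iota x)) (\big[op/idx]_y F (kappa y)).
Proof.
pose g (s : 'I_a + 'I_b) := match s with inl x => iota x | inr y => kappa y end.
rewrite (reindex g); last first.
  exists e => [s _|j _]; last exact: (eK j).
  by case: s => l; rewrite ?e_iota ?e_kappa.
by rewrite big_sumType.
Qed.

Local Notation mu := (lebesgue_tuple a \x lebesgue_tuple b)%E.

Let merge_mixin := isMeasurableFun.Build _ _ _ _ _ measurable_merge.
Let merge_pack : {mfun (a.-tuple R_ * b.-tuple R_)%type >-> k.-tuple R_} :=
  HB.pack (fun p : a.-tuple R_ * b.-tuple R_ => merge p.1 p.2) merge_mixin.

(** Fubini starts here: both measures give a box the product of its side lengths. *)
Lemma lebesgue_tuple_merge X : measurable X ->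
  lebesgue_tuple k X = pushforward mu (fun p => merge p.1 p.2) X.
Proof.
apply: (@lebesgue_tuple_unique k (pushforward mu merge_pack)) => A mA.
rewrite big_merge -!lebesgue_tuple_box //.
rewrite -[RHS]product_measure1E; [|exact: measurable_box..].
transitivity (mu ((fun p => merge p.1 p.2) @^-1` box A)); first by [].
rewrite (_ : _ @^-1` _ =
    box (fun l => A (iota l)) `*` box (fun l => A (kappa l))) //.
apply/seteqP; split=> -[x y] /= => [xyA|[xA yA] j].
  split=> l; first by have := xyA (iota l); rewrite tnth_merge_l.
  by have := xyA (kappa l); rewrite tnth_merge_r.
by case: (e j) (eK j) => l <-; rewrite ?tnth_merge_l ?tnth_merge_r.
Qed.

End merge.

Section shift.
Variables (k : nat) (c : 'I_k -> R).

Definition shift_tuple (t : k.-tuple R_) : k.-tuple R_ :=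
  [tuple tnth t i + c i | i < k].

Lemma measurable_shift : measurable_fun setT shift_tuple.
Proof.
apply/measurable_fun_tnthP => j.
rewrite (_ : _ \o _ = (fun x : R_ => x + c j) \o (fun t => tnth t j)).
  apply: measurableT_comp; last exact: measurable_tnth.
  exact: measurable_funD.
by apply/funext => t; rewrite /= tnth_mktuple.
Qed.

Lemma measurable_add (d : R) : measurable_fun setT (fun x : R_ => x + d : R_).
Proof. exact: measurable_funD. Qed.

Let add_pack (d : R) : {mfun R_ >-> R_} :=
  HB.pack (fun x : R_ => x + d : R_) (isMeasurableFun.Build _ _ _ _ _ (measurable_add d)).

Lemma lebesgue_measure_shift (d : R) (X : set R_) : measurable X ->
  leb ((fun x => x + d) @^-1` X) = leb X.
Proof.
move=> mX; rewrite -/(pushforward leb (add_pack d) X); apply/esym.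
apply: (lebesgue_measure_unique (mu := pushforward leb (add_pack d))) => //.
move=> _ [[x y] _ <-] /=; rewrite /pushforward.
rewrite (_ : _ @^-1` _ = `]x - d, y - d]%classic); last first.
  by apply/seteqP; split=> z /=; rewrite !in_itv /= ltrBlDr lerBrDr.
rewrite !lebesgue_measure_itv /= !lte_fin ltrD2r; case: ifP => // _.
by rewrite -!EFinB; congr EFin; ring.
Qed.

Let shift_pack : {mfun k.-tuple R_ >-> k.-tuple R_} :=
  HB.pack shift_tuple (isMeasurableFun.Build _ _ _ _ _ measurable_shift).

(** Translation invariance, again by comparing boxes. *)
Lemma lebesgue_tuple_shift X : measurable X ->
  lebesgue_tuple k X = pushforward (lebesgue_tuple k) shift_tuple X.
Proof.
apply: (@lebesgue_tuple_unique k (pushforward (lebesgue_tuple k) shift_pack)) => A mA.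
transitivity (lebesgue_tuple k (shift_tuple @^-1` box A)); first by [].
rewrite (_ : _ @^-1` _ = box (fun i => (fun x => x + c i) @^-1` A i)); last first.
  by apply/seteqP; split=> t /= h i; have := h i; rewrite /= tnth_mktuple.
rewrite lebesgue_tuple_box; last first.
  by move=> i; rewrite -[X in measurable X]setTI; exact: measurable_add.
by apply: eq_bigr => i _; rewrite lebesgue_measure_shift.
Qed.

End shift.

End boxes.

(** * Cubes, measurability and Fubini on C^n *)

Section complex_topology.
Context {R : realType}.
Local Notation C := R[i].

(** Polydisc-like neighbourhoods with real radii; in real coordinates they are
    boxes, which ties the topology of C^n to Lebesgue measure. *)
Definition cube n (z : 'rV[C]_n) (d : R) : set 'rV[C]_n :=
  [set w | forall j, `|complex.Re (w 0 j) - complex.Re (z 0 j)| < d /\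
                     `|complex.Im (w 0 j) - complex.Im (z 0 j)| < d].

Lemma normc_le_ReIm (z : C) :
  `|z| <= (`|complex.Re z| + `|complex.Im z|)%:C%C.
Proof.
rewrite normc_def lecR -(@ler_pXn2r _ 2) ?nnegrE ?addr_ge0 ?sqrtr_ge0 //.
rewrite sqr_sqrtr ?addr_ge0 ?sqr_ge0 // sqrrD !real_normK ?num_real //.
have := mulr_ge0 (normr_ge0 (complex.Re z)) (normr_ge0 (complex.Im z)).
by rewrite mulr2n; lra.
Qed.

Lemma ReB (x y : C) : complex.Re (x - y) = complex.Re x - complex.Re y.
Proof. by case: x; case: y. Qed.

Lemma ImB (x y : C) : complex.Im (x - y) = complex.Im x - complex.Im y.
Proof. by case: x; case: y. Qed.

Lemma ReD (x y : C) : complex.Re (x + y) = complex.Re x + complex.Re y.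
Proof. by case: x; case: y. Qed.

Lemma ImD (x y : C) : complex.Im (x + y) = complex.Im x + complex.Im y.
Proof. by case: x; case: y. Qed.

Lemma ReZ (c : R) (x : C) : complex.Re (c%:C%C * x) = c * complex.Re x.
Proof. by case: x => x y /=; rewrite mul0r subr0. Qed.

Lemma ImZ (c : R) (x : C) : complex.Im (c%:C%C * x) = c * complex.Im x.
Proof. by case: x => x y /=; rewrite mul0r addr0. Qed.

Lemma normc_ge_Im (z : C) : `|complex.Im z|%:C%C <= `|z|.
Proof.
rewrite normc_def lecR -sqrtr_sqr ler_sqrt ?addr_ge0 ?sqr_ge0 //.
by rewrite lerDr sqr_ge0.
Qed.

Lemma nbhs_cube n (z : 'rV[C]_n) (U : set 'rV[C]_n) :
  nbhs z U <-> exists2 d : R, 0 < d & cube z d `<=` U.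
Proof.
split=> [/nbhs_ballP[e /= e0 eU]|[d d0 dU]].
  have eE : e = (complex.Re e)%:C%C by rewrite RRe_real ?gtr0_real.
  have d0 : 0 < complex.Re e by rewrite -ltcR -eE.
  exists (complex.Re e / 2) => [|w wz]; first by rewrite divr_gt0.
  apply: eU; split=> // i j; rewrite ord1 /ball /= eE.
  have [re im] := wz j; apply: le_lt_trans (normc_le_ReIm _) _.
  rewrite ltcR ReB ImB distrC (distrC (complex.Im _)).
  by rewrite [ltRHS](splitr (complex.Re e)) ltrD.
apply/nbhs_ballP; exists d%:C%C => /=; first by rewrite ltcR.
move=> w [_ wz]; apply: dU => j; have := wz 0 j; rewrite /ball /= => zw.
rewrite distrC -ReB (distrC (complex.Im _)) -ImB.
by split; rewrite -ltcR; apply: le_lt_trans zw; [exact: normc_ge_Re|exact: normc_ge_Im].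
Qed.

Lemma cube_center n (z : 'rV[C]_n) d : 0 < d -> cube z d z.
Proof. by move=> d0 j; rewrite !subrr normr0. Qed.

Lemma nbhs_cube_center n (z : 'rV[C]_n) d : 0 < d -> nbhs z (cube z d).
Proof. by move=> d0; apply/nbhs_cube; exists d. Qed.

Lemma open_cube n (z : 'rV[C]_n) d : open (cube z d).
Proof.
rewrite openE => w wz.
suff : exists2 e : R, 0 < e & forall j,
    `|complex.Re (w 0 j) - complex.Re (z 0 j)| + e <= d /\
    `|complex.Im (w 0 j) - complex.Im (z 0 j)| + e <= d.
  move=> [e e0 He]; apply/nbhs_cube; exists e => // v vw j.
  have [vr vi] := vw j; have [hr hi] := He j; split.
    by rewrite (le_lt_trans (ler_distD (complex.Re (w 0 j)) _ _)) //; lra.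
  by rewrite (le_lt_trans (ler_distD (complex.Im (w 0 j)) _ _)) //; lra.
pose m j := Num.min (d - `|complex.Re (w 0 j) - complex.Re (z 0 j)|)
                    (d - `|complex.Im (w 0 j) - complex.Im (z 0 j)|).
exists (\big[Num.min/1]_j m j) => [|j].
  elim/big_ind: _ => // [x y x0 y0|j _]; first by rewrite lt_min x0.
  by have [hr hi] := wz j; rewrite lt_min !subr_gt0 hr.
have : \big[Num.min/1]_j' m j' <= m j by exact: bigmin_le.
by rewrite le_min => /andP[h1 h2]; split; lra.
Qed.

Notation R_ := (measurableTypeR R).

Lemma tnth_dbl n (t : (n * 2).-tuple R_) e (j : 'I_n) :
  tnth t (dbl e j) = nth 0 t (j.*2 + e).
Proof. by rewrite (tnth_nth 0). Qed.

Lemma Re_ofreal n (t : (n * 2).-tuple R_) j :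
  complex.Re (ofreal t 0 j) = tnth t (dbl false j).
Proof. by rewrite mxE tnth_dbl addn0. Qed.

Lemma Im_ofreal n (t : (n * 2).-tuple R_) j :
  complex.Im (ofreal t 0 j) = tnth t (dbl true j).
Proof. by rewrite mxE tnth_dbl addn1. Qed.

Lemma cube_ofreal n (t t' : (n * 2).-tuple R_) d :
  cube (ofreal t) d (ofreal t') <-> forall i, `|tnth t' i - tnth t i| < d.
Proof.
split=> h i.
  rewrite -(dbl_half i); have [] := h (half_ord i); rewrite !Re_ofreal !Im_ofreal.
  by case: odd.
by rewrite !Re_ofreal !Im_ofreal; split; exact: h.
Qed.

(** An open set is a countable union of boxes with rational data. *)
Lemma measurable_ofreal_open n (U : set 'rV[C]_n) : open U ->
  measurable ((@ofreal R n) @^-1` U).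
Proof.
move=> oU.
pose B (p : (n * 2).-tuple rat * nat) : set ((n * 2).-tuple R_) :=
  box (fun i => [set` `](ratr (tnth p.1 i) - p.2.+1%:R^-1),
                        (ratr (tnth p.1 i) + p.2.+1%:R^-1)[] : set R_).
have mB p : measurable (B p) by apply: measurable_box => i; exact: measurable_itv.
have -> : (@ofreal R n) @^-1` U =
    \bigcup_p (if `[< B p `<=` (@ofreal R n) @^-1` U >] then B p else set0).
  apply/seteqP; split=> [t /= Ut|t [p _]]; last by case: asboolP => // h /h.
  have /nbhs_cube[d d0 dU] : nbhs (ofreal t) U by exact: open_nbhs_nbhs.
  have [m md] : exists m, m.+1%:R^-1 < d / 2.
    have [m _ /(_ m (leqnn _)) mE] := near_infty_natSinv_lt (PosNum (divr_gt0 d0 (ltr0Sn R 1))).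
    by exists m.
  have q_ i : {q : rat | ratr q \in `](tnth t i - m.+1%:R^-1 : R), (tnth t i + m.+1%:R^-1)[}.
    by apply: cid; apply: rat_in_itvoo; rewrite ltrBlDr -addrA ltrDl addr_gt0 // invr_gt0.
  pose q := [tuple sval (q_ i) | i < n * 2].
  have qE i : `|tnth t i - ratr (tnth q i)| < m.+1%:R^-1 :> R.
    rewrite tnth_mktuple; have := svalP (q_ i); rewrite in_itv /=.
    by rewrite -ltr_distl distrC.
  exists (q, m) => //; case: asboolP => [_|[]]; first by move=> i; rewrite /= in_itv /= -ltr_distl.
  move=> t' t'B; apply: dU; apply/cube_ofreal => i.
  have := t'B i; rewrite /= in_itv /= -ltr_distl => t'q.
  apply: le_lt_trans (ler_distD (ratr (tnth q i)) _ _) _.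
  move: (qE i) t'q md; rewrite !(distrC _ (ratr _)); move: (m.+1%:R^-1) => v. lra.
apply: countable_bigcupT_measurable => [|p]; first exact: countableP.
by case: asboolP.
Qed.

(** Superlevel sets of real levels suffice to test measurability of functions with
    values in the extended reals; this is the form in which semicontinuity gives
    measurability. *)
Lemma measurable_fun_gt d (T : measurableType d) (D : set T) (f : T -> \bar R) :
  measurable D -> (forall a : R, measurable (D `&` [set x | (a%:E < f x)%E])) ->
  measurable_fun D f.
Proof.
move=> mD h; apply: (measurability _ (ErealGenOInfty.measurableE R)).
move=> _ [_ [a ->] <-]; rewrite preimage_itvoy; exact: h.
Qed.

Lemma measurable_fun_continuous n (U : set 'rV[C]_n) (f : 'rV[C]_n -> R) :
  open U -> (forall z, U z -> {for z, continuous f}) ->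
  measurable_fun ((@ofreal R n) @^-1` U) (f \o @ofreal R n).
Proof.
move=> oU cf; apply/measurable_EFinP; apply: measurable_fun_gt.
  exact: measurable_ofreal_open.
move=> a; rewrite (_ : _ `&` _ = (@ofreal R n) @^-1` (U `&` [set z | a < f z])); last first.
  by apply/seteqP; split=> t [Ut] /=; rewrite lte_fin.
apply: measurable_ofreal_open; rewrite openE => z [Uz az].
apply: filterI; first exact: open_nbhs_nbhs.
by apply: (cf z Uz [set y | a < y]); apply: open_nbhs_nbhs; split=> //; exact: open_gt.
Qed.

Section integral.
Local Open Scope ereal_scope.
Variables (a b k : nat) (iota : 'I_a -> 'I_k) (kappa : 'I_b -> 'I_k).
Variable e : 'I_k -> 'I_a + 'I_b.
Hypothesis e_iota : forall x, e (iota x) = inl x.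
Hypothesis e_kappa : forall y, e (kappa y) = inr y.
Hypothesis eK : forall j, match e j with inl x => iota x | inr y => kappa y end = j.
Local Notation mrg := (merge (R := R) e).
Local Notation mrg2 := (fun p : a.-tuple R_ * b.-tuple R_ => mrg p.1 p.2).
Local Notation lab := (lebesgue_tuple a \x lebesgue_tuple b).

Let mmrg : measurable_fun setT mrg2.
Proof. exact: measurable_merge e_iota e_kappa eK. Qed.

Let merge_pack : {mfun (a.-tuple R_ * b.-tuple R_)%type >-> k.-tuple R_} :=
  HB.pack mrg2 (isMeasurableFun.Build _ _ _ _ _ mmrg).

Let integral_merge_measure (F : k.-tuple R_ -> \bar R) :
  \int[lebesgue_tuple k]_t F t = \int[pushforward lab merge_pack]_t F t.
Proof.
by apply: eq_measure_integral => A mA _; exact: (lebesgue_tuple_merge e_iota e_kappa eK).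
Qed.

Lemma ge0_integral_merge (F : k.-tuple R_ -> \bar R) :
  measurable_fun setT F -> (forall t, 0 <= F t) ->
  \int[lebesgue_tuple k]_t F t =
  \int[lebesgue_tuple a]_x \int[lebesgue_tuple b]_y F (mrg x y).
Proof.
move=> mF F0.
rewrite integral_merge_measure.
rewrite ge0_integral_pushforward //.
rewrite preimage_setT (fubini_tonelli1 (F \o mrg2)) // => [|p]; last exact: F0.
exact: measurableT_comp.
Qed.

Lemma integrable_merge (F : k.-tuple R_ -> \bar R) :
  measurable_fun setT F ->
  (lebesgue_tuple k).-integrable setT F <-> lab.-integrable setT (F \o mrg2).
Proof.
move=> mF; rewrite !integrable12ltyP //; last first.
  by apply: measurableT_comp => //; exact: mmrg.
split=> [/integrableP[_]|h]; last (apply/integrableP; split=> //);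
  by rewrite ge0_integral_merge //; exact: measurableT_comp.
Qed.

Lemma integral_merge (F : k.-tuple R_ -> \bar R) :
  (lebesgue_tuple k).-integrable setT F ->
  \int[lebesgue_tuple k]_t F t =
  \int[lebesgue_tuple a]_x \int[lebesgue_tuple b]_y F (mrg x y).
Proof.
move=> iF; have mF : measurable_fun setT F by exact: measurable_int iF.
have iFm := (integrable_merge mF).1 iF.
rewrite integral_merge_measure.
rewrite integral_pushforward //.
by rewrite preimage_setT -(integral12_prod_meas1 iFm).
Qed.

Lemma integral_shift (c : 'I_k -> R) (F : k.-tuple R_ -> \bar R) :
  (lebesgue_tuple k).-integrable setT F ->
  \int[lebesgue_tuple k]_t F (shift_tuple c t) = \int[lebesgue_tuple k]_t F t.
Proof.
move=> iF; have mF : measurable_fun setT F by exact: measurable_int iF.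
have ms := measurable_shift c.
pose shift_pack : {mfun k.-tuple R_ >-> k.-tuple R_} :=
  HB.pack (shift_tuple c) (isMeasurableFun.Build _ _ _ _ _ ms).
have E (G : k.-tuple R_ -> \bar R) : \int[lebesgue_tuple k]_t G t =
    \int[pushforward (lebesgue_tuple k) shift_pack]_t G t.
  by apply: eq_measure_integral => A mA _; rewrite [LHS](lebesgue_tuple_shift c).
rewrite [RHS]E integral_pushforward //.
rewrite preimage_setT; apply/integrableP; split; first exact: measurableT_comp.
have /integrableP[_] := iF; rewrite E ge0_integral_pushforward //.
exact: measurableT_comp.
Qed.

End integral.

End complex_topology.

(** * Smooth functions *)

Section smooth_calculus.
Context {R : realType}.
Local Notation C := R[i].

Lemma continuous_real_line n (z v : 'rV[C]_n) :
  continuous (fun s : R => z + s%:C%C *: v).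
Proof.
move=> s0 A /nbhs_cube[d d0 dA].
pose m := 1 + \sum_j (`|complex.Re (v 0 j)| + `|complex.Im (v 0 j)|).
have m0 : 0 < m.
  by rewrite ltr_pwDl // sumr_ge0 // => j _; rewrite addr_ge0.
have vm j : `|complex.Re (v 0 j)| < m /\ `|complex.Im (v 0 j)| < m.
  have h : `|complex.Re (v 0 j)| + `|complex.Im (v 0 j)| < m.
    rewrite /m (bigD1 j) //= addrCA ltrDl ltr_pwDl //.
    by apply: sumr_ge0 => k _; exact: addr_ge0.
  by split; apply: le_lt_trans h; rewrite ?lerDl ?lerDr.
have : \forall s \near s0, `|s - s0| < d / m.
  have := @nbhsx_ballx R R s0 (d / m) (divr_gt0 d0 m0).
  by apply: filterS => s; rewrite /ball /= distrC.
apply: filterS => s ss0; apply: dA => j; have [vr vi] := vm j.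
have E : (z + s%:C%C *: v) 0 j - (z + s0%:C%C *: v) 0 j = (s - s0)%:C%C * v 0 j.
  by rewrite !mxE rmorphB mulrBl opprD addrACA subrr add0r.
rewrite -ReB -ImB E ReZ ImZ.
rewrite !normrM; move: ss0; rewrite ltr_pdivlMr // => ss0.
by split; apply: le_lt_trans ss0; rewrite ler_wpM2l // ltW.
Qed.

Local Notation P n := (R * 'rV[C]_n)%type.

Lemma continuous_tline n (d p : P n) : continuous (tline d p).
Proof.
move=> s; apply: (@cvg_pair _ _ _ _ (nbhs (p.1 + s * d.1)) (nbhs (p.2 + s%:C%C *: d.2))).
  by apply: cvgD; [exact: cvg_cst|apply: cvgM; [exact: cvg_id|exact: cvg_cst]].
exact: continuous_real_line.
Qed.

Lemma tline0 n (d p : P n) : tline d p 0 = p.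
Proof. by case: p => t z; rewrite /tline /= mul0r addr0 scale0r addr0. Qed.

Lemma near_tline n (d p : P n) (U : set (P n)) : open U -> U p ->
  \forall s \near 0, U (tline d p s).
Proof.
move=> oU Up; apply: (@continuous_tline n d p 0 U); rewrite tline0.
exact: open_nbhs_nbhs.
Qed.

(** One step of smoothness: continuity and directional derivatives everywhere. *)
Definition dir_diff n (U : set (P n)) (f : P n -> R) := forall p, U p ->
  {for p, continuous f} /\ forall d, derivable (f \o tline d p) 0 1.

Lemma eq_on_tderive n (U : set (P n)) (f g : P n -> R) d p : open U -> U p ->
  (forall q, U q -> f q = g q) -> tderive d f p = tderive d g p.
Proof.
move=> oU Up fg; rewrite /tderive !derive1E; apply: near_eq_derive.
by have := near_tline d oU Up; apply: filterS => s /fg.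
Qed.

Lemma eq_on_dir_diff n (U : set (P n)) (f g : P n -> R) : open U ->
  (forall q, U q -> f q = g q) -> dir_diff U f -> dir_diff U g.
Proof.
move=> oU fg fU p Up; have [cf df] := fU p Up; split=> [|d].
  suff: g x @[x --> p] --> g p by [].
  rewrite -(fg p Up); apply: cvg_trans cf; apply: near_eq_cvg.
  have : nbhs p U by exact: open_nbhs_nbhs.
  by apply: filterS => q /fg ->.
apply: near_eq_derivable (df d).
by have := near_tline d oU Up; apply: filterS => s /fg.
Qed.

(** Smoothness quantifies over all finite sequences of directions. A class of
    functions that is stable under derivatives up to equality on U, and consists
    of functions differentiable once, is therefore a class of smooth functions. *)
Lemma smooth_on_coind n (U : set (P n)) (Q : (P n -> R) -> Prop) : open U ->
  (forall f, Q f -> dir_diff U f /\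
     forall d, exists2 g, Q g & forall p, U p -> tderive d f p = g p) ->
  forall f, Q f -> smooth_on U f.
Proof.
move=> oU HQ f Qf ds.
suff H f' : (exists2 g, Q g & forall p, U p -> f' p = g p) ->
    dir_diff U (foldr (@tderive R n) f' ds).
  by move=> p Up; apply: H => //; exists f.
move: f' {f Qf}; elim/last_ind: ds => [|ds d IH] f [g Qg fg].
  apply: (eq_on_dir_diff (f := g)) => // [q Uq|]; first by rewrite /= fg.
  by have [] := HQ g Qg.
rewrite foldr_rcons; apply: IH; have [_ /(_ d)[g' Qg' gg']] := HQ g Qg.
by exists g' => // p Up; rewrite (eq_on_tderive d oU Up fg) gg'.
Qed.

Lemma smooth_on_dir_diff n (U : set (P n)) f : smooth_on U f -> dir_diff U f.
Proof. by move=> fU p Up; have := fU [::] p Up. Qed.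

Lemma smooth_on_tderive n (U : set (P n)) d f :
  smooth_on U f -> smooth_on U (tderive d f).
Proof.
by move=> fU ds p Up; have := fU (rcons ds d) p Up; rewrite foldr_rcons.
Qed.

Lemma eq_smooth_on n (U : set (P n)) f g : open U ->
  (forall p, U p -> f p = g p) -> smooth_on U f -> smooth_on U g.
Proof.
move=> oU fg fU.
apply: (@smooth_on_coind _ U (fun h => exists2 f, smooth_on U f & forall p, U p -> f p = h p)) => //; last by exists f.
move=> h [f' f'U f'h]; split.
  by apply: (eq_on_dir_diff oU f'h); exact: smooth_on_dir_diff.
move=> d; exists (tderive d f'); last first.
  by move=> p Up; rewrite (eq_on_tderive d oU Up f'h).
by exists (tderive d f') => //; exact: smooth_on_tderive.
Qed.

Lemma sub_smooth_on n (U V : set (P n)) f :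
  U `<=` V -> smooth_on V f -> smooth_on U f.
Proof. by move=> UV fV ds p /UV; exact: fV. Qed.

Lemma tderiveD n (f g : P n -> R) (d p : P n) :
  derivable (f \o tline d p) 0 1 -> derivable (g \o tline d p) 0 1 ->
  tderive d (fun q => f q + g q) p = tderive d f p + tderive d g p.
Proof. by move=> df dg; rewrite /tderive !derive1E -deriveD. Qed.

Lemma tderiveM n (f g : P n -> R) (d p : P n) :
  derivable (f \o tline d p) 0 1 -> derivable (g \o tline d p) 0 1 ->
  tderive d (fun q => f q * g q) p = f p * tderive d g p + g p * tderive d f p.
Proof.
move=> df dg; rewrite /tderive !derive1E.
have := deriveM df dg; rewrite /= !tline0 => e.
exact: e.
Qed.

Lemma tderive_cst n c (d p : P n) : tderive d (fun=> c) p = 0 :> R.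
Proof. by rewrite /tderive derive1_cst. Qed.

(** The derivative of a product is a sum of products: it is the algebra generated by
    the smooth functions, and not the set of their products, that is stable under
    derivatives, as smooth_on_coind requires. *)
Inductive smooth_algebra n (U : set (P n)) : (P n -> R) -> Prop :=
| SmoothLeaf f : smooth_on U f -> smooth_algebra U f
| SmoothCst c : smooth_algebra U (fun=> c)
| SmoothD f g : smooth_algebra U f -> smooth_algebra U g ->
    smooth_algebra U (fun p => f p + g p)
| SmoothM f g : smooth_algebra U f -> smooth_algebra U g ->
    smooth_algebra U (fun p => f p * g p).

Lemma smooth_algebra_dir_diff n (U : set (P n)) f :
  smooth_algebra U f -> dir_diff U f.
Proof.
elim=> {f} [f /smooth_on_dir_diff//|c|f g _ fU _ gU|f g _ fU _ gU] p Up.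
- by split=> [|d]; [exact: cvg_cst|exact: derivable_cst].
- have [cf df] := fU p Up; have [cg dg] := gU p Up; split=> [|d].
    exact: cvgD.
  exact: (derivableD (df d) (dg d)).
- have [cf df] := fU p Up; have [cg dg] := gU p Up; split=> [|d].
    exact: cvgM.
  exact: (derivableM (df d) (dg d)).
Qed.

Lemma smooth_algebraP n (U : set (P n)) f : open U ->
  smooth_algebra U f -> smooth_on U f.
Proof.
move=> oU; apply: smooth_on_coind => // {}f fU.
split; first exact: smooth_algebra_dir_diff.
move=> d; elim: fU => {f} [f fU|c|f g fU [f' f'U ff'] gU [g' g'U gg']|
    f g fU [f' f'U ff'] gU [g' g'U gg']].
- by exists (tderive d f) => //; apply: SmoothLeaf; exact: smooth_on_tderive.
- by exists (fun=> 0); [exact: SmoothCst|move=> p _; rewrite tderive_cst].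
- exists (fun p => f' p + g' p) => [|p Up]; first exact: SmoothD.
  have [_ df] := smooth_algebra_dir_diff fU Up.
  have [_ dg] := smooth_algebra_dir_diff gU Up.
  by rewrite tderiveD // ff' // gg'.
- exists (fun p => f p * g' p + g p * f' p) => [|p Up].
    by apply: SmoothD; exact: SmoothM.
  have [_ df] := smooth_algebra_dir_diff fU Up.
  have [_ dg] := smooth_algebra_dir_diff gU Up.
  by rewrite tderiveM // ff' // gg'.
Qed.

Lemma smooth_on_sum n (U : set (P n)) (I : Type) (r : seq I) (F : I -> P n -> R) :
  open U -> (forall i, smooth_on U (F i)) ->
  smooth_on U (fun p => \sum_(i <- r) F i p).
Proof.
move=> oU FU; apply: smooth_algebraP => //; elim: r => [|i r IH].
  by under eq_fun do rewrite big_nil; exact: SmoothCst.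
by under eq_fun do rewrite big_cons; apply: SmoothD => //; exact: SmoothLeaf.
Qed.

(** L is affine with linear part L', which covers projections onto a factor as well
    as the restriction to a fixed time. *)
Lemma smooth_on_comp m n (U : set (P n)) (V : set (P m)) (L L' : P n -> P m) f :
  open U -> continuous L ->
  (forall d p s, L (tline d p s) = tline (L' d) (L p) s) ->
  (forall p, U p -> V (L p)) -> smooth_on V f -> smooth_on U (f \o L).
Proof.
move=> oU cL lL UV fV.
have tE d p g : (g \o L) \o tline d p = g \o tline (L' d) (L p).
  by apply/funext => s; rewrite /= lL.
apply: (@smooth_on_coind _ U (fun h => exists2 g, smooth_on V g & h = g \o L)) => //.
  move=> _ [g gV ->]; split=> [p Up|d]; last first.
    exists (tderive (L' d) g \o L); first by exists (tderive (L' d) g) => //; exact: smooth_on_tderive.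
    by move=> p _; rewrite /tderive tE.
  have [cg dg] := smooth_on_dir_diff gV (UV _ Up); split=> [|d].
    apply: continuous_comp; [exact: cL|exact: cg].
  by rewrite tE.
by exists f.
Qed.

End smooth_calculus.

(** * The complex Hessian *)

Section dolbeault.
Context {R : realType}.
Local Notation C := R[i].

Lemma open_cylinder n (U : set 'rV[C]_n) :
  open U -> open ([set: R] `*` U).
Proof.
move=> oU; rewrite openE => -[t z] [_ Uz].
exists (setT, U) => //=; split; [exact: filterT|exact: open_nbhs_nbhs].
Qed.

Lemma smooth_rderive n (U : set 'rV[C]_n) v f :
  smooth U f -> smooth U (rderive v f).
Proof. exact: (@smooth_on_tderive R n (setT `*` U) (0, v) (f \o snd)). Qed.

Section at_a_point.
Variables (n : nat) (U : set 'rV[C]_n) (z : 'rV[C]_n) (Uz : U z).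

Lemma smooth_derivable f v : smooth U f ->
  derivable (fun s : R => f (z + s%:C%C *: v)) 0 1.
Proof.
move=> fU; have Up : (setT `*` U) ((0 : R), z) by [].
by have [_ /(_ (0, v))] := smooth_on_dir_diff fU Up.
Qed.

Lemma smooth_continuous f : smooth U f -> {for z, continuous f}.
Proof.
move=> fU; have Up : (setT `*` U) ((0 : R), z) by [].
have [cf _] := smooth_on_dir_diff fU Up.
rewrite (_ : f = (f \o snd) \o pair (0 : R)) //.
apply: continuous_comp => //.
apply: (@cvg_pair _ _ _ (nbhs z) (nbhs (0 : R)) (nbhs z)).
  exact: cvg_cst.
exact: cvg_id.
Qed.

Lemma rderiveD f g v : smooth U f -> smooth U g ->
  rderive v (fun w => f w + g w) z = rderive v f z + rderive v g z.
Proof.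
by move=> fU gU; rewrite /rderive !derive1E -deriveD //; exact: smooth_derivable.
Qed.

Lemma rderiveZ c f v : smooth U f ->
  rderive v (fun w => c * f w) z = c * rderive v f z.
Proof.
move=> fU; rewrite /rderive !derive1E.
exact: (deriveZ c (@smooth_derivable f v fU)).
Qed.

End at_a_point.

Lemma eq_on_rderive n (U : set 'rV[C]_n) f g v z : open U -> U z ->
  (forall w, U w -> f w = g w) -> rderive v f z = rderive v g z.
Proof.
move=> oU Uz fg.
apply: (@eq_on_tderive R n (setT `*` U) (f \o snd) (g \o snd) (0, v) (0, z)).
- exact: open_cylinder.
- by [].
- by move=> [t w] [_ Uw]; exact: fg.
Qed.

Lemma rderive0 n f (z : 'rV[C]_n) : rderive 0 f z = 0 :> R.
Proof.
rewrite /rderive (_ : (fun s => _) = fun=> f z) ?derive1_cst //.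
by apply/funext => s; rewrite scaler0 addr0.
Qed.

Lemma rderive_cst n c v (z : 'rV[C]_n) : rderive v (fun=> c) z = 0 :> R.
Proof. by rewrite /rderive derive1_cst. Qed.

Lemma smooth_sum n (U : set 'rV[C]_n) (I : Type) (r : seq I) (F : I -> 'rV[C]_n -> R) :
  open U -> (forall i, smooth U (F i)) -> smooth U (fun w => \sum_(i <- r) F i w).
Proof.
move=> oU FU.
exact: (@smooth_on_sum R n (setT `*` U) I r (fun i => F i \o snd) (open_cylinder oU)).
Qed.

Lemma rderive_sum n (U : set 'rV[C]_n) (I : Type) (r : seq I) (F : I -> 'rV[C]_n -> R) v z :
  open U -> U z -> (forall i, smooth U (F i)) ->
  rderive v (fun w => \sum_(i <- r) F i w) z = \sum_(i <- r) rderive v (F i) z.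
Proof.
move=> oU Uz FU; elim: r => [|i r IH].
  by rewrite big_nil; under eq_fun do rewrite big_nil; rewrite rderive_cst.
rewrite big_cons; under eq_fun do rewrite big_cons.
by rewrite (rderiveD Uz) ?IH //; exact: smooth_sum.
Qed.

Local Notation e_ j := (delta_mx 0 j : 'rV[C]_ _).
Local Notation f_ j := ('i%C *: delta_mx 0 j : 'rV[C]_ _).

(** Writing the complex Hessian entry (j, k) with real second derivatives gives
    this real part and the imaginary part below; the operators dz and dzbar
    disappear from all later arguments. *)
Definition levi_Re n (j k : 'I_n) (u : 'rV[C]_n -> R) (z : 'rV[C]_n) : R :=
  (rderive (e_ j) (rderive (e_ k) u) z + rderive (f_ j) (rderive (f_ k) u) z) / 4.

Definition levi_Im n (j k : 'I_n) (u : 'rV[C]_n -> R) (z : 'rV[C]_n) : R :=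
  (rderive (e_ j) (rderive (f_ k) u) z - rderive (f_ j) (rderive (e_ k) u) z) / 4.

Lemma half_complex (a b c d : R) :
  ((a +i* b)%C + 'i%C * (c +i* d)%C) / 2 = (2^-1 * (a - d) +i* (2^-1 * (b + c)))%C.
Proof.
have -> : (2 : C)^-1 = (2^-1)%:C%C by rewrite fmorphV rmorph_nat.
by apply/eqP; rewrite eq_complex /=; apply/andP; split; apply/eqP; ring.
Qed.

Lemma half_complexN (a b c d : R) :
  ((a +i* b)%C - 'i%C * (c +i* d)%C) / 2 = (2^-1 * (a + d) +i* (2^-1 * (b - c)))%C.
Proof.
have -> : (2 : C)^-1 = (2^-1)%:C%C by rewrite fmorphV rmorph_nat.
by apply/eqP; rewrite eq_complex /=; apply/andP; split; apply/eqP; ring.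
Qed.

Lemma dz_dzbarE n (U : set 'rV[C]_n) (u : 'rV[C]_n -> R) j k z : U z -> smooth U u ->
  dz j (dzbar k (fun w => (u w)%:C%C)) z = (levi_Re j k u z +i* levi_Im j k u z)%C.
Proof.
move=> Uz uU.
have -> : dzbar k (fun w => (u w)%:C%C) =
    fun w => (2^-1 * rderive (e_ k) u w +i* (2^-1 * rderive (f_ k) u w))%C.
  apply/funext => w; rewrite /dzbar /cderive.
  rewrite (_ : @complex.Im R \o _ = fun=> 0); last by apply/funext.
  rewrite !rderive_cst (_ : @complex.Re R \o _ = u); last by apply/funext.
  by rewrite half_complex subr0 add0r.
rewrite /dz /cderive half_complexN.
rewrite (_ : @complex.Re R \o _ = fun w => 2^-1 * rderive (e_ k) u w); last by apply/funext.
rewrite (_ : @complex.Im R \o _ = fun w => 2^-1 * rderive (f_ k) u w); last by apply/funext.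
have Du v : smooth U (rderive v u) by exact: smooth_rderive.
have Z v w : rderive v (fun y => 2^-1 * rderive w u y) z =
    2^-1 * rderive v (rderive w u) z by exact: (@rderiveZ n U z Uz 2^-1 (rderive w u) v (Du w)).
rewrite /levi_Re /levi_Im.
generalize (f_ j) (f_ k) (e_ j) (e_ k) => fj fk ej ek.
rewrite !Z.
generalize (rderive ej (rderive ek u) z) (rderive fj (rderive fk u) z)
  (rderive ej (rderive fk u) z) (rderive fj (rderive ek u) z) => a b c d.
have quarter (x : R) : 2^-1 * (2^-1 * x) = x / 4.
  by rewrite mulrA -invfM -natrM mulrC.
by congr Complex; rewrite -?mulrDr -?mulrBr quarter.
Qed.

(** The coefficient of the entry (j, k) of the complex Hessian in dd^c evaluated
    on the two rows of M. *)
Definition levi_weight n (j k : 'I_n) (M : 'M[C]_(2, n)) : C :=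
  'i%C / (2 * (pi : R)%:C%C) * (M 0 j * (M 1 k)^* - M 1 j * (M 0 k)^*).

Lemma ord2P (x : 'I_2) : x = 0 \/ x = 1.
Proof. by case: x => -[|[|//]] ?; [left|right]; apply: val_inj. Qed.

Lemma wedge_1E n (a b : Defs.form (R := R) 1 n) (M : 'M[C]_(2, n)) :
  wedge a b M = a (row 0 M) * b (row 1 M) - a (row 1 M) * b (row 0 M).
Proof.
have tE : tperm 0 1 != 1%g :> 'S_2.
  by apply/eqP => /permP/(_ 0); rewrite tpermL perm1.
rewrite /wedge invr1 mul1r (bigD1 1%g) //= (bigD1 (tperm 0 1 : 'S_2)) //=.
rewrite big1 ?addr0; last first.
  move=> s /andP[s1 st]; exfalso.
  have s01 : s 0 != s 1 by rewrite (inj_eq (@perm_inj _ s)).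
  have [s0|s0] := ord2P (s 0).
    case/eqP: s1; apply/permP => x; rewrite perm1.
    by have [->|->] := ord2P x => //; case: (ord2P (s 1)) s01 => ->; rewrite s0.
  case/eqP: st; apply/permP => x.
  by have [->|->] := ord2P x; rewrite ?tpermL ?tpermR //;
    case: (ord2P (s 1)) s01 => ->; rewrite s0.
have up (s : 'S_2) : usubmx (row_perm s M : 'M[C]_((1 + 1)%N, n)) = row (s 0) M.
  by apply/matrixP => x j; rewrite !mxE ord1; congr (M (s _) _); exact: val_inj.
have down (s : 'S_2) : dsubmx (row_perm s M : 'M[C]_((1 + 1)%N, n)) = row (s 1) M.
  by apply/matrixP => x j; rewrite !mxE ord1; congr (M (s _) _); exact: val_inj.
by rewrite !up !down odd_perm1 odd_tperm /= !perm1 tpermL tpermR mul1r expr1 mulN1r.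
Qed.

Lemma ddcE n (U : set 'rV[C]_n) (u : 'rV[C]_n -> R) z M : U z -> smooth U u ->
  ddc u z M = \sum_j \sum_k (levi_Re j k u z +i* levi_Im j k u z)%C * levi_weight j k M.
Proof.
move=> Uz uU; rewrite /ddc mulr_sumr; apply: eq_bigr => j _.
rewrite mulr_sumr; apply: eq_bigr => k _.
by rewrite (dz_dzbarE _ _ Uz) // wedge_1E !mxE /levi_weight mulrCA.
Qed.

Lemma multilinear_ddc n (u : 'rV[C]_n -> R) z : real_multilinear (ddc u z).
Proof.
move=> A B B' i b b' /rowP h1 h2 h3; rewrite /ddc (mulrCA b%:C%C) (mulrCA b'%:C%C) -mulrDr.
congr (_ * _); rewrite !mulr_sumr -big_split /=; apply: eq_bigr => j _.
rewrite !mulr_sumr -big_split /=; apply: eq_bigr => k _.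
rewrite (mulrCA b%:C%C) (mulrCA b'%:C%C) -mulrDr; congr (_ * _); rewrite !wedge_1E.
have cj (x y : C) : (b%:C%C * x + b'%:C%C * y)^* = b%:C%C * x^* + b'%:C%C * y^*.
  have re (c : R) : c%:C%C \is Num.real.
    by rewrite -[c%:C%C]/(c +i* 0)%C complex_real.
  by rewrite rmorphD !rmorphM /= (conj_Creal (re b)) (conj_Creal (re b')).
have {h1}h1 x : A i x = b%:C%C * B i x + b'%:C%C * B' i x.
  by have := h1 x; rewrite !mxE.
have h2' y x : y != i -> B y x = A y x.
  by move=> yi; have /rowP/(_ x) := row'_eq h2 yi; rewrite !mxE.
have h3' y x : y != i -> B' y x = A y x.
  by move=> yi; have /rowP/(_ x) := row'_eq h3 yi; rewrite !mxE.
rewrite !mxE; have [i0|i1] := ord2P i; subst i.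
  by rewrite !(h2' 1) // !(h3' 1) // !h1 cj; ring.
by rewrite !(h2' 0) // !(h3' 0) // !h1 cj; ring.
Qed.

Section blocks_of_variables.
Variables (r : nat) (n_ : 'I_r -> nat).
Local Notation N := (\sum_(i < r) n_ i)%N.

Lemma projZ i c (v : 'rV[C]_N) : proj i (c *: v) = c *: proj i v.
Proof. exact: linearZ. Qed.

Lemma proj_delta_diag i (j : 'I_(n_ i)) :
  proj i (delta_mx 0 (tagnat.Rank i j)) = delta_mx 0 j :> 'rV[C]__.
Proof.
apply/rowP => x; rewrite !mxE eqxx /=; congr (_%:R).
by rewrite -val_eqE /= tagnat.eq_Rank eqxx.
Qed.

Lemma proj_delta_off i i' (j : 'I_(n_ i)) : i != i' ->
  proj i' (delta_mx 0 (tagnat.Rank i j)) = 0 :> 'rV[C]__.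
Proof.
move=> ii'; apply/rowP => x; rewrite !mxE eqxx /=.
by rewrite -val_eqE /= tagnat.eq_Rank eq_sym (negbTE ii').
Qed.

Lemma rderive_proj i v (f : 'rV[C]_(n_ i) -> R) (z : 'rV[C]_N) :
  rderive v (f \o proj i) z = rderive (proj i v) f (proj i z).
Proof.
rewrite /rderive; congr (derive1 _ 0); apply/funext => s /=.
by rewrite linearD linearZ.
Qed.

Lemma rderive2_proj i v w (f : 'rV[C]_(n_ i) -> R) (z : 'rV[C]_N) :
  rderive v (rderive w (f \o proj i)) z =
  rderive (proj i v) (rderive (proj i w) f) (proj i z).
Proof.
rewrite -rderive_proj; congr (rderive v _ z).
by apply/funext => y; exact: rderive_proj.
Qed.

(** If the second derivatives in directions v, w depend only on the components of
    v and w in the factor i, then all Hessian entries outside this block vanish.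
    It serves twice: for pulled back functions, and for fibre integrals. *)
Lemma sum_levi_block i (D : 'rV[C]_N -> 'rV[C]_N -> R)
    (D' : 'rV[C]_(n_ i) -> 'rV[C]_(n_ i) -> R) (M : 'M[C]_(2, N)) :
  (forall v w, D v w = D' (proj i v) (proj i w)) ->
  (forall w, D' 0 w = 0) -> (forall v, D' v 0 = 0) ->
  \sum_j \sum_k ((D (e_ j) (e_ k) + D (f_ j) (f_ k)) / 4 +i*
      ((D (e_ j) (f_ k) - D (f_ j) (e_ k)) / 4))%C * levi_weight j k M =
  \sum_j \sum_k ((D' (e_ j) (e_ k) + D' (f_ j) (f_ k)) / 4 +i*
      ((D' (e_ j) (f_ k) - D' (f_ j) (e_ k)) / 4))%C *
      levi_weight j k (\matrix_l proj i (row l M)).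
Proof.
move=> DE D0l D0r; rewrite (big_blocks (blocks_Rank n_)) (bigD1 i) //=.
rewrite [X in _ + X]big1 ?addr0; last first.
  move=> i' ii'; apply: big1 => j _; apply: big1 => k _.
  rewrite !DE !projZ (proj_delta_off j ii') scaler0 !D0l addr0 subrr mul0r.
  exact: mul0r.
apply: eq_bigr => j _; rewrite (big_blocks (blocks_Rank n_)) (bigD1 i) //=.
rewrite [X in _ + X]big1 ?addr0; last first.
  move=> i' ii'; apply: big1 => k _.
  rewrite !DE !projZ (proj_delta_off k ii') scaler0 !D0r addr0 subrr mul0r.
  exact: mul0r.
apply: eq_bigr => k _; rewrite !DE !projZ !proj_delta_diag; congr (_ * _).
by rewrite /levi_weight !mxE.
Qed.

Lemma continuous_proj i : continuous (@proj R r n_ i).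
Proof.
move=> z A /nbhs_cube[d d0 dA]; apply/nbhs_cube; exists d => // w wz; apply: dA => j.
by rewrite !mxE; exact: wz.
Qed.

Lemma open_preimage_proj i (U : set 'rV[C]_(n_ i)) : open U -> open (@proj R r n_ i @^-1` U).
Proof.
by move=> oU; apply: open_comp => // z _; exact: continuous_proj.
Qed.

Lemma smooth_proj i (U : set 'rV[C]_(n_ i)) f : open U -> smooth U f ->
  smooth (@proj R r n_ i @^-1` U) (f \o proj i).
Proof.
move=> oU fU; apply: (@smooth_on_comp R _ _ (setT `*` (@proj R r n_ i @^-1` U)) (setT `*` U)
  (fun p : R * 'rV[C]_N => (p.1, proj i p.2))
  (fun p : R * 'rV[C]_N => (p.1, proj i p.2)) (f \o snd)) => //.
- by apply: open_cylinder; exact: open_preimage_proj.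
- move=> p; apply: (@cvg_pair _ _ _ _ (nbhs p.1) (nbhs (proj i p.2))).
    exact: cvg_fst.
  apply: (@continuous_comp _ _ _ snd (@proj R r n_ i)); first exact: cvg_snd.
  exact: continuous_proj.
- by move=> d p s; rewrite /tline /= linearD linearZ.
Qed.

Lemma ddc_proj i (U : set 'rV[C]_(n_ i)) f z M : open U -> U (proj i z) -> smooth U f ->
  ddc (f \o proj i) z M = pullback (@proj R r n_ i) (ddc f (proj i z)) M.
Proof.
move=> oU Uz fU; rewrite /pullback (ddcE (U := U) _ Uz fU).
rewrite (ddcE (U := @proj R r n_ i @^-1` U) _ _ (smooth_proj oU fU)) //.
apply: (sum_levi_block (D := fun v w => rderive v (rderive w (f \o proj i)) z)
  (D' := fun v w => rderive v (rderive w f) (proj i z))).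
- by move=> v w; exact: rderive2_proj.
- by move=> w; exact: rderive0.
- move=> v; rewrite (_ : rderive 0 f = fun=> 0) ?rderive_cst //.
  by apply/funext => y; exact: rderive0.
Qed.

End blocks_of_variables.

End dolbeault.

(** * Integration along the fibres of a coordinate projection *)

Section real_coordinates.
Context {R : realType}.
Local Notation C := R[i].
Notation R_ := (measurableTypeR R).

Definition toreal n (z : 'rV[C]_n) : (n * 2).-tuple R_ :=
  [tuple if odd q then complex.Im (z 0 (half_ord q)) else complex.Re (z 0 (half_ord q))
     | q < n * 2].

Lemma toreal_ofreal n (t : (n * 2).-tuple R_) : toreal (ofreal t) = t.
Proof.
apply: eq_from_tnth => q; rewrite tnth_mktuple Re_ofreal Im_ofreal.
by rewrite -[in RHS](dbl_half q); case: odd.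
Qed.

Lemma ofreal_toreal n (z : 'rV[C]_n) : ofreal (toreal z) = z.
Proof.
apply/rowP => j; apply/eqP; rewrite eq_complex Re_ofreal Im_ofreal !tnth_mktuple.
by rewrite !odd_dbl !half_dbl !eqxx.
Qed.

Lemma toreal_inj n : injective (@toreal n).
Proof. exact: can_inj (@ofreal_toreal n). Qed.

Lemma toreal_line n (z v : 'rV[C]_n) s q :
  tnth (toreal (z + s%:C%C *: v)) q = tnth (toreal z) q + s * tnth (toreal v) q :> R.
Proof.
rewrite !tnth_mktuple [in LHS]mxE [in LHS]mxE.
by case: odd; [rewrite ImD ImZ|rewrite ReD ReZ].
Qed.

Lemma toreal_add n (z v : 'rV[C]_n) q :
  tnth (toreal (z + v)) q = tnth (toreal z) q + tnth (toreal v) q :> R.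
Proof. by have := toreal_line z v 1 q; rewrite scale1r mul1r. Qed.

Lemma toreal_sub n (z v : 'rV[C]_n) q :
  tnth (toreal (z - v)) q = tnth (toreal z) q - tnth (toreal v) q :> R.
Proof. by have := toreal_add (z - v) v q; rewrite subrK => ->; rewrite addrK. Qed.

Lemma toreal0 n q : tnth (toreal (0 : 'rV[C]_n)) q = 0 :> R.
Proof. by have := toreal_sub (0 : 'rV[C]_n) 0 q; rewrite !subrr. Qed.

Lemma cubeP n (z w : 'rV[C]_n) d :
  cube z d w <-> forall q, `|tnth (toreal w) q - tnth (toreal z) q| < d.
Proof. by rewrite -cube_ofreal !ofreal_toreal. Qed.

Lemma compact_bounded_coordinates n (K : set 'rV[C]_n) : compact K ->
  exists2 rho : R, 0 < rho & forall z, K z -> forall q, `|tnth (toreal z) q| <= rho.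
Proof.
move=> /compact_near_coveringP cK.
have : \forall N \near \oo, K `<=` (fun (N : nat) z => forall q, `|tnth (toreal z) q| <= N%:R) N.
  apply: cK => z Kz.
  pose m := 1 + \sum_q `|tnth (toreal z) q|.
  exists (cube z 1, [set N : nat | m <= N%:R]).
    split; first exact: (nbhs_cube_center z ltr01).
    exact: (nbhs_infty_ger m).
  move=> [w N] [/cubeP zw /= mN] q; apply: le_trans mN.
  rewrite -[tnth (toreal w) q](subrK (tnth (toreal z) q)).
  apply: le_trans (ler_normD _ _) _; rewrite /m; apply: lerD; first exact/ltW/zw.
  by rewrite (bigD1 q) //= lerDl sumr_ge0.
case=> N _ /(_ N (leqnn _)) KN; exists N.+1%:R => // z Kz q.
by apply: le_trans (KN z Kz q) _; rewrite ler_nat.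
Qed.

(** Near each point of K the function is bounded, and K is compact. *)
Lemma compact_bounded_fun n (K : set 'rV[C]_n) (g : 'rV[C]_n -> R) :
  compact K -> continuous g -> (forall z, ~ K z -> g z = 0) ->
  exists2 M : R, 0 < M & forall z, `|g z| <= M.
Proof.
move=> /compact_near_coveringP cK cg gK.
have : \forall N \near \oo, K `<=` (fun (N : nat) z => `|g z| <= N%:R) N.
  apply: cK => z Kz; exists ([set w | `|g w - g z| < 1], [set N : nat | 1 + `|g z| <= N%:R]).
    split; last exact: (nbhs_infty_ger (1 + `|g z|)).
    have h : \forall w \near z, ball (g z) 1 (g w).
      exact: (cg z _ (@nbhsx_ballx R R (g z) 1 ltr01)).
    by apply: filterS h => w; rewrite /ball /= distrC.
  move=> [w N] [/= zw mN]; apply: le_trans mN; rewrite -[g w](subrK (g z)).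
  by apply: le_trans (ler_normD _ _) _; rewrite lerD2r ltW.
case=> N _ /(_ N (leqnn _)) KN; exists N.+1%:R => // z.
have [Kz|nKz] := pselect (K z); last by rewrite gK // normr0.
by apply: le_trans (KN z Kz) _; rewrite ler_nat.
Qed.

(** Heine's theorem, for functions on the whole space that vanish outside a
    compact set. *)
Lemma compact_unif_continuous_fun n (K : set 'rV[C]_n) (g : 'rV[C]_n -> R) :
  compact K -> continuous g -> (forall z, ~ K z -> g z = 0) ->
  forall eps : R, 0 < eps -> exists2 d : R, 0 < d &
    forall z w, cube z d w -> `|g w - g z| <= eps.
Proof.
move=> /compact_near_coveringP cK cg gK eps eps0.
have : \forall h \near (0 : 'rV[C]_n),
    K `<=` (fun h z => `|g (z + h) - g z| <= eps) h.
  apply: (cK _ _ (fun h z => `|g (z + h) - g z| <= eps) (nbhs_filter _)) => z Kz.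
  have e2 : 0 < eps / 2 by rewrite divr_gt0.
  have h1 : nbhs z [set w | `|g w - g z| < eps / 2].
    have h : \forall w \near z, ball (g z) (eps / 2) (g w).
      exact: (cg z _ (@nbhsx_ballx R R (g z) _ e2)).
    by apply: filterS h => w; rewrite /ball /= distrC.
  have h2 : \forall q \near (z, 0 : 'rV[C]_n), `|g (q.1 + q.2) - g z| < eps / 2.
    have /nbhs_cube[d d0 dg] := h1.
    have d2 : 0 < d / 2 by rewrite divr_gt0.
    exists (cube z (d / 2), cube 0 (d / 2)).
      by split; exact: nbhs_cube_center.
    move=> [w h] [/= /cubeP wz /cubeP h0]; apply: dg; apply/cubeP => q.
    rewrite toreal_add addrAC (le_lt_trans (ler_normD _ _)) //.
    by have := h0 q; rewrite toreal0 subr0 => h0q; rewrite [d]splitr ltrD.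
  have h3 : \forall q \near (z, 0 : 'rV[C]_n), `|g q.1 - g z| < eps / 2.
    exists ([set w | `|g w - g z| < eps / 2], setT); last by move=> [w h] [].
    by split; [exact: h1|exact: filterT].
  apply: filterS (filterI h2 h3) => -[w h] [/= {}h2 {}h3].
  rewrite [eps]splitr (le_trans (ler_distD (g z) _ _)) // lerD //; first exact: ltW.
  by rewrite distrC ltW.
move=> /nbhs_cube[d d0 dK]; exists d => // z w zw.
have [Kz|nKz] := pselect (K z).
  have -> : w = z + (w - z) by rewrite addrC subrK.
  apply: dK Kz; apply/cubeP => q; have /cubeP/(_ q) := zw.
  by rewrite toreal0 subr0 toreal_sub.
have [Kw|nKw] := pselect (K w); last by rewrite !gK // subrr normr0 ltW.
have -> : z = w + (z - w) by rewrite addrC subrK.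
rewrite distrC; apply: dK Kw; apply/cubeP => q; have /cubeP/(_ q) := zw.
by rewrite toreal0 subr0 toreal_sub distrC.
Qed.

Definition real_box k (rho : R) : set (k.-tuple R_) :=
  box (fun=> `[- rho, rho]%classic).
Arguments real_box : clear implicits.

Lemma measurable_real_box k rho : measurable (real_box k rho).
Proof. by apply: measurable_box => i; exact: measurable_itv. Qed.

Lemma lebesgue_real_box k rho : (lebesgue_tuple k (real_box k rho) < +oo)%E.
Proof.
rewrite lebesgue_tuple_box; last by move=> i; exact: measurable_itv.
suff /andP[] : (0 <= \prod_(i < k) lebesgue_measure (`[(- rho)%R, rho]%classic : set R_) < +oo)%E.
  by [].
elim/big_ind: _ => [|x y /andP[x0 xoo] /andP[y0 yoo]|i _].
- by rewrite lee01 ltry.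
- by rewrite mule_ge0 // lte_mul_pinfty // ge0_fin_numE.
- rewrite measure_ge0 lebesgue_measure_itv /=; case: ifP => // _.
  by rewrite -EFinB ltry.
Qed.

Lemma integrable_bounded_support k (f : k.-tuple R_ -> R) M rho :
  measurable_fun setT f -> (forall y, `|f y| <= M) ->
  (forall y, ~ real_box k rho y -> f y = 0) ->
  (lebesgue_tuple k).-integrable setT (EFin \o f).
Proof.
move=> mf fM f0; have mB := @measurable_real_box k rho.
have iB : (lebesgue_tuple k).-integrable (real_box k rho) (EFin \o f).
  apply: measurable_bounded_integrable => //; first exact: lebesgue_real_box.
    exact: measurable_funTS.
  exists M; split; first exact: num_real.
  by move=> x Mx y _ /=; apply: le_trans (fM y) (ltW Mx).
apply: eq_integrable ((integrable_mkcond _ mB).1 iB) => // y _.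
rewrite patchE; case: ifPn => // /negP yB /=; rewrite f0 // => By.
by apply: yB; exact: mem_set.
Qed.

Lemma measurable_fun_ofreal n (g : 'rV[C]_n -> R) : continuous g ->
  measurable_fun setT (g \o @ofreal R n).
Proof.
move=> cg; have := measurable_fun_continuous (@openT 'rV[C]_n) (fun z _ => cg z).
by rewrite preimage_setT.
Qed.

Section fiber_integral.
Variables (m n b : nat) (iota : 'I_(m * 2) -> 'I_(n * 2)) (kappa : 'I_b -> 'I_(n * 2)).
Variable e : 'I_(n * 2) -> 'I_(m * 2) + 'I_b.
Hypothesis e_iota : forall x, e (iota x) = inl x.
Hypothesis e_kappa : forall y, e (kappa y) = inr y.
Hypothesis eK : forall j, match e j with inl x => iota x | inr y => kappa y end = j.
Variable pr : 'rV[C]_n -> 'rV[C]_m.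
Hypothesis prE : forall w q, tnth (toreal (pr w)) q = tnth (toreal w) (iota q).

(** The point with coordinates z in the chosen factor and y in the others. *)
Definition glue (z : 'rV[C]_m) (y : b.-tuple R_) : 'rV[C]_n :=
  ofreal (merge e (toreal z) y).

Lemma pr_glue z y : pr (glue z y) = z.
Proof.
apply: toreal_inj; apply: eq_from_tnth => q.
by rewrite prE toreal_ofreal (tnth_merge_l e_iota).
Qed.

Lemma glue_line z y w s :
  glue z y + s%:C%C *: w =
  glue (z + s%:C%C *: pr w) (shift_tuple (fun l => s * tnth (toreal w) (kappa l)) y).
Proof.
apply: toreal_inj; apply: eq_from_tnth => q; rewrite toreal_line !toreal_ofreal.
case: (e q) (eK q) => l <-.
  by rewrite !(tnth_merge_l e_iota) toreal_line prE.
by rewrite !(tnth_merge_r e_kappa) [RHS]tnth_mktuple.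
Qed.

Lemma glue_add z z' y d : cube z d z' -> 0 < d -> cube (glue z y) d (glue z' y).
Proof.
move=> /cubeP zz' d0; apply/cubeP => q; rewrite !toreal_ofreal.
case: (e q) (eK q) => l <-; first by rewrite !(tnth_merge_l e_iota).
by rewrite !(tnth_merge_r e_kappa) subrr normr0.
Qed.

Lemma measurable_glue g z : continuous g ->
  measurable_fun setT (fun y => g (glue z y) : R).
Proof.
move=> cg.
rewrite (_ : (fun y => _) = (g \o @ofreal R n) \o
  ((fun p => merge e p.1 p.2) \o pair (toreal z))) //.
apply: measurableT_comp; first exact: measurable_fun_ofreal.
apply: measurableT_comp; first exact: measurable_merge e_iota e_kappa eK.
exact: pair1_measurable.
Qed.

Definition supported (K : set 'rV[C]_n) (g : 'rV[C]_n -> R) :=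
  continuous g /\ forall z, ~ K z -> g z = 0.

(** Integration over the coordinates complementary to a factor. Applied to a test
    function of the product it yields a test function of the factor. *)
Definition fiber (g : 'rV[C]_n -> R) (z : 'rV[C]_m) : R :=
  \int[lebesgue_tuple b]_y g (glue z y).

Variable K : set 'rV[C]_n.
Hypothesis cK : compact K.

(** One radius must serve all z at once: the fibre variable of a point of K is
    bounded since K is. *)
Lemma support_radius : exists2 rho : R, 0 < rho &
  forall g, supported K g -> forall z y, ~ real_box b rho y -> g (glue z y) = 0.
Proof.
have [rho rho0 Krho] := compact_bounded_coordinates cK; exists rho => // g [_ gK] z y yB.
apply: gK => Kg; apply: yB => l; rewrite /= in_itv /= -ler_norml.
by have := Krho _ Kg (kappa l); rewrite toreal_ofreal (tnth_merge_r e_kappa).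
Qed.

Lemma integrable_glue g z : supported K g ->
  (lebesgue_tuple b).-integrable setT (EFin \o (fun y => g (glue z y))).
Proof.
move=> gs; have [cg gK] := gs; have [rho _ H] := support_radius.
have [M _ gM] := compact_bounded_fun cK cg gK.
apply: (@integrable_bounded_support b _ M rho) => [|y|y yB].
- exact: measurable_glue.
- exact: gM.
- exact: H.
Qed.

Lemma continuous_fiber g : supported K g -> continuous (fiber g).
Proof.
move=> gs; have [cg gK] := gs; have [rho _ H] := support_radius.
move=> z0; have Fz := nbhs_filter z0; apply/cvgrPdist_le => eps eps0.
pose V := fine (lebesgue_tuple b (real_box b rho)).
have V0 : 0 <= V by rewrite fine_ge0.
have VE : lebesgue_tuple b (real_box b rho) = V%:E.
  by rewrite fineK // ge0_fin_numE // lebesgue_real_box.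
have e1 : 0 < eps / (V + 1) by rewrite divr_gt0 // ltr_wpDl.
have [d d0 gd] := compact_unif_continuous_fun cK cg gK e1.
apply/nbhs_cube; exists d => // z zz0 /=.
have mB := @measurable_real_box b rho.
pose h y := g (glue z0 y) - g (glue z y).
have hB y : ~ real_box b rho y -> h y = 0 by move=> yB; rewrite /h !H // subrr.
have ih : (lebesgue_tuple b).-integrable setT (EFin \o h).
  rewrite (_ : _ \o _ = fun y => (g (glue z0 y))%:E - (g (glue z y))%:E)%E //.
  by apply: integrableB => //; exact: integrable_glue.
have -> : fiber g z0 - fiber g z = \int[lebesgue_tuple b]_y h y.
  by rewrite /fiber -RintegralB //; exact: integrable_glue.
apply: le_trans (le_normr_Rintegral _ ih) _ => //.
have -> : \int[lebesgue_tuple b]_y `|h y| = \int[lebesgue_tuple b]_(y in real_box b rho) `|h y|.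
  rewrite [RHS]Rintegral_mkcond; apply: eq_Rintegral => y _.
  rewrite patchE; case: ifPn => // /negP yB; rewrite hB ?normr0 // => By.
  by apply: yB; exact: mem_set.
apply: (@le_trans _ _ (\int[lebesgue_tuple b]_(y in real_box b rho) (eps / (V + 1)))).
  apply: le_Rintegral => //.
  - apply: (@integrableS _ _ _ _ setT) => //.
    exact: integrable_norm.
  - apply: measurable_bounded_integrable => //.
      exact: lebesgue_real_box.
    exact: bounded_cst.
  - move=> y _; rewrite /h distrC; apply: gd; exact: glue_add.
rewrite Rintegral_cst // -/V -mulrA ler_piMr ?ltW //.
by rewrite ltr_pdivrMl ?ltr_wpDl // mulr1 ltrDl.
Qed.

Hypothesis cK' : closed K.

Definition smooth_supported (g : 'rV[C]_n -> R) :=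
  smooth setT g /\ forall z, ~ K z -> g z = 0.

Lemma smooth_supportedW g : smooth_supported g -> supported K g.
Proof.
by move=> [gs gK]; split=> // z; exact: (smooth_continuous (U := setT)).
Qed.

Lemma smooth_supported_rderive g v :
  smooth_supported g -> smooth_supported (rderive v g).
Proof.
move=> [gs gK]; split; first exact: smooth_rderive.
move=> z nKz; rewrite -(rderive_cst 0 v z).
by apply: (@eq_on_rderive R n (~` K)) => //; exact: closed_openC.
Qed.

Let quotient_line (g : 'rV[C]_n -> R) (p w : 'rV[C]_n) (s : R) :
  (fun h : R => h^-1 *: (g (p + (h + s)%:C%C *: w) - g (p + s%:C%C *: w) : R)) =
  (fun h : R => h^-1 *: (g (p + s%:C%C *: w + (h + 0)%:C%C *: w) -
                         g (p + s%:C%C *: w + (0 : R)%:C%C *: w) : R)).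
Proof.
apply/funext => h; rewrite scale0r !addr0.
by rewrite rmorphD scalerDl -addrA [s%:C%C *: w + _]addrC.
Qed.

Lemma derive1_line (g : 'rV[C]_n -> R) (p w : 'rV[C]_n) (s : R) :
  derive1 (fun s : R => g (p + s%:C%C *: w)) s = rderive w g (p + s%:C%C *: w).
Proof.
rewrite /rderive /derive1.
by have -> := quotient_line g p w s.
Qed.

Lemma derivable_line (g : 'rV[C]_n -> R) (p w : 'rV[C]_n) (s : R) : smooth setT g ->
  derivable (fun s : R => g (p + s%:C%C *: w)) s 1.
Proof.
move=> gs; have := @smooth_derivable R n setT (p + s%:C%C *: w) I g w gs.
have E (f : R -> R) x : derivable f x 1 = cvg (h^-1 *: (f (h + x) - f x) @[h --> 0^']).
  rewrite /derivable (_ : (fun h => _) = (fun h => h^-1 *: (f (h + x) - f x))) //.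
  by apply/funext => h /=; rewrite scaler1.
by rewrite !E; have -> := quotient_line g p w s.
Qed.

(** Differentiation under the integral sign. By translation invariance of the
    fibre measure a displacement w of the total space moves the fibre integral by
    pr w only. The derivative of g is bounded, and the translates of g by s w with
    |s| < 1 vanish outside one box, which gives the dominating function. *)
Lemma fiber_derive g z w : smooth_supported g ->
  derivable (fun s : R => fiber g (z + s%:C%C *: pr w)) 0 1 /\
  rderive (pr w) (fiber g) z = fiber (rderive w g) z.
Proof.
move=> gss; have [gs gK] := gss.
pose f s y := g (glue z y + s%:C%C *: w).
have fE : (fun s => fiber g (z + s%:C%C *: pr w)) =
    (fun s => \int[lebesgue_tuple b]_y f s y).
  apply/funext => s; rewrite /fiber /Rintegral; congr fine.
  rewrite -(integral_shift (fun l => s * tnth (toreal w) (kappa l))); last first.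
    exact/integrable_glue/smooth_supportedW.
  by apply: eq_integral => y _; rewrite /f glue_line.
have [rho rho0 H] := support_radius.
have dgs := smooth_supported_rderive w gss.
have [dg dgK] := smooth_supportedW dgs.
have [M M0 dM] := compact_bounded_fun cK dg dgK.
pose c := \sum_q `|tnth (toreal w) q|.
have c0 : 0 <= c by apply: sumr_ge0.
(* the translates by s w with |s| < 1 vanish outside the box of radius rho + c,
   since c bounds the coordinates of w *)
have far h : supported K h -> forall s y, `|s| < 1 -> ~ real_box b (rho + c) y ->
    h (glue z y + s%:C%C *: w) = 0.
  move=> hs s y s1 yB; rewrite glue_line; apply: H => // yB'; apply: yB => l.
  have := yB' l; rewrite /= !in_itv /= -!ler_norml [tnth (shift_tuple _ _) _]tnth_mktuple => yl.
  rewrite -[tnth y l](addrK (s * tnth (toreal w) (kappa l))).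
  apply: le_trans (ler_normB _ _) _; apply: lerD => //; rewrite normrM.
  apply: (@le_trans _ _ `|tnth (toreal w) (kappa l)|).
    by rewrite ler_piMl // ltW.
  by rewrite /c (bigD1 (kappa l)) //= lerDl sumr_ge0.
have mf h s : continuous h -> measurable_fun setT (fun y => h (glue z y + s%:C%C *: w) : R).
  move=> ch; apply: (@measurable_glue (fun v => h (v + s%:C%C *: w)) z) => v.
  suff : {for v, continuous (h \o (fun v => v + s%:C%C *: w))} by [].
  apply: continuous_comp; last exact: ch.
  move=> A /nbhs_cube[d d0 dA]; apply/nbhs_cube; exists d => // v' /cubeP vv'.
  by apply: dA; apply/cubeP => q; rewrite !toreal_line opprD addrACA subrr addr0.
have I1 (s : R) : s \in `]-1, 1[ -> `|s| < 1 by rewrite in_itv /= -ltr_norml.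
have [gc _] := smooth_supportedW gss.
have [M' _ gM'] := compact_bounded_fun cK gc gK.
have intf s : s \in `]-1, 1[ -> (lebesgue_tuple b).-integrable setT (EFin \o f s).
  move=> /I1 s1; apply: (@integrable_bounded_support b _ M' (rho + c)) => [|y|y yB].
  - exact: mf.
  - exact: gM'.
  - exact: far (smooth_supportedW gss) _ _ s1 yB.
pose G y := M * \1_(real_box b (rho + c)) y.
have mB := @measurable_real_box b (rho + c).
have iG : (lebesgue_tuple b).-integrable setT (EFin \o G).
  apply: (@integrable_bounded_support b _ M (rho + c)) => [|y|y yB].
  - by apply: measurable_funM => //; exact: measurable_indic.
  - by rewrite /G indicE; case: (_ \in _) => /=; rewrite ?(mulr1, mulr0, normr0) ?gtr0_norm // ltW.
  - by rewrite /G indicE memNset // mulr0.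
have d1E s y : partial1of2 f s y = rderive w g (glue z y + s%:C%C *: w).
  exact: derive1_line.
have dG s y : s \in `]-1, 1[ -> `|partial1of2 f s y| <= G y.
  move=> /I1 s1; rewrite d1E /G indicE.
  have [By|nBy] := pselect (real_box b (rho + c) y); first by rewrite mem_set // mulr1.
  by rewrite memNset // mulr0 far ?normr0.
have G0 y : 0 <= G y by rewrite /G indicE mulr_ge0 // ltW.
have I0 : (0 : R) \in `]-1, 1[ by rewrite in_itv /= ltrN10 ltr01.
have df s y : s \in `]-1, 1[ -> setT y -> derivable (f ^~ y) s 1.
  by move=> _ _; exact: derivable_line.
have der := @derivable_under_integral R _ _ (lebesgue_tuple b) f setT measurableT 0 (-1) 1 I0
  intf df G G0 iG (fun s y sI _ => dG s y sI).
have val := @differentiation_under_integral R _ _ (lebesgue_tuple b) f setT measurableT 0 (-1) 1 I0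
  intf df G G0 iG (fun s y sI _ => dG s y sI).
split; first by rewrite fE.
rewrite /rderive fE [LHS]val; apply: eq_Rintegral => y _.
by rewrite d1E scale0r addr0.
Qed.

Lemma fiber_eq0 g z : (forall y, ~ K (glue z y)) -> supported K g -> fiber g z = 0.
Proof.
move=> zK [_ gK]; rewrite /fiber /Rintegral integral0_eq // => y _.
by rewrite gK.
Qed.

Let lift_dir (v : 'rV[C]_m) : 'rV[C]_n := glue v [tuple 0 | _ < b].

Let pr_lift_dir v : pr (lift_dir v) = v. Proof. exact: pr_glue. Qed.

(** By fiber_derive the fibre integrals of compactly supported smooth functions are
    stable under derivatives, so smooth_on_coind applies. A direction of the
    factor is first lifted to the total space. *)
Lemma smooth_fiber g : smooth_supported g -> smooth setT (fiber g).
Proof.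
move=> gs.
apply: (@smooth_on_coind R m (setT `*` setT) (fun F => exists2 g, smooth_supported g &
  F = fiber g \o snd)) => //; last by exists g.
  by apply: open_cylinder; exact: openT.
move=> _ [h hs ->]; split=> [[t z] _|[t v]].
  split=> [|[t' v]].
    apply: (@continuous_comp _ _ _ snd (fiber h)); first exact: cvg_snd.
    exact/continuous_fiber/smooth_supportedW.
  by have [] := fiber_derive z (lift_dir v) hs; rewrite pr_lift_dir.
exists (fiber (rderive (lift_dir v) h) \o snd).
  by exists (rderive (lift_dir v) h) => //; exact: smooth_supported_rderive.
move=> [t' z] _; have [_] := fiber_derive z (lift_dir v) hs.
by rewrite pr_lift_dir; apply.
Qed.

Lemma rderive_fiber g v z : smooth_supported g ->
  rderive (pr v) (fiber g) z = fiber (rderive v g) z.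
Proof. by move=> gs; have [] := fiber_derive z v gs. Qed.

Lemma rderive2_fiber g v w z : smooth_supported g ->
  rderive (pr v) (rderive (pr w) (fiber g)) z = fiber (rderive v (rderive w g)) z.
Proof.
move=> gs; rewrite -rderive_fiber; last exact: smooth_supported_rderive.
by congr (rderive _ _ z); apply/funext => z'; exact: rderive_fiber.
Qed.

End fiber_integral.

End real_coordinates.

Arguments real_box {R} k rho _.

(** * Fubini for functions of one block *)

Section integrability.
Local Open Scope ereal_scope.
Context d (T : measurableType d) (R : realType) (mu : {measure set T -> \bar R}).

Lemma integrable_setU (A B : set T) (f : T -> \bar R) :
  measurable A -> measurable B -> mu.-integrable A f -> mu.-integrable B f ->
  mu.-integrable (A `|` B) f.
Proof.
move=> mA mB iA iB.
have mAB := measurableU _ _ mA mB.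
apply/(integrable_mkcond _ mAB).
have H := integrableD measurableT
  (integrable_abse ((integrable_mkcond f mA).1 iA))
  (integrable_abse ((integrable_mkcond f mB).1 iB)).
apply: le_integrable H => //.
  apply/(measurable_restrictT _ mAB).
  by apply/measurable_funU => //; split; [exact: measurable_int iA|exact: measurable_int iB].
move=> x _; rewrite [leRHS]gee0_abs ?adde_ge0 //= !patchE in_setU.
by case: (x \in A); case: (x \in B) => /=; rewrite ?normr0 ?adde0 ?add0e // ?leeDl //.
Qed.

Lemma integrable_bigcup_fset (I : choiceType) (D : {fset I}) (F : I -> set T)
    (f : T -> \bar R) :
  (forall i, i \in D -> measurable (F i)) ->
  (forall i, i \in D -> mu.-integrable (F i) f) ->
  mu.-integrable (\bigcup_(i in [set` D]) F i) f.
Proof.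
move=> mF iF.
pose s : seq I := D.
have -> : \bigcup_(i in [set` D]) F i = \big[setU/set0]_(i <- s) F i.
  by rewrite bigcup_seq.
have {}mF i : i \in s -> measurable (F i) by exact: mF.
have {}iF i : i \in s -> mu.-integrable (F i) f by exact: iF.
elim: s mF iF => [|i s IH] mF iF.
  rewrite big_nil; apply/integrableP; split; first exact: measurable_fun_set0.
  by rewrite integral_set0 ltry.
rewrite big_cons; apply: integrable_setU.
- by apply: mF; exact: mem_head.
- rewrite -bigcup_seq; apply: fin_bigcup_measurable => // j js.
  by apply: mF; rewrite in_cons js orbT.
- by apply: iF; exact: mem_head.
- by apply: IH => j js; [apply: mF|apply: iF]; rewrite in_cons js orbT.
Qed.

End integrability.

Section local_integrability.
Context {R : realType}.
Local Notation C := R[i].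
Notation R_ := (measurableTypeR R).

Definition loc_integrable n (U : set 'rV[C]_n) (f : 'rV[C]_n -> \bar R) :=
  forall z, U z -> exists W, [/\ open W, W z, W `<=` U &
    (lebesgue_tuple (n * 2)).-integrable (@ofreal R n @^-1` W) (f \o @ofreal R n)].

Lemma measurable_ofreal_compact n (K : set 'rV[C]_n) : closed K ->
  measurable (@ofreal R n @^-1` K).
Proof.
move=> cK; rewrite -[K]setCK preimage_setC; apply: measurableC.
exact: measurable_ofreal_open (closed_openC cK).
Qed.

(** A compact set meets only finitely many of the neighbourhoods of integrability. *)
Lemma loc_integrable_compact n (U K : set 'rV[C]_n) (f : 'rV[C]_n -> \bar R) :
  compact K -> closed K -> K `<=` U -> loc_integrable U f ->
  (lebesgue_tuple (n * 2)).-integrable (@ofreal R n @^-1` K) (f \o @ofreal R n).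
Proof.
move=> cK clK KU fU.
pose W z := if pselect (U z) is left Uz then projT1 (cid (fU z Uz)) else set0.
have WP z : U z -> [/\ open (W z), W z z, W z `<=` U &
    (lebesgue_tuple (n * 2)).-integrable (@ofreal R n @^-1` W z) (f \o @ofreal R n)].
  by rewrite /W; case: pselect => // Uz _; exact: projT2 (cid (fU z Uz)).
move: cK; rewrite compact_cover => /(_ 'rV[C]_n K W).
case=> [z /KU/WP[]//|z Kz|D DK KD].
  by exists z => //; have [] := WP z (KU _ Kz).
have sub : @ofreal R n @^-1` K `<=`
    \bigcup_(z in [set` D]) (@ofreal R n @^-1` W z).
  by move=> t /= /KD[z zD Wz]; exists z.
have mW z : z \in D -> measurable (@ofreal R n @^-1` W z).
  by move=> /DK/set_mem/KU/WP[oW _ _ _]; exact: measurable_ofreal_open.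
apply: integrableS sub _.
- by apply: fin_bigcup_measurable => // z; exact: mW.
- exact: measurable_ofreal_compact.
apply: integrable_bigcup_fset => // z /DK/set_mem/KU/WP[_ _ _].
exact.
Qed.

Lemma integrable_supported n (K : set 'rV[C]_n) g : compact K -> supported K g ->
  (lebesgue_tuple (n * 2)).-integrable setT (EFin \o (g \o @ofreal R n)).
Proof.
move=> cK [cg gK]; have [rho _ Krho] := compact_bounded_coordinates cK.
have [M _ gM] := compact_bounded_fun cK cg gK.
apply: (@integrable_bounded_support _ _ _ M rho) => [|t|t tB].
- exact: measurable_fun_ofreal.
- exact: gM.
- apply: gK => Kt; apply: tB => q; rewrite /= in_itv /= -ler_norml.
  by have := Krho _ Kt q; rewrite toreal_ofreal.
Qed.

Section fubini_block.
Local Open Scope ereal_scope.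
Variables (m n b : nat) (iota : 'I_(m * 2) -> 'I_(n * 2)) (kappa : 'I_b -> 'I_(n * 2)).
Variable e : 'I_(n * 2) -> 'I_(m * 2) + 'I_b.
Hypothesis e_iota : forall x, e (iota x) = inl x.
Hypothesis e_kappa : forall y, e (kappa y) = inr y.
Hypothesis eK : forall j, match e j with inl x => iota x | inr y => kappa y end = j.
Variable pr : 'rV[C]_n -> 'rV[C]_m.
Hypothesis prE : forall w q, tnth (toreal (pr w)) q = tnth (toreal w) (iota q).
Local Notation glue := (glue (R := R) (m := m) e).
Local Notation fiber := (fiber (R := R) (m := m) e).

Variable K : set 'rV[C]_n.
Hypotheses (cK : compact K) (clK : closed K).

Lemma glue_ofreal x y : ofreal (merge e x y) = glue (@ofreal R m x) y.
Proof. by rewrite /glue toreal_ofreal. Qed.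

Variables (u : (m * 2).-tuple R_ -> \bar R) (c : 'rV[C]_n -> R).
Hypothesis iu : (lebesgue_tuple (m * 2)).-integrable setT u.
Let J (t : (n * 2).-tuple R_) := u (toreal (pr (ofreal t))) * (c (ofreal t))%:E.

Let JE x y : J (merge e x y) = u x * (c (glue (ofreal x) y))%:E.
Proof. by rewrite /J glue_ofreal (pr_glue e_iota prE) toreal_ofreal. Qed.

Let mu : measurable_fun setT u. Proof. exact: measurable_int iu. Qed.

Section bounded.
Hypothesis mc : measurable_fun setT (c \o @ofreal R n).

Let mJ : measurable_fun setT J.
Proof.
apply: emeasurable_funM; last exact/measurable_EFinP.
apply: (measurableT_comp mu); apply/measurable_fun_tnthP => q.
rewrite (_ : _ \o _ = (fun t => tnth t (iota q))); first exact: measurable_tnth.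
by apply/funext => t; rewrite /= prE toreal_ofreal.
Qed.

Let mcg x : measurable_fun setT (fun y => c (glue (ofreal x) y)).
Proof.
rewrite (_ : (fun y => _) = (c \o @ofreal R n) \o
  ((fun p => merge e p.1 p.2) \o pair x)); last first.
  by apply/funext => y; rewrite /= glue_ofreal.
apply: measurableT_comp => //.
apply: measurableT_comp; first exact: measurable_merge e_iota e_kappa eK.
exact: pair1_measurable.
Qed.

(** By Tonelli the absolute integral is at most M times the volume of the box of
    radius rho times the integral of |u|. *)
Lemma integrable_block_bounded M rho : (0 <= M)%R -> (forall z, `|c z| <= M)%R ->
  (forall z y, ~ real_box b rho y -> c (glue z y) = 0%R) ->
  (lebesgue_tuple (n * 2)).-integrable setT J.
Proof.
move=> M0 cM H.
apply/integrableP; split=> //.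
rewrite (ge0_integral_merge e_iota e_kappa eK) //; last exact: measurableT_comp.
pose V := fine (lebesgue_tuple b (real_box b rho)).
have VE : lebesgue_tuple b (real_box b rho) = V%:E.
  by rewrite fineK // ge0_fin_numE // lebesgue_real_box.
have V0 : (0 <= V)%R by rewrite fine_ge0.
apply: (@le_lt_trans _ _ (\int[lebesgue_tuple (m * 2)]_x (`|u x| * (M * V)%:E))).
  apply: ge0_le_integral => //.
  - by move=> x _; apply: integral_ge0.
  - apply: (measurable_fun_fubini_tonelli_F
      (fun p : (m * 2).-tuple R_ * b.-tuple R_ => `|J (merge e p.1 p.2)|)) => //.
    apply: (measurableT_comp (f := abse)) => //; apply: measurableT_comp => //.
    exact: measurable_merge e_iota e_kappa eK.
  - by apply: emeasurable_funM => //; exact: measurableT_comp.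
  move=> x _; under eq_integral => y _ do rewrite JE abseM.
  rewrite ge0_integralZl //; last first.
    apply: measurableT_comp => //; apply/measurable_EFinP.
    exact: mcg.
  apply: lee_wpmul2l => //.
  have mB := @measurable_real_box R b rho.
  apply: (@le_trans _ _ (\int[lebesgue_tuple b]_(y in real_box b rho)
      `|(c (glue (ofreal x) y))%:E|)).
    rewrite [leRHS]integral_mkcond le_eqVlt; apply/orP; left; apply/eqP.
    apply: eq_integral => y _; rewrite patchE; case: ifPn => // /negP yB.
    by rewrite H ?abse0 // => By; apply: yB; exact: mem_set.
  rewrite EFinM -VE -(integral_cst (lebesgue_tuple b) mB).
  apply: ge0_le_integral => //.
  - apply: measurable_funTS; apply: measurableT_comp => //; apply/measurable_EFinP.
    exact: mcg.
  - by move=> y _; rewrite lee_fin; exact: cM.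
rewrite ge0_integralZr //; last 2 first.
- exact: measurableT_comp.
- by rewrite lee_fin mulr_ge0.
rewrite lte_mul_pinfty //; first exact: integral_ge0.
  rewrite ge0_fin_numE; last exact: integral_ge0.
  by have /integrableP[] := iu.
exact: ltry.
Qed.

End bounded.

Hypothesis cs : supported K c.

Lemma integrable_block : (lebesgue_tuple (n * 2)).-integrable setT J.
Proof.
have [cc cK0] := cs.
have [rho _ H] := support_radius e_kappa (m := m) cK.
have [M M0 cM] := compact_bounded_fun cK cc cK0.
apply: (@integrable_block_bounded _ M rho) => //; first exact: measurable_fun_ofreal.
  exact: ltW.
exact: H.
Qed.

(** Fubini, followed by pulling the factor u x out of the inner integral; this
    requires u x to be finite, which holds almost everywhere. *)
Lemma integral_block : \int[lebesgue_tuple (n * 2)]_t J t =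
  \int[lebesgue_tuple (m * 2)]_x (u x * (fiber c (ofreal x))%:E).
Proof.
rewrite (integral_merge e_iota e_kappa eK integrable_block).
have iJ := (integrable_merge e_iota e_kappa eK (measurable_int _ integrable_block)).1 integrable_block.
apply: ae_eq_integral => //.
- exact: (measurable_fubini_F iJ).
- apply: emeasurable_funM => //; apply/measurable_EFinP.
  apply: (measurable_fun_ofreal (g := fiber c)).
  exact: (continuous_fiber e_iota e_kappa eK cK cs).
have := integrable_ae measurableT iu.
apply: filterS => x /(_ I) ux _.
under eq_integral => y _ do rewrite JE.
rewrite -(fineK ux) integralZl //; last exact: (integrable_glue e_iota e_kappa eK cK).
congr (_ * _); rewrite /fiber /Rintegral fineK //.
by apply: integrable_fin_num => //; exact: (integrable_glue e_iota e_kappa eK cK).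
Qed.

End fubini_block.
End local_integrability.

(** * The complex Hessian of a fibre integral *)

(** Complementary coordinates of a factor, in arbitrary order. *)
Lemma complement_coordinates a k (iota : 'I_a -> 'I_k) : injective iota ->
  exists b (kappa : 'I_b -> 'I_k) (e : 'I_k -> 'I_a + 'I_b),
    [/\ forall x, e (iota x) = inl x, forall y, e (kappa y) = inr y &
        forall j, match e j with inl x => iota x | inr y => kappa y end = j].
Proof.
move=> inj; pose D := [pred j | [forall x, iota x != j]].
pose kappa : 'I_#|D| -> 'I_k := enum_val.
pose g (s : 'I_a + 'I_#|D|) := match s with inl x => iota x | inr y => kappa y end.
have kD y x : iota x != kappa y by have := enum_valP y; rewrite inE => /forallP.
have g_surj j : exists s, g s == j.
  have [/forallP jD|/forallPn[x /negPn jx]] := boolP [forall x, iota x != j].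
    have jD' : j \in D by rewrite inE; apply/forallP.
    by exists (inr (enum_rank_in jD' j)); rewrite /g /kappa enum_rankK_in.
  by exists (inl x).
have g_inj : injective g.
  move=> [x|y] [x'|y'] //= e; first by rewrite (inj _ _ e).
  - by have := kD y' x; rewrite e eqxx.
  - by have := kD y x'; rewrite e eqxx.
  - by rewrite (enum_val_inj e).
pose e j := sval (sigW (g_surj j)).
have gK j : g (e j) = j by rewrite /e; case: sigW => s /= /eqP.
exists #|D|, kappa, e; split=> [x|y|//].
- by apply: g_inj; rewrite gK.
- by apply: g_inj; rewrite gK.
Qed.

Section levi.
Context {R : realType}.
Local Notation C := R[i].
Notation R_ := (measurableTypeR R).
Local Notation e_ j := (delta_mx 0 j : 'rV[C]_ _).
Local Notation f_ j := ('i%C *: delta_mx 0 j : 'rV[C]_ _).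

Lemma supportedD n (K : set 'rV[C]_n) g h :
  supported K g -> supported K h -> supported K (fun z => g z + h z).
Proof.
move=> [cg gK] [ch hK]; split=> z; last by move=> nK; rewrite gK // hK // addr0.
have Fz := nbhs_filter z; exact: (cvgD (cg z) (ch z)).
Qed.

Lemma supportedZ n (K : set 'rV[C]_n) c g :
  supported K g -> supported K (fun z => c * g z).
Proof.
move=> [cg gK]; split=> z; last by move=> nK; rewrite gK // mulr0.
have Fz := nbhs_filter z; exact: (cvgM (cvg_cst c) (cg z)).
Qed.

Lemma supported0 n (K : set 'rV[C]_n) : supported K (fun=> 0 : R).
Proof. by split=> // z; have Fz := nbhs_filter z; exact: cvg_cst. Qed.

Lemma supported_sum n (K : set 'rV[C]_n) (I : Type) (r : seq I) (g : I -> 'rV[C]_n -> R) :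
  (forall i, supported K (g i)) -> supported K (fun z => \sum_(i <- r) g i z).
Proof.
move=> gs; elim: r => [|i r IH].
  by under eq_fun do rewrite big_nil; exact: supported0.
by under eq_fun do rewrite big_cons; exact: supportedD.
Qed.

Section fiber_linear.
Variables (m n b : nat) (iota : 'I_(m * 2) -> 'I_(n * 2)) (kappa : 'I_b -> 'I_(n * 2)).
Variable e : 'I_(n * 2) -> 'I_(m * 2) + 'I_b.
Hypothesis e_iota : forall x, e (iota x) = inl x.
Hypothesis e_kappa : forall y, e (kappa y) = inr y.
Hypothesis eK : forall j, match e j with inl x => iota x | inr y => kappa y end = j.
Local Notation fiber := (fiber (R := R) (m := m) e).
Variable K : set 'rV[C]_n.
Hypothesis cK : compact K.

Let ig g z : supported K g ->
  (lebesgue_tuple b).-integrable setT (EFin \o (fun y => g (glue e z y))).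
Proof. exact: (integrable_glue e_iota e_kappa eK cK). Qed.

Lemma fiberD g h z : supported K g -> supported K h ->
  fiber (fun w => g w + h w) z = fiber g z + fiber h z.
Proof. by move=> gs hs; rewrite /fiber RintegralD //; exact: ig. Qed.

Lemma fiberZ c g z : supported K g -> fiber (fun w => c * g w) z = c * fiber g z.
Proof. by move=> gs; rewrite /fiber RintegralZl //; exact: ig. Qed.

Lemma fiber_sum (I : Type) (r : seq I) (g : I -> 'rV[C]_n -> R) z :
  (forall i, supported K (g i)) ->
  fiber (fun w => \sum_(i <- r) g i w) z = \sum_(i <- r) fiber (g i) z.
Proof.
move=> gs; elim: r => [|i r IH].
  by rewrite big_nil /fiber; under eq_Rintegral do rewrite big_nil; rewrite Rintegral_cst ?mul0r.
rewrite big_cons -IH -fiberD //; last exact: supported_sum.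
by congr (fiber _ z); apply/funext => w; rewrite big_cons.
Qed.

End fiber_linear.

Lemma Re_ddcE n (U : set 'rV[C]_n) (u : 'rV[C]_n -> R) z M : U z -> smooth U u ->
  complex.Re (ddc u z M) = \sum_j \sum_k
    (complex.Re (levi_weight j k M) * levi_Re j k u z +
     - complex.Im (levi_weight j k M) * levi_Im j k u z).
Proof.
move=> Uz uU; rewrite (ddcE _ Uz) //.
rewrite (big_morph (@complex.Re R) (@ReD R) (erefl : complex.Re 0 = 0)).
apply: eq_bigr => j _; rewrite (big_morph (@complex.Re R) (@ReD R) (erefl : complex.Re 0 = 0)).
apply: eq_bigr => k _.
by case: (levi_weight j k M) => x y /=; rewrite mulNr; congr (_ - _); rewrite mulrC.
Qed.

Section supported_levi.
Variables (n : nat) (K : set 'rV[C]_n) (clK : closed K) (chi : 'rV[C]_n -> R).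
Hypothesis chis : smooth_supported K chi.

Lemma supported_rderive2 v w : supported K (rderive v (rderive w chi)).
Proof.
by apply: smooth_supportedW; do 2!apply: smooth_supported_rderive => //.
Qed.

Lemma supported_levi_Re j k : supported K (levi_Re j k chi).
Proof.
rewrite (_ : levi_Re _ _ _ = fun z => 4^-1 *
  (rderive (e_ j) (rderive (e_ k) chi) z + rderive (f_ j) (rderive (f_ k) chi) z)); last first.
  by apply/funext => z; rewrite mulrC.
by apply/supportedZ/supportedD; exact: supported_rderive2.
Qed.

Lemma supported_levi_Im j k : supported K (levi_Im j k chi).
Proof.
rewrite (_ : levi_Im _ _ _ = fun z => 4^-1 *
  (rderive (e_ j) (rderive (f_ k) chi) z + -1 * rderive (f_ j) (rderive (e_ k) chi) z)); last first.
  by apply/funext => z; rewrite mulN1r mulrC.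
apply/supportedZ/supportedD; first exact: supported_rderive2.
by apply: supportedZ; exact: supported_rderive2.
Qed.

Lemma supported_Re_ddc M : supported K (fun z => complex.Re (ddc chi z M)).
Proof.
rewrite (_ : (fun z => _) = (fun z => \sum_j \sum_k
    (complex.Re (levi_weight j k M) * levi_Re j k chi z +
     - complex.Im (levi_weight j k M) * levi_Im j k chi z))); last first.
  by apply/funext => z; apply: (Re_ddcE _ (U := setT)) => //; have [] := chis.
apply: supported_sum => j; apply: supported_sum => k.
by apply: supportedD; apply: supportedZ; [exact: supported_levi_Re|exact: supported_levi_Im].
Qed.

End supported_levi.

End levi.

Section psh_sum.
Context {R : realType}.
Local Notation C := R[i].
Notation R_ := (measurableTypeR R).
Variables (r : nat) (X : 'I_r -> complex_manifold R).
Local Notation n_ i := (cm_dim (X i)).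
Local Notation N := (\sum_(i < r) cm_dim (X i))%N.
Local Notation pr i := (@proj R r (fun i => cm_dim (X i)) i).
Local Notation iota_ i := (@iota2 r (fun i => cm_dim (X i)) i).
Local Notation e_ j := (delta_mx 0 j : 'rV[C]_ _).
Local Notation f_ j := ('i%C *: delta_mx 0 j : 'rV[C]_ _).

Lemma toreal_proj i (w : 'rV[C]_N) q :
  tnth (toreal (pr i w)) q = tnth (toreal w) (iota_ i q).
Proof. by rewrite !tnth_mktuple /iota2 odd_dbl half_dbl mxE. Qed.

Lemma prod_img_proj (a : prod_index X) (z : 'rV[C]_N) :
  cm_img (X := prod_manifold X) a z <-> forall i, cm_img (a i) (pr i z).
Proof.
suff -> : cm_img (X := prod_manifold X) a = [set z | forall i, cm_img (a i) (submxrow z i)].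
  by [].
exact: (@prod_imgE R r X a).
Qed.

Section one_block.
Variables (i : 'I_r) (om : diff_form (X i) 2) (u : X i -> \bar R).
Hypothesis omS : smooth_real_form om.
Hypothesis upsh : PSH om u.
Variables (a : prod_index X) (v : 'rV[C]_N) (chi : 'rV[C]_N -> R).
Hypothesis chiT : test_fun (X := prod_manifold X) a chi.
Hypothesis chi0 : forall z, 0 <= chi z.
Let V : 'M[C]_(2, N) := col_mx v ('i%C *: v).
Let Vi : 'M[C]_(2, n_ i) := col_mx (pr i v) ('i%C *: pr i v).

Let ui (z : 'rV[C]_(n_ i)) := u (cm_inv (a i) z).

Lemma psh_loc_integrable : loc_integrable (cm_img (a i)) ui.
Proof.
move=> z [x ax <-]; have [_ _ uL _ _] := upsh.
by have [W [oW Wx WU iW]] := uL x (a i) ax; exists W.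
Qed.

(** Fibre integration commutes with second derivatives, and derivatives along the
    fibres integrate to zero, so dd^c of the fibre integral evaluated on the
    projected vectors is the fibre integral of dd^c. *)
Lemma Re_ddc_fiber (K : set 'rV[C]_N) b (kappa : 'I_b -> 'I_(N * 2))
    (e : 'I_(N * 2) -> 'I_(n_ i * 2) + 'I_b) z M :
  compact K -> closed K -> smooth_supported K chi ->
  (forall x, e (iota_ i x) = inl x) -> (forall y, e (kappa y) = inr y) ->
  (forall j, match e j with inl x => iota_ i x | inr y => kappa y end = j) ->
  fiber (m := n_ i) e (fun w => complex.Re (ddc chi w M)) z =
  complex.Re (pullback (pr i) (ddc (fiber (m := n_ i) e chi) z) M).
Proof.
move=> cK clK chis e_iota e_kappa eK.
have prE := @toreal_proj i.
have chiS : smooth setT chi by case: chis.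
have fS : smooth setT (fiber (m := n_ i) e chi).
  exact: (smooth_fiber e_iota e_kappa eK prE cK clK chis).
pose D v w := fiber (m := n_ i) e (rderive v (rderive w chi)) z.
have sR := supported_levi_Re clK chis; have sI := supported_levi_Im clK chis.
have s2 := supported_rderive2 clK chis.
have HR j k : fiber (m := n_ i) e (levi_Re j k chi) z =
    (D (e_ j) (e_ k) + D (f_ j) (f_ k)) / 4.
  rewrite mulrC -(fiberD e_iota e_kappa eK cK z (s2 _ _) (s2 _ _)).
  rewrite -(fiberZ e_iota e_kappa eK cK); last exact: supportedD.
  by congr fiber; apply/funext => w; rewrite mulrC.
have HI j k : fiber (m := n_ i) e (levi_Im j k chi) z =
    (D (e_ j) (f_ k) - D (f_ j) (e_ k)) / 4.
  rewrite mulrC -[- D _ _]mulN1r -(fiberZ e_iota e_kappa eK cK _ _ (s2 _ _)).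
  rewrite -(fiberD e_iota e_kappa eK cK z (s2 _ _) (supportedZ _ (s2 _ _))).
  rewrite -(fiberZ e_iota e_kappa eK cK); last exact: supportedD (s2 _ _) (supportedZ _ (s2 _ _)).
  by congr fiber; apply/funext => w; rewrite mulrC mulN1r.
rewrite (_ : (fun w => _) = fun w => \sum_j \sum_k
    (complex.Re (levi_weight j k M) * levi_Re j k chi w +
     - complex.Im (levi_weight j k M) * levi_Im j k chi w)); last first.
  by apply/funext => w; exact: (Re_ddcE (U := setT)).
have sk j k : supported K (fun w => complex.Re (levi_weight j k M) * levi_Re j k chi w +
     - complex.Im (levi_weight j k M) * levi_Im j k chi w).
  by apply: supportedD; apply: supportedZ.
rewrite (fiber_sum e_iota e_kappa eK cK); last by move=> j; apply: supported_sum.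
under eq_bigr => j _ do rewrite (fiber_sum e_iota e_kappa eK cK _ _ (sk j)).
transitivity (complex.Re (\sum_j \sum_k ((D (e_ j) (e_ k) + D (f_ j) (f_ k)) / 4 +i*
      ((D (e_ j) (f_ k) - D (f_ j) (e_ k)) / 4))%C * levi_weight j k M)).
  rewrite (big_morph (@complex.Re R) (@ReD R) (erefl : complex.Re 0 = 0)).
  apply: eq_bigr => j _; rewrite (big_morph (@complex.Re R) (@ReD R) (erefl : complex.Re 0 = 0)).
  apply: eq_bigr => k _.
  rewrite (fiberD e_iota e_kappa eK cK z (supportedZ _ (sR _ _)) (supportedZ _ (sI _ _))).
  rewrite (fiberZ e_iota e_kappa eK cK _ _ (sR _ _)) (fiberZ e_iota e_kappa eK cK _ _ (sI _ _)).
  rewrite HR HI; case: (levi_weight j k M) => x y /=.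
  by rewrite mulNr; congr (_ - _); rewrite mulrC.
rewrite /pullback (ddcE (U := setT) _ _ fS) //; congr complex.Re.
apply: (sum_levi_block (D := D) (D' := fun v w => rderive v (rderive w (fiber (m := n_ i) e chi)) z)).
- move=> v' w'; apply/esym; exact: (rderive2_fiber e_iota e_kappa eK prE cK clK).
- by move=> w; exact: rderive0.
- move=> v'; rewrite (_ : rderive 0 _ = fun=> 0) ?rderive_cst //.
  by apply/funext => y; exact: rderive0.
Qed.

(** The contribution of one factor to the positivity of the product current. After
    Fubini the integral is the same current of the factor i, tested against the
    fibre integral of chi, which is again a nonnegative test function. The
    integrability is what allows the contributions to be added up. *)
Lemma block_current :
  let J (t : (N * 2).-tuple R_) :=
    ((chi (ofreal t) * complex.Re (om (a i) (pr i (ofreal t)) Vi))%:E +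
     ui (pr i (ofreal t)) * (complex.Re (ddc chi (ofreal t) V))%:E)%E in
  (lebesgue_tuple (N * 2)).-integrable setT J /\
  (0 <= \int[lebesgue_tuple (N * 2)]_t J t)%E.
Proof.
move=> J; have [chiS [K [cK Ka chiK]]] := chiT.
have clK : closed K.
  apply: compact_closed cK; exact: norm_hausdorff.
have chis : smooth_supported K chi by [].
have chiK' := smooth_supportedW chis.
have [b [kappa [e [e_iota e_kappa eK]]]] :=
  complement_coordinates (blocks_inj (blocks_iota2 (fun i => n_ i)) (i := i)).
have prE := @toreal_proj i.
pose c z := complex.Re (ddc chi z V).
have cs : supported K c by exact: supported_Re_ddc.
pose K1 := pr i @` K.
have cK1 : compact K1.
  apply: continuous_compact cK; apply: continuous_subspaceT; exact: continuous_proj.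
have clK1 : closed K1 by apply: compact_closed cK1; exact: norm_hausdorff.
have K1a : K1 `<=` cm_img (a i).
  by move=> _ [z Kz <-]; have /prod_img_proj := Ka z Kz; exact.
pose w0 z := complex.Re (om (a i) z Vi).
have cw0 z : cm_img (a i) z -> {for z, continuous w0}.
  move=> az; have [_ _ omSm _] := omS.
  exact: (@smooth_continuous R _ (cm_img (a i)) z az w0 (omSm (a i) Vi)).
pose g1 z := chi z * w0 (pr i z).
have g1s : supported K g1.
  split=> z; last by move=> nK; rewrite /g1 chiK // mul0r.
  have Fz := nbhs_filter z.
  have [Kz|nKz] := pselect (K z).
    suff : g1 x @[x --> z] --> g1 z by [].
    apply: cvgM; first by have [+ _] := chiK'; exact.
    suff : {for z, continuous (w0 \o pr i)} by [].
    apply: continuous_comp; first exact: continuous_proj.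
    by apply: cw0; apply: K1a; exists z.
  suff : g1 x @[x --> z] --> g1 z by [].
  rewrite {2}/g1 chiK // mul0r; apply: cvg_near_cst.
  have : nbhs z (~` K) by apply: open_nbhs_nbhs; split=> //; exact: closed_openC.
  by apply: filterS => w nKw; rewrite /g1 chiK // mul0r.
(* u is only locally integrable: cut it off outside the projected support *)
pose u' (t : (n_ i * 2).-tuple R_) : \bar R := if `[< K1 (ofreal t) >] then ui (ofreal t) else 0%E.
have iu' : (lebesgue_tuple (n_ i * 2)).-integrable setT u'.
  have := loc_integrable_compact cK1 clK1 K1a psh_loc_integrable.
  move=> /(integrable_mkcond _ (measurable_ofreal_compact clK1)).
  by apply: eq_integrable.
have uE z : K z -> u' (toreal (pr i z)) = ui (pr i z).
  by move=> Kz; rewrite /u' ofreal_toreal asboolT //; exists z.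
have JE t : J t = ((g1 (ofreal t))%:E +
    u' (toreal (pr i (ofreal t))) * (c (ofreal t))%:E)%E.
  rewrite /J -/(c _) -/(g1 _); congr (_ + _)%E.
  have [Kt|nKt] := pselect (K (ofreal t)); first by rewrite uE.
  by have [_ ->//] := cs; rewrite !mule0.
have i1 := integrable_supported cK g1s.
have i2 := integrable_block e_iota e_kappa eK prE cK iu' cs.
have iJ : (lebesgue_tuple (N * 2)).-integrable setT J.
  by apply: eq_integrable (integrableD measurableT i1 i2) => // t _; rewrite JE.
split=> //.
have -> : (\int[lebesgue_tuple (N * 2)]_t J t =
  \int[lebesgue_tuple (n_ i * 2)]_x
    ((fiber e g1 (ofreal x))%:E + u' x * (fiber e c (ofreal x))%:E))%E.
  under eq_integral => t _ do rewrite JE.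
  rewrite (integralD measurableT i1 i2) (integral_block e_iota e_kappa eK prE cK iu' cs).
  rewrite integralD //; last 2 first.
  - apply: (@integrable_supported R (n_ i) K1 (fiber (m := n_ i) e g1) cK1); split.
      exact: (continuous_fiber e_iota e_kappa eK cK g1s).
    move=> z nz; apply: fiber_eq0 g1s => y Ky; apply: nz.
    by exists (glue e z y) => //; exact: (pr_glue e_iota prE).
  - have cf := continuous_fiber e_iota e_kappa eK cK cs.
    have f0 z : ~ K1 z -> fiber (m := n_ i) e c z = 0.
      move=> nz; apply: fiber_eq0 cs => y Ky; apply: nz.
      by exists (glue e z y) => //; exact: (pr_glue e_iota prE).
    have [B B0 HB] := compact_bounded_fun cK1 cf f0.
    apply: (integrableMl measurableT iu').
      exact: measurable_fun_ofreal cf.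
    exists B; split; first exact: num_real.
    by move=> y By t _; apply: le_trans (HB _) _; exact: ltW.
  congr (_ + _)%E.
  rewrite (integral_merge e_iota e_kappa eK i1); apply: eq_integral => x _.
  rewrite /fiber /Rintegral fineK; last first.
    by apply: integrable_fin_num => //; exact: (integrable_glue e_iota e_kappa eK cK _ g1s).
  by apply: eq_integral => y _; rewrite /= glue_ofreal.
have fchi : test_fun (a i) (fiber (m := n_ i) e chi).
  split; first exact: (smooth_fiber e_iota e_kappa eK prE cK clK chis).
  exists K1; split=> // z nz; apply: fiber_eq0 chiK' => y Ky; apply: nz.
  by exists (glue e z y) => //; exact: (pr_glue e_iota prE).
have fchi0 z : 0 <= fiber (m := n_ i) e chi z by apply: Rintegral_ge0 => y _.
have [_ _ _ _ /(_ (a i) (pr i v) _ fchi fchi0)] := upsh.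
rewrite -/Vi; congr (_ <= _)%E; apply: eq_integral => x _ /=.
set z := ofreal x.
have -> : fiber (m := n_ i) e g1 z = fiber (m := n_ i) e chi z * w0 z.
  rewrite mulrC -(fiberZ e_iota e_kappa eK cK _ _ chiK'); congr fine.
  apply: eq_integral => y _ /=.
  by rewrite /g1 (pr_glue e_iota prE) mulrC.
have fcE : fiber (m := n_ i) e c z = complex.Re (ddc (fiber (m := n_ i) e chi) z Vi).
  rewrite (Re_ddc_fiber _ _ cK clK chis e_iota e_kappa eK).
  by rewrite pullback_col_mx projZ.
rewrite -fcE; congr (_ + _)%E.
have [Kz|nKz] := pselect (K1 z); first by rewrite /u' asboolT.
rewrite (_ : fiber (m := n_ i) e c z = 0) ?mule0 //.
apply: fiber_eq0 cs => y Ky; apply: nKz.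
by exists (glue e z y) => //; exact: (pr_glue e_iota prE).
Qed.

End one_block.
End psh_sum.

(** * Sums of quasi-plurisubharmonic functions *)

Section upper_semicontinuous.
Context {R : realType}.

(** The same condition as lower semicontinuity of the opposite function, in the form
    in which it passes to sums and to composites. *)
Definition upper_semicont (Y : topologicalType) (f : Y -> \bar R) :=
  forall x (a : R), (f x < a%:E)%E -> \forall y \near x, (f y < a%:E)%E.

Lemma upper_semicontP (Y : topologicalType) (f : Y -> \bar R) :
  lower_semicontinuous (fun x => - f x)%E <-> upper_semicont f.
Proof.
split=> [H x a fa|H x a fa].
  have := H x (- a); rewrite EFinN lteN2 => /(_ fa) [V xV HV].
  by apply: filterS xV => y /HV; rewrite lteN2.
exists [set y | (f y < (- a)%:E)%E].
  by apply: H; rewrite EFinN lteNr.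
by move=> y /=; rewrite EFinN lteNr.
Qed.

(** A sum below a can be witnessed by separate bounds on the terms, also when one
    of the terms is -oo. *)
Lemma adde_lt_split (x y : \bar R) (a : R) : (x < +oo)%E -> (y < +oo)%E ->
  (x + y < a%:E)%E ->
  exists b c : R, [/\ (x < b%:E)%E, (y < c%:E)%E & b + c <= a].
Proof.
case: x => [x||] // _; case: y => [y||] // _.
- rewrite -EFinD lte_fin => h; exists (x + (a - (x + y)) / 2), (y + (a - (x + y)) / 2).
  by split; rewrite ?lte_fin; lra.
- move=> _; exists (x + 1), (a - (x + 1)); split; rewrite ?ltNyr ?lte_fin //; lra.
- move=> _; exists (a - (y + 1)), (y + 1); split; rewrite ?ltNyr ?lte_fin //; lra.
by move=> _; exists 0, a; split; rewrite ?ltNyr // add0r.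
Qed.

Lemma upper_semicontD (Y : topologicalType) (f g : Y -> \bar R) :
  (forall x, f x < +oo)%E -> (forall x, g x < +oo)%E ->
  upper_semicont f -> upper_semicont g -> upper_semicont (fun x => f x + g x)%E.
Proof.
move=> fy gy cf cg x a /(adde_lt_split (fy x) (gy x)) [b [c [fb gc bc]]].
have Fx := nbhs_filter x.
apply: filterS2 (cf x b fb) (cg x c gc) => y fb' gc'.
apply: lt_le_trans (_ : (b%:E + c%:E <= a%:E)%E); first exact: lteD.
by rewrite -EFinD lee_fin.
Qed.

Lemma upper_semicont_sum (Y : topologicalType) (I : Type) (r : seq I) (f : I -> Y -> \bar R) :
  (forall i x, f i x < +oo)%E -> (forall i, upper_semicont (f i)) ->
  upper_semicont (fun x => \sum_(i <- r) f i x)%E.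
Proof.
move=> fy cf; elim: r => [|i r IH].
  move=> x a; rewrite big_nil => a0; have Fx := nbhs_filter x.
  by apply: nearW => y; rewrite big_nil.
rewrite (_ : (fun x => _) = fun x => f i x + \sum_(j <- r) f j x)%E.
  apply: upper_semicontD => // x; exact: lte_sum_pinfty.
by apply/funext => x; rewrite big_cons.
Qed.

Lemma upper_semicont_comp (Y Z : topologicalType) (h : Z -> Y) (f : Y -> \bar R) :
  continuous h -> upper_semicont f -> upper_semicont (f \o h).
Proof. by move=> ch cf x a fa; exact: (ch x _ (cf _ _ fa)). Qed.

Lemma sume_muler (I : Type) (r : seq I) (f : I -> \bar R) (c : R) :
  (forall i, f i < +oo)%E ->
  ((\sum_(i <- r) f i) * c%:E = \sum_(i <- r) f i * c%:E)%E.
Proof.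
move=> fy; elim: r => [|i r IH]; first by rewrite !big_nil mul0e.
rewrite !big_cons muleDl // ?IH //.
have: (\sum_(j <- r) f j < +oo)%E by exact: lte_sum_pinfty.
by have := fy i; case: (f i) => [?||] //; case: (\sum_(j <- r) f j)%E.
Qed.

End upper_semicontinuous.

Section psh_sum.
Context {R : realType}.
Local Notation C := R[i].
Local Notation R_ := (measurableTypeR R).
Variables (r : nat) (X : 'I_r -> complex_manifold R).
Local Notation n_ i := (cm_dim (X i)).
Local Notation N := (\sum_(i < r) cm_dim (X i))%N.
Local Notation pr i := (@proj R r (fun i => cm_dim (X i)) i).
Local Notation iota_ i := (@iota2 r (fun i => cm_dim (X i)) i).

(** On a bounded product neighbourhood each summand depends on one factor and is
    integrable there, and the other coordinates contribute a bounded factor. *)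
Lemma L1loc_sum (u : forall i, X i -> \bar R) (x : prod_manifold X) :
  (forall i, L1loc_at (u i) (x i)) ->
  L1loc_at (X := prod_manifold X) (fun y => \sum_i u i (y i))%E x.
Proof.
move=> uL a ax.
have W_ i : {W : set 'rV[C]_(n_ i) | [/\ open W, W (cm_chart (a i) (x i)),
   W `<=` cm_img (a i) & (lebesgue_tuple (n_ i * 2)).-integrable
      (@ofreal R (n_ i) @^-1` W) (u i \o cm_inv (a i) \o @ofreal R (n_ i))]}.
  by apply: cid; have [W ?] := uL i (a i) (ax i); exists W.
pose W i := sval (W_ i); have HW i := svalP (W_ i).
set z0 : 'rV[C]_N := cm_chart a x.
pose U : set 'rV[C]_N := cube z0 1 `&` [set z | forall i, W i (pr i z)].
have oU : open U.
  apply: openI; first exact: open_cube.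
  rewrite openE => z Wz.
  suff: \forall w \near z, forall i, W i (pr i w) by [].
  apply: (@filter_forall _ _ _ _ (nbhs_filter z)) => i.
  by apply: (@continuous_proj R r _ i z); apply: open_nbhs_nbhs; split; case: (HW i).
exists U; split=> //.
- split; first exact: cube_center.
  by move=> i; rewrite /proj mxrowK; case: (HW i).
- move=> z [_ Wz]; apply/prod_img_proj => i.
  by case: (HW i) => _ _ + _; apply; exact: Wz.
have mU := measurable_ofreal_open oU.
rewrite (_ : _ \o _ = fun t => \sum_i (u i (cm_inv (a i) (pr i (ofreal t)))))%E; last by [].
apply: integrable_sum => // i _.
have [oW _ _ iW] := HW i.
have [b [kappa [e [e_iota e_kappa eK]]]] :=
  complement_coordinates (blocks_inj (blocks_iota2 (fun i => n_ i)) (i := i)).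
have prE := @toreal_proj R r X i.
pose f t := (u i \o cm_inv (a i) \o @ofreal R (n_ i)) t.
pose u' := (f \_ (@ofreal R (n_ i) @^-1` W i))%E.
have iu' : (lebesgue_tuple (n_ i * 2)).-integrable setT u'.
  exact/(integrable_mkcond _ (measurable_ofreal_open oW)).
pose c : 'rV[C]_N -> R := \1_U.
(* a radius that bounds all coordinates of the unit cube around z0 *)
pose rho := \sum_q (`|tnth (toreal z0) q| + 1).
have iJ : (lebesgue_tuple (N * 2)).-integrable setT
    (fun t => u' (toreal (pr i (ofreal t))) * (c (ofreal t))%:E)%E.
  apply: (integrable_block_bounded e_iota e_kappa eK prE iu' (c := c) _ (M := 1) (rho := rho)) => //.
  - rewrite (_ : c \o _ = \1_(@ofreal R N @^-1` U)); last first.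
      by apply/funext => t; rewrite /= /c !indicE.
    exact: measurable_indic.
  - by move=> z; rewrite /c indicE; case: (_ \in _) => /=; rewrite ?normr1 ?normr0.
  - move=> z y nb; rewrite /c indicE memNset // => -[/cubeP zy _]; apply: nb => l.
    rewrite /= in_itv /= -ler_norml.
    have := zy (kappa l); rewrite /glue toreal_ofreal (tnth_merge_r e_kappa) => yl.
    have h q : 0 <= `|tnth (toreal z0) q| + 1 by rewrite addr_ge0.
    rewrite /rho (bigD1 (kappa l)) //= ler_wpDr //; first by apply: sumr_ge0.
    rewrite -(subrK (tnth (toreal z0) (kappa l)) (tnth y l)) addrC.
    apply: le_trans (ler_normD _ _) _; rewrite lerD2l; exact: ltW.
have := integrableS measurableT mU (@subsetT _ _) iJ.
apply: eq_integrable => // t /set_mem [cUt WUt].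
rewrite /c indicE mem_set // mule1 /u' patchE /f /= ofreal_toreal mem_set //=.
by rewrite ofreal_toreal; exact: WUt.
Qed.

(** Semicontinuity and local integrability are checked term by term, and positivity
    of the current is the sum of the inequalities of block_current. *)
Lemma PSH_sum (om : forall i, diff_form (X i) 2) (u : forall i, X i -> \bar R) :
  (forall i, smooth_real_form (om i)) -> (forall i, PSH (om i) (u i)) ->
  PSH (X := prod_manifold X) (prod_kahler om) (fun x => \sum_i u i (x i))%E.
Proof.
move=> omS upsh.
have uy i y : (u i y < +oo)%E by have [] := upsh i.
split.
- by move=> x; apply: lte_sum_pinfty.
- apply/upper_semicontP.
  apply: (@upper_semicont_sum _ _ _ _ (fun i (x : prod_manifold X) => u i (x i))) => // i.
  apply: (@upper_semicont_comp _ _ _ (fun x : prod_manifold X => x i)).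
    exact: (@proj_continuous 'I_r (fun i => X i : topologicalType) i).
  by apply/upper_semicontP; have [] := upsh i.
- by move=> x; apply: L1loc_sum => i; have [] := upsh i.
- have x i : {y | u i y != -oo%E} by apply: cid; have [] := upsh i.
  exists (fun i => sval (x i)); rewrite esum_eqNy; apply/existsPn => i /=.
  exact: svalP (x i).
move=> a v chi chiT chi0; lazy zeta; set V := col_mx v ('i%C *: v).
have B i := block_current (omS i) (upsh i) v chiT chi0.
rewrite (_ : (fun t => _) = (fun t => \sum_i
  ((chi (ofreal t) * complex.Re (om i (a i) (pr i (ofreal t)) (col_mx (pr i v) ('i%C *: pr i v))))%:E +
     u i (cm_inv (a i) (pr i (ofreal t))) * (complex.Re (ddc chi (ofreal t) V))%:E)))%E.
  rewrite integral_sum //; last by move=> i; have [] := B i.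
  by apply: sume_ge0 => i _; have [] := B i.
apply/funext => t /=; rewrite big_split /= sumEFin -sume_muler //.
congr (_ + _)%E; congr EFin.
rewrite /prod_kahler (big_morph (@complex.Re R) (@ReD R) (erefl : complex.Re 0 = 0)).
rewrite mulr_sumr; apply: eq_bigr => i _; congr (_ * complex.Re _).
rewrite /pr_pullback.
by rewrite -/(pr i _) (pullback_col_mx (pr i)) projZ.
Qed.

End psh_sum.

(** * The product Kahler form and volume form *)

Section real_smooth.
Context {R : realType}.
Local Notation C := R[i].

(** Forms have complex values, whereas smoothness is a notion for real functions;
    real values make the real part multiplicative. *)
Definition real_smooth n (U : set 'rV[C]_n) (f : 'rV[C]_n -> C) :=
  (forall z, U z -> f z \is Num.real) /\ smooth U (fun z => complex.Re (f z)).

Section closure.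
Variables (n : nat) (U : set 'rV[C]_n).
Hypothesis oU : open U.

Lemma smooth_cst c : smooth U (fun=> c).
Proof. by apply: smooth_algebraP; [exact: open_cylinder|exact: SmoothCst]. Qed.

Lemma real_smooth_cst (c : C) : c \is Num.real -> real_smooth U (fun=> c).
Proof. by move=> cR; split=> //; exact: smooth_cst. Qed.

Lemma real_smooth_sum (I : Type) (s : seq I) (f : I -> 'rV[C]_n -> C) :
  (forall i, real_smooth U (f i)) -> real_smooth U (fun z => \sum_(i <- s) f i z).
Proof.
move=> fS; split=> [z Uz|]; first by apply: rpred_sum => i _; case: (fS i) => + _; exact.
rewrite (_ : (fun z => _) = fun z => \sum_(i <- s) complex.Re (f i z)).
  by apply: smooth_sum => // i; case: (fS i).
by apply/funext => z; rewrite (big_morph (@complex.Re R) (@ReD R) (erefl : complex.Re 0 = 0)).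
Qed.

Lemma Re_realM (x y : C) : x \is Num.real -> y \is Num.real ->
  complex.Re (x * y) = complex.Re x * complex.Re y.
Proof. by move=> /complex_realP[k ->] /complex_realP[l ->] /=; rewrite mulr0 subr0. Qed.

Lemma real_smoothM (f g : 'rV[C]_n -> C) :
  real_smooth U f -> real_smooth U g -> real_smooth U (fun z => f z * g z).
Proof.
move=> [fR fS] [gR gS]; split=> [z Uz|].
  by apply: realM; [exact: fR | exact: gR].
apply: (eq_smooth_on (f := fun p => complex.Re (f p.2) * complex.Re (g p.2))).
- exact: open_cylinder.
- by move=> p [_ Up] /=; rewrite Re_realM //; [exact: fR | exact: gR].
apply: smooth_algebraP; first exact: open_cylinder.
by apply: SmoothM; apply: SmoothLeaf.
Qed.

Lemma real_smooth_prod (I : Type) (s : seq I) (f : I -> 'rV[C]_n -> C) :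
  (forall i, real_smooth U (f i)) -> real_smooth U (fun z => \prod_(i <- s) f i z).
Proof.
move=> fS; elim: s => [|i s IH].
  rewrite (_ : (fun z => _) = fun=> 1); first exact: real_smooth_cst.
  by apply/funext => z; rewrite big_nil.
rewrite (_ : (fun z => _) = fun z => f i z * \prod_(j <- s) f j z).
  exact: real_smoothM.
by apply/funext => z; rewrite big_cons.
Qed.

End closure.

Lemma is_form_sum (I : finType) k n (a : I -> Defs.form (R := R) k n) :
  (forall i, is_form (a i)) -> is_form (fun M => \sum_i a i M).
Proof.
move=> aF; split; first by apply: multilinear_sum => i; case: (aF i).
by move=> A j j' jj' e; apply: big1 => i _; case: (aF i) => _ h; exact: h jj' e.
Qed.

Lemma big_wedge_pullback r (k : 'I_r -> nat) m n (f : 'rV[C]_n -> 'rV[C]_m)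
    (a : forall i, Defs.form (R := R) (k i) m) M :
  big_wedge (fun i => pullback f (a i)) M = pullback f (big_wedge a) M.
Proof.
rewrite /pullback /big_wedge; congr (_ * _); apply: eq_bigr => s _; congr (_ * _).
apply: eq_bigr => i _; congr (a i _); apply/matrixP => x y; rewrite !mxE.
by congr (f _ 0 y); apply/rowP => l; rewrite !mxE.
Qed.

Lemma pullback_castmx k k' m n (E : k = k') (f : 'rV[C]_n -> 'rV[C]_m)
    (a : Defs.form (R := R) k' m) M :
  pullback f a (castmx (E, erefl) M) = pullback f (fun N => a (castmx (E, erefl) N)) M.
Proof. by case: _ / E a => a; rewrite castmx_id /pullback castmx_id. Qed.

End real_smooth.

Section product_forms.
Context {R : realType}.
Local Notation C := R[i].
Variables (r : nat) (X : 'I_r -> complex_manifold R).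
Local Notation n_ i := (cm_dim (X i)).
Local Notation N := (\sum_(i < r) cm_dim (X i))%N.
Local Notation pr i := (@proj R r (fun i => cm_dim (X i)) i).
Local Notation P := (prod_manifold X).

(** Tychonoff's theorem. *)
Lemma compact_prod : (forall i, compact [set: X i]) -> compact [set: P].
Proof.
move=> cX; have := @tychonoff 'I_r (fun i => X i : topologicalType) (fun i => setT) cX.
by congr compact; apply/seteqP; split.
Qed.

Lemma open_prod_img (a : prod_index X) : open (cm_img (X := P) a).
Proof. exact: cm_open_img. Qed.

(** The i-th projection intertwines the transition maps of the product and of the
    factor, and is linear, so the chain rule gives the identity of differentials. *)
Lemma diff_transition (a b : prod_index X) z i v :
  (cm_chart (c := P) a @` (cm_dom (c := P) a `&` cm_dom (c := P) b)) z ->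
  pr i ('d (cm_chart (c := P) b \o cm_inv (c := P) a) z v) =
  'd (cm_chart (b i) \o cm_inv (a i)) (pr i z) (pr i v) :> 'rV[C]__.
Proof.
move=> abz; have dF := cm_holo abz.
set F := cm_chart (c := P) b \o cm_inv (c := P) a in dF *.
set Fi := cm_chart (b i) \o cm_inv (a i).
have dFi : differentiable Fi (pr i z).
  have [x [ax bx] <-] := abz; rewrite /proj mxrowK.
  by apply: cm_holo; exists (x i).
have cp := @continuous_proj R r (fun i => n_ i) i.
have E : pr i \o F = Fi \o pr i by apply/funext => w; rewrite /= /proj mxrowK.
have dpr w : differentiable (pr i) w by exact: linear_differentiable.
have dl w u : 'd (pr i) w u = pr i u.
  exact: (congr1 (fun g => g u) (@diff_lin _ _ _ (pr i) w cp)).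
have L : 'd (pr i \o F) z v = pr i ('d F z v).
  exact: etrans (congr1 (fun g => g v) (diff_comp dF (dpr (F z)))) (dl _ _).
have Rh : 'd (Fi \o pr i) z v = 'd Fi (pr i z) (pr i v).
  apply: etrans (congr1 (fun g => g v) (diff_comp (dpr z) dFi)) _.
  exact: congr1 (dl z v).
by rewrite -L -Rh E.
Qed.

Lemma pr_pullback_transition i k (al : diff_form (X i) k) (a b : prod_index X) z M :
  smooth_real_form al ->
  (cm_chart (c := P) a @` (cm_dom (c := P) a `&` cm_dom (c := P) b)) z ->
  pr_pullback al a z M =
  pullback ('d (cm_chart (c := P) b \o cm_inv (c := P) a) z)
    (pr_pullback al b (cm_chart (c := P) b (cm_inv (c := P) a z))) M.
Proof.
move=> [_ _ _ alT] abz.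
have abzi : (cm_chart (a i) @` (cm_dom (a i) `&` cm_dom (b i))) (pr i z).
  by have [x [ax bx] <-] := abz; exists (x i) => //; rewrite /proj mxrowK.
rewrite /pr_pullback -/(pr i _) /pullback (alT _ _ _ abzi) /pullback.
rewrite {2}/proj mxrowK; congr (al _ _ _); apply/row_matrixP => l; rewrite !rowK.
exact: esym (diff_transition _ _ abz).
Qed.

Lemma real_smooth_pr_pullback i k (al : diff_form (X i) k) (a : prod_index X) M :
  smooth_real_form al ->
  real_smooth (cm_img (X := P) a) (fun z => pr_pullback al a z M).
Proof.
move=> [_ alR alS _]; split=> [z az|].
  by apply: alR; move/prod_img_proj : az; exact.
apply: (@sub_smooth_on R N _ (setT `*` (pr i @^-1` cm_img (a i)))).
  by move=> p [_ ap]; split=> //; exact: (prod_img_proj _ _).1 ap i.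
apply: (smooth_proj (f := fun w => complex.Re (al (a i) w (\matrix_l pr i (row l M))))).
  exact: cm_open_img.
exact: alS.
Qed.

Lemma is_form_pr_pullback i k (al : diff_form (X i) k) (a : prod_index X) z :
  smooth_real_form al -> cm_img (X := P) a z -> is_form (pr_pullback al a z).
Proof.
move=> [alF _ _ _] az; apply: (@is_form_pullback R k _ _ (pr i) (al (a i) (pr i z))).
by apply: alF; move/prod_img_proj : az; exact.
Qed.

Lemma smooth_real_form_prod_kahler (om : forall i, diff_form (X i) 2) :
  (forall i, smooth_real_form (om i)) -> smooth_real_form (prod_kahler om).
Proof.
move=> omS; have S a M := real_smooth_sum (@open_prod_img a) (index_enum _)
  (fun i => real_smooth_pr_pullback a M (omS i)).
split=> [a z az|a z M az|a M|a b z abz].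
- by apply: (is_form_sum (a := fun i => pr_pullback (om i) a z)) => i; exact: is_form_pr_pullback az.
- by have [+ _] := S a M; exact.
- by have [] := S a M.
apply/funext => M; rewrite /prod_kahler /pullback; apply: eq_bigr => i _.
exact: pr_pullback_transition.
Qed.

Lemma smooth_real_form_prod_volume (dV : forall i, diff_form (X i) (n_ i * 2)) :
  (forall i, smooth_real_form (dV i)) -> smooth_real_form (prod_volume dV).
Proof.
move=> dVS.
have S a M : real_smooth (cm_img (X := P) a) (fun z => prod_volume dV a z M).
  have oU := @open_prod_img a.
  apply: real_smoothM => //.
    by apply: real_smooth_cst => //; rewrite rpredM ?rpredV ?realn.
  apply: real_smoothM => //.
    by apply: real_smooth_cst => //; rewrite rpredV realn.
  apply: real_smooth_sum => // s; apply: real_smoothM => //.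
    by apply: real_smooth_cst => //; rewrite rpredX ?rpredN ?rpred1.
  by apply: real_smooth_prod => // i; exact: real_smooth_pr_pullback.
split=> [a z az|a z M az|a M|a b z abz].
- apply: is_form_scale; apply: (is_form_big_wedge_proj (a := fun i => dV i (a i) (pr i z))).
  by move=> i; have [dVF _ _ _] := dVS i; apply: dVF; exact: (prod_img_proj _ _).1 az i.
- by have [+ _] := S a M; exact.
- by have [] := S a M.
apply/funext => M; rewrite /prod_volume /pullback; congr (_ * _).
rewrite -[RHS]/(pullback _ (fun N => big_wedge _ (castmx (prod_dim2 X, erefl) N)) M).
rewrite -pullback_castmx -big_wedge_pullback; congr (big_wedge _ _).
apply: functional_extensionality_dep => i; apply/funext => M'.
exact: pr_pullback_transition.
Qed.

Lemma volume_form_prod (dV : forall i, diff_form (X i) (n_ i * 2)) :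
  (forall i, volume_form (dV i)) -> volume_form (prod_volume dV).
Proof.
move=> dVV; split; first by apply: smooth_real_form_prod_volume => i; case: (dVV i).
move=> a z /prod_img_proj az; rewrite /prod_volume.
have F i : is_form (dV i (a i) (pr i z)) by have [[+ _ _ _] _] := dVV i; exact.
rewrite (big_wedge_frame F) mulr_gt0 ?divr_gt0 ?ltr0n ?fact_gt0 ?prodn_gt0 //.
  by move=> i; exact: fact_gt0.
by apply: prodr_gt0 => i _; case: (dVV i) => _; exact.
Qed.

(** Positivity: some component of a nonzero vector is nonzero and contributes a
    positive term, the others contribute nonnegative ones. Closedness: each
    pulled back form depends only on its own block, so the exterior derivative is
    the sum of the pulled back exterior derivatives. *)
Lemma kahler_form_prod (om : forall i, diff_form (X i) 2) :
  (forall i, kahler_form (om i)) -> kahler_form (prod_kahler om).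
Proof.
move=> omK; have omS i : smooth_real_form (om i) by case: (omK i).
split; first exact: smooth_real_form_prod_kahler.
- move=> a z M /prod_img_proj az; rewrite /prod_kahler; apply: eq_bigr => i _.
  have [_ J _ _] := omK i; rewrite /pr_pullback -/(pr i _) /pullback -[RHS]J //.
  by congr (om i _ _ _); apply/matrixP => x y; rewrite /proj !mxE.
- move=> a z v /prod_img_proj az v0; rewrite /prod_kahler.
  have [i vi] : exists i, pr i v != 0.
    apply/not_existsP => vi; move/negP: v0; apply; apply/eqP.
    rewrite -[v]submxrowK; apply/rowP => j; rewrite !mxE.
    by have /negP/negPn/eqP/rowP/(_ (tagnat.sig2 j)) := vi (tagnat.sig1 j); rewrite !mxE.
  have E i' : pr_pullback (om i') a z (col_mx v ('i%C *: v)) =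
      om i' (a i') (pr i' z) (col_mx (pr i' v) ('i%C *: pr i' v)).
    by rewrite /pr_pullback -/(pr i' _) (pullback_col_mx (pr i')) projZ.
  rewrite (bigD1 i) //= ltr_wpDr //; last by rewrite E; case: (omK i) => _ _ + _; exact.
  apply: sumr_ge0 => i' _; rewrite E; have [vi'|vi'] := eqVneq (pr i' v) 0; last first.
    by apply: ltW; case: (omK i') => _ _ + _; exact.
  have [[omF _ _ _] _ _ _] := omK i'; have [omM _] := omF _ _ (az i').
  rewrite (multilinear_row0 omM (l := 0)) // vi'.
  by apply/rowP => j; rewrite !mxE; case: splitP => // k _; rewrite !mxE.
move=> a z M az; have azi := (prod_img_proj _ _).1 az.
have oU := @open_prod_img a.
pose om' i l w := om i (a i) w (row' l (\matrix_j pr i (row j M))).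
have omE i l w : pr_pullback (om i) a w (row' l M) = om' i l (pr i w).
  rewrite /pr_pullback /pullback /om' -/(pr i _); congr (om i _ _ _).
  by apply/matrixP => x y; rewrite !mxE.
have S i l : real_smooth (cm_img (a i)) (om' i l).
  by have [_ oR oS _] := omS i; split=> [w aw|]; [exact: oR | exact: oS].
have cE l : cderive (row l M) (fun w => prod_kahler om a w (row' l M)) z =
    \sum_i cderive (pr i (row l M)) (om' i l) (pr i z).
  pose F i w : R := complex.Re (pr_pullback (om i) a w (row' l M)).
  have FE i : F i = (fun w => complex.Re (om' i l w)) \o pr i.
    by apply/funext => w; rewrite /F omE.
  have FS i : smooth (cm_img (X := P) a) (F i).
    by have [] := real_smooth_pr_pullback a (row' l M) (omS i).
  have im0 f (U : set 'rV[C]_N) : open U -> U z -> (forall w, U w -> f w \is Num.real) ->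
      rderive (row l M) (@complex.Im R \o f) z = 0.
    move=> oV Vz fR; rewrite -(rderive_cst (0 : R) (row l M) z).
    by apply: eq_on_rderive oV Vz _ => w /fR /complex_realP[x fw]; rewrite /= fw.
  have im0' i : rderive (pr i (row l M)) (@complex.Im R \o om' i l) (pr i z) = 0.
    rewrite -rderive_proj.
    apply: (im0 (om' i l \o pr i) (cm_img (X := P) a)) => // w /prod_img_proj aw.
    by have [+ _] := S i l; apply.
  rewrite /cderive (im0 _ _ oU az); last first.
    by have [_ + _ _] := smooth_real_form_prod_kahler omS => R_ w; exact: R_.
  rewrite (eq_on_rderive (g := fun w => \sum_i F i w) _ oU az); last first.
    move=> w _; rewrite /= /prod_kahler.
    by rewrite (big_morph (@complex.Re R) (@ReD R) (erefl : complex.Re 0 = 0)).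
  rewrite (rderive_sum _ _ oU az FS).
  transitivity ((\sum_i rderive (row l M) (F i) z)%:C%C); first by [].
  rewrite (rmorph_sum (real_complex R)); apply: eq_bigr => i _.
  by rewrite im0' -rderive_proj FE.
transitivity (\sum_i ext_d (om i (a i)) (pr i z) (\matrix_j pr i (row j M))).
  rewrite /ext_d exchange_big /=; apply: eq_bigr => l _; rewrite cE mulr_sumr.
  by apply: eq_bigr => i _; rewrite rowK.
by apply: big1 => i _; case: (omK i) => _ _ _; apply; exact: azi.
Qed.

End product_forms.

(** * Sums of solutions of the flow *)

Section calculus_of_sums.
Context {R : realType}.
Local Notation C := R[i].

(** Fixing the time is an affine map with linear part d |-> (0, d.2). *)
Lemma smooth_slice n (I : set R) (V : set 'rV[C]_n) (f : R * 'rV[C]_n -> R) t :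
  open V -> I t -> smooth_on (I `*` V) f -> smooth V (fun z => f (t, z)).
Proof.
move=> oV It fS.
apply: (@smooth_on_comp R _ _ _ _ (fun p : R * 'rV[C]_n => (t, p.2))
  (fun d : R * 'rV[C]_n => (0, d.2)) f) fS => //.
- exact: open_cylinder.
- move=> p; apply: (@cvg_pair _ _ _ _ (nbhs t) (nbhs p.2)); first exact: cvg_cst.
  exact: cvg_snd.
- by move=> d p s; rewrite /tline /= mulr0 addr0.
- by move=> p [_ Vp].
Qed.

Lemma smooth_time_derivable n (U : set (R * 'rV[C]_n)) f t z :
  smooth_on U f -> U (t, z) -> derivable (fun s => f (s, z)) t 1.
Proof.
move=> fS Up; have [_ /(_ (1, 0)) H] := smooth_on_dir_diff fS Up.
move: H; rewrite /derivable; set g := fun h : R => _; set g' := fun h : R => _.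
suff -> : g = g' by [].
apply/funext => h; rewrite /g /g' /tline /= !scaler0 !addr0 mul0r addr0.
by rewrite (_ : h *: (1 : R) = h) ?mulr1 ?[h + t]addrC //; exact: mulr1.
Qed.

Lemma rderive2_sum n (U : set 'rV[C]_n) (I : Type) (s : seq I) (F : I -> 'rV[C]_n -> R) v w z :
  open U -> U z -> (forall i, smooth U (F i)) ->
  rderive v (rderive w (fun y => \sum_(i <- s) F i y)) z =
  \sum_(i <- s) rderive v (rderive w (F i)) z.
Proof.
move=> oU Uz FS.
rewrite (eq_on_rderive (g := fun y => \sum_(i <- s) rderive w (F i) y) _ oU Uz).
  by rewrite (rderive_sum _ _ oU Uz) // => i; exact: smooth_rderive.
by move=> y Uy; rewrite (rderive_sum _ _ oU Uy).
Qed.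

Section levi_sum.
Variables (n : nat) (U : set 'rV[C]_n) (I : Type) (s : seq I) (F : I -> 'rV[C]_n -> R).
Variable z : 'rV[C]_n.
Hypotheses (oU : open U) (Uz : U z) (FS : forall i, smooth U (F i)).

Lemma levi_Re_sum j k :
  levi_Re j k (fun y => \sum_(i <- s) F i y) z = \sum_(i <- s) levi_Re j k (F i) z.
Proof.
rewrite /levi_Re -mulr_suml.
move: (delta_mx 0 k) (delta_mx 0 j) ('i%C *: delta_mx 0 k) ('i%C *: delta_mx 0 j) => ek ej fk fj.
rewrite big_split; congr ((_ + _) / _).
  exact: (rderive2_sum s ej ek oU Uz FS).
exact: (rderive2_sum s fj fk oU Uz FS).
Qed.

Lemma levi_Im_sum j k :
  levi_Im j k (fun y => \sum_(i <- s) F i y) z = \sum_(i <- s) levi_Im j k (F i) z.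
Proof.
rewrite /levi_Im -mulr_suml.
move: (delta_mx 0 k) (delta_mx 0 j) ('i%C *: delta_mx 0 k) ('i%C *: delta_mx 0 j) => ek ej fk fj.
rewrite sumrB; congr ((_ - _) / _).
  exact: (rderive2_sum s ej fk oU Uz FS).
exact: (rderive2_sum s fj ek oU Uz FS).
Qed.

Lemma complex_sum (a b : I -> R) :
  ((\sum_(i <- s) a i) +i* (\sum_(i <- s) b i))%C = \sum_(i <- s) (a i +i* b i)%C.
Proof.
elim: s => [|i s' IH]; first by rewrite !big_nil.
by rewrite [RHS]big_cons -IH !big_cons.
Qed.

Lemma ddc_sum M :
  ddc (fun y => \sum_(i <- s) F i y) z M = \sum_(i <- s) ddc (F i) z M.
Proof.
rewrite (ddcE _ Uz); last exact: smooth_sum.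
transitivity (\sum_(i <- s) \sum_j \sum_k
    (levi_Re j k (F i) z +i* levi_Im j k (F i) z)%C * levi_weight j k M); last first.
  by apply: eq_bigr => i _; rewrite (ddcE _ Uz).
rewrite [RHS]exchange_big; apply: eq_bigr => j _.
rewrite [RHS]exchange_big; apply: eq_bigr => k _.
by rewrite levi_Re_sum levi_Im_sum complex_sum mulr_suml.
Qed.

End levi_sum.

End calculus_of_sums.

Section limits_of_sums.
Context {R : realType}.

(** Limits that may be -oo can be added as long as none of them is +oo. *)
Lemma cvge_sum (I : Type) (s : seq I) (f : nat -> I -> \bar R) (l : I -> \bar R) :
  (forall i, l i < +oo)%E -> (forall i, f j i @[j --> \oo] --> l i) ->
  (\sum_(i <- s) f j i)%E @[j --> \oo] --> (\sum_(i <- s) l i)%E.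
Proof.
move=> ly fl; elim: s => [|i s IH].
  rewrite big_nil (_ : (fun j => _) = fun=> 0%E); first exact: cvg_cst.
  by apply/funext => j; rewrite big_nil.
rewrite big_cons (_ : (fun j => _) = f^~ i \+ (fun j => \sum_(i <- s) f j i)%E).
  apply: cvgeD => //.
  have: (\sum_(j <- s) l j < +oo)%E by exact: lte_sum_pinfty.
  by have := ly i; case: (l i) => [?||] //; case: (\sum_(j <- s) l j)%E.
by apply/funext => j; rewrite big_cons.
Qed.

Lemma within_continuous_comp (S T U : topologicalType) (A : set S) (B : set T)
    (h : S -> T) (f : T -> U) :
  continuous h -> (forall x, A x -> B (h x)) ->
  {within B, continuous f} -> {within A, continuous (f \o h)}.
Proof.
move=> ch AB /subspace_continuousP cf; apply/subspace_continuousP => x Ax P fP.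
have := cf (h x) (AB _ Ax) P fP; rewrite /within /= => H.
have Fx := nbhs_filter x.
apply: (@filterS _ (nbhs x) Fx _ _ _ (ch x _ H)) => y /= By Ay.
by apply: By; exact: AB.
Qed.

Lemma within_continuous_sum (S : topologicalType) (A : set S) (I : Type) (s : seq I)
    (f : I -> S -> R) : (forall i, {within A, continuous (f i)}) ->
  {within A, continuous (fun x => \sum_(i <- s) f i x)}.
Proof.
move=> cf; elim: s => [|i s IH].
  rewrite (_ : (fun x => _) = fun=> 0); first exact: cst_continuous.
  by apply/funext => x; rewrite big_nil.
rewrite (_ : (fun x => _) = f i \+ (fun x => \sum_(i <- s) f i x)).
  move=> x; apply: (@cvgD _ _ _ (nbhs x) _ (f i) (fun x => \sum_(i <- s) f i x) (f i x) (\sum_(i <- s) f i x)); [exact: cf | exact: IH].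
by apply/funext => x; rewrite /= big_cons.
Qed.

End limits_of_sums.

Section product_flow.
Context {R : realType}.
Local Notation C := R[i].
Variables (r : nat) (X : 'I_r -> complex_manifold R).
Local Notation n_ i := (cm_dim (X i)).
Local Notation N := (\sum_(i < r) cm_dim (X i))%N.
Local Notation pr i := (@proj R r (fun i => cm_dim (X i)) i).
Local Notation P := (prod_manifold X).

Lemma smooth_factor (a : prod_index X) i (f : 'rV[C]_(n_ i) -> R) :
  smooth (cm_img (a i)) f -> smooth (cm_img (X := P) a) (f \o pr i).
Proof.
move=> fS; apply: (@sub_smooth_on R N _ (setT `*` (pr i @^-1` cm_img (a i)))).
  by move=> p [_ ap]; split=> //; exact: (prod_img_proj _ _).1 ap i.
by apply: smooth_proj fS; exact: cm_open_img.
Qed.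

Lemma smooth_fun_sum (f : forall i, X i -> R) :
  (forall i, smooth_fun (f i)) -> smooth_fun (X := P) (fun x => \sum_i f i (x i)).
Proof.
move=> fS a.
apply: (@smooth_sum R N _ _ _ (fun i => (f i \o cm_inv (a i)) \o pr i) (@open_prod_img _ _ _ a)).
by move=> i; apply: smooth_factor; exact: fS.
Qed.

Section solution.
Variables (om : forall i, diff_form (X i) 2) (dV : forall i, diff_form (X i) (n_ i * 2)).
Arguments om : clear implicits.
Arguments dV : clear implicits.
Hypothesis omS : forall i, smooth_real_form (om i).
Hypothesis dVS : forall i, smooth_real_form (dV i).
Variables (T : \bar R) (psi0 : forall i, X i -> R) (psi : forall i, R -> X i -> R).
Arguments psi0 : clear implicits.
Arguments psi : clear implicits.
Hypothesis sol : forall i, smooth_solution (om i) (dV i) T (psi0 i) (psi i).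

Let I := [set t : R | 0 < t /\ (t%:E < T)%E].

Let psi_smooth i (a : cm_index (X i)) :
  smooth_on (I `*` cm_img a) (fun p => psi i p.1 (cm_inv a p.2)).
Proof.
have [_ _ /(_ a) + _] := sol i.
by apply: sub_smooth_on => p [[? ?] ?]; split.
Qed.

Let open_I : open I.
Proof.
have -> : I = [set t | 0 < t] `&` [set t | (t%:E < T)%E] by [].
apply: openI; first exact: open_gt.
case: T => [x||].
- by rewrite (_ : mkset _ = [set t | t < x]); [exact: open_lt | apply/seteqP; split=> t /=; rewrite lte_fin].
- by rewrite (_ : mkset _ = setT); [exact: openT | apply/seteqP; split=> t //= _; rewrite ltry].
- by rewrite (_ : mkset _ = set0); [exact: open0 | apply/seteqP; split=> t //=; rewrite ltNge leNye].
Qed.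

(** The parabolic equation of the product. dd^c of the sum splits into blocks,
    wedge_pow_product multiplies the equations of the factors, and the product of
    the exponentials is the exponential of the sum of the time derivatives. *)
Lemma monge_ampere_product (a : prod_index X) t z M : I t -> cm_img (X := P) a z ->
  wedge_pow (fun N0 => prod_kahler om a z N0 +
     ddc ((fun x : P => \sum_i psi i t (x i)) \o cm_inv (c := P) a) z N0) N M =
  (expR (derive1 (fun s => \sum_i psi i s (cm_inv (c := P) a z i)) t))%:C%C *
    prod_volume dV a z M.
Proof.
move=> It az; have azi := (prod_img_proj _ _).1 az.
have sl i : smooth (cm_img (a i)) (fun w => psi i t (cm_inv (a i) w)).
  by apply: (smooth_slice (I := I)) (psi_smooth (a := a i)) => //; exact: cm_open_img.
have -> : (fun N0 => prod_kahler om a z N0 +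
     ddc ((fun x : P => \sum_i psi i t (x i)) \o cm_inv (c := P) a) z N0) =
  (fun N0 => \sum_i pullback (pr i) (fun M' => om i (a i) (pr i z) M' +
     ddc (psi i t \o cm_inv (a i)) (pr i z) M') N0).
  apply/funext => N0.
  rewrite (@ddc_sum R N _ _ _ (fun i => (psi i t \o cm_inv (a i)) \o pr i) z (@open_prod_img _ _ _ a) az); last first.
    by move=> i; apply: smooth_factor; exact: sl.
  rewrite -big_split; apply: eq_bigr => i _; congr (_ + _).
  apply: (ddc_proj (U := cm_img (a i))) => //; exact: cm_open_img.
have c i M' : wedge_pow (fun M' => om i (a i) (pr i z) M' +
     ddc (psi i t \o cm_inv (a i)) (pr i z) M') (n_ i) M' =
   (expR (derive1 (psi i ^~ (cm_inv (a i) (pr i z))) t))%:C%C * dV i (a i) (pr i z) M'.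
  by have [_ _ _ E] := sol i; apply: E => //; case: It.
rewrite (wedge_pow_product (prod_dim2 X) _ _ c); last 2 first.
- move=> i A B B' l b b' h1 h2 h3.
  have [/(_ _ _ (azi i))[omM _] _ _ _] := omS i.
  rewrite (omM A B B' l b b' h1 h2 h3) (multilinear_ddc _ _ h1 h2 h3).
  by rewrite !mulrDr addrACA.
- by move=> i; have [+ _ _ _] := dVS i; apply.
congr (_ * _); rewrite -rmorph_prod -expR_sum; congr (_ (expR _)).
rewrite derive1E.
rewrite (_ : (fun s => _) = \sum_i (psi i ^~ (cm_inv (a i) (pr i z)))); last first.
  by apply/funext => s; rewrite fct_sumE.
rewrite derive_sum; first by apply: eq_bigr => i _; rewrite derive1E.
move=> i; apply: (@smooth_time_derivable R _ _ (fun p => psi i p.1 (cm_inv (a i) p.2)) t (pr i z) (psi_smooth (a := a i))).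
by split=> //; exact: azi.
Qed.

Lemma smooth_solution_sum :
  smooth_solution (X := P) (prod_kahler om) (prod_volume dV) T
    (fun x => \sum_i psi0 i (x i)) (fun t x => \sum_i psi i t (x i)).
Proof.
split.
- by apply/funext => x; apply: eq_bigr => i _; have [-> _ _ _] := sol i.
- apply: within_continuous_sum => i.
  have [_ ci _ _] := sol i.
  apply: (within_continuous_comp (h := fun p : R * P => (p.1, p.2 i)) _ _ ci) => //.
  move=> p; apply: (@cvg_pair _ _ _ _ (nbhs p.1) (nbhs (p.2 i))); first exact: cvg_fst.
  apply: (@continuous_comp _ _ _ snd (fun x : P => x i)); first exact: cvg_snd.
  exact: (@proj_continuous 'I_r (fun i => X i : topologicalType) i).
- move=> a.
  have oU : open (I `*` cm_img (X := P) a).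
    rewrite openE => -[t z] [It Uz]; exists (I, cm_img (X := P) a) => //=.
    by split; apply: open_nbhs_nbhs; split=> //; exact: open_prod_img.
  apply: (@sub_smooth_on R N _ (I `*` cm_img (X := P) a)); first by move=> p [? ? ?]; split.
  apply: (@smooth_on_sum R N _ _ _ (fun i p => psi i p.1 (cm_inv (a i) (pr i p.2)))) => // i.
  apply: (@smooth_on_comp R _ _ _ _ (fun p : R * 'rV[C]_N => (p.1, pr i p.2))
    (fun p : R * 'rV[C]_N => (p.1, pr i p.2)) (fun p => psi i p.1 (cm_inv (a i) p.2)) oU)
    (psi_smooth (a := a i)).
  + move=> p; apply: (@cvg_pair _ _ _ _ (nbhs p.1) (nbhs (pr i p.2))); first exact: cvg_fst.
    apply: (@continuous_comp _ _ _ snd (pr i)); first exact: cvg_snd.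
    exact: continuous_proj.
  + by move=> d p s; rewrite /tline /= linearD linearZ.
  + by move=> p [Ip ap]; split=> //; exact: (prod_img_proj _ _).1 ap i.
move=> a t z M t0 tT az; exact: monge_ampere_product.
Qed.

End solution.

Lemma nonincreasing_sum (f : forall i, nat -> X i -> R) (x : P) :
  (forall i, nonincreasing_seq ((f i)^~ (x i))) ->
  nonincreasing_seq (fun j => \sum_i f i j (x i)).
Proof. by move=> fd j k jk; apply: ler_sum => i _; exact: fd. Qed.

Lemma nonincreasing_lim_lty (u : nat -> R) l : nonincreasing_seq u ->
  (u j)%:E @[j --> \oo] --> l -> (l < +oo)%E.
Proof.
move=> ud ul; apply: (@le_lt_trans _ _ (u 0%N)%:E); last exact: ltry.
by apply: (cvge_to_le ul); apply: nearW => j; rewrite lee_fin; exact: ud.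
Qed.

(** Sums of the approximants of the factors approximate the sum: they are smooth,
    quasi-plurisubharmonic and decreasing, they solve the product equation, and
    decreasing limits, being different from +oo, add up. *)
Lemma maximal_weak_solution_sum (om : forall i, diff_form (X i) 2)
    (dV : forall i, diff_form (X i) (n_ i * 2)) (T : \bar R)
    (phi0 : forall i, X i -> \bar R) (phi : forall i, R -> X i -> \bar R) :
  (forall i, smooth_real_form (om i)) -> (forall i, smooth_real_form (dV i)) ->
  (forall i, maximal_weak_solution (om i) (dV i) T (phi0 i) (phi i)) ->
  maximal_weak_solution (X := P) (prod_kahler om) (prod_volume dV) T
    (fun x => \sum_i phi0 i (x i))%E (fun t x => \sum_i phi i t (x i))%E.
Proof.
move=> omS dVS flow.
have f0 i : {f : nat -> X i -> R & {f_ : nat -> R -> X i -> R | 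
   [/\ forall j, smooth_fun (f j) /\ PSH (om i) (EFin \o f j),
        forall x, nonincreasing_seq (f ^~ x) /\
          (f j x)%:E @[j --> \oo] --> phi0 i x,
        forall j, smooth_solution (om i) (dV i) T (f j) (f_ j) &
        forall t x, 0 <= t -> (t%:E < T)%E ->
          nonincreasing_seq (fun j => f_ j t x) /\
          (f_ j t x)%:E @[j --> \oo] --> phi i t x]}}.
  by have [_ /cid[f /cid[f_ ?]]] := flow i; exists f, f_.
pose f i := projT1 (f0 i); pose f_ i := sval (projT2 (f0 i)).
have H i : [/\ forall j, smooth_fun (f i j) /\ PSH (om i) (EFin \o f i j),
        forall x, nonincreasing_seq ((f i) ^~ x) /\
          (f i j x)%:E @[j --> \oo] --> phi0 i x,
        forall j, smooth_solution (om i) (dV i) T (f i j) (f_ i j) &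
        forall t x, 0 <= t -> (t%:E < T)%E ->
          nonincreasing_seq (fun j => f_ i j t x) /\
          (f_ i j t x)%:E @[j --> \oo] --> phi i t x] := svalP (projT2 (f0 i)).
split; first by apply: PSH_sum => // i; case: (flow i).
exists (fun j x => \sum_i f i j (x i)), (fun j t x => \sum_i f_ i j t (x i)); split.
- move=> j; split; first by apply: (smooth_fun_sum (f := fun i => f i j)) => i; case: (H i) => /(_ j)[].
  rewrite (_ : EFin \o _ = (fun x : P => \sum_i (EFin \o f i j) (x i))%E); last first.
    by apply/funext => x; rewrite /= sumEFin.
  by apply: (PSH_sum (u := fun i => EFin \o f i j)) => // i; case: (H i) => /(_ j)[].
- move=> x; split.
    by apply: (nonincreasing_sum (f := f)) => i; have [_ /(_ (x i))[ud _] _ _] := H i.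
  rewrite (_ : (fun j => _) = fun j => \sum_i (f i j (x i))%:E)%E; last first.
    by apply/funext => j; rewrite sumEFin.
  apply: (cvge_sum (l := fun i => phi0 i (x i))) => i; have [_ /(_ (x i))[ud ul] _ _] := H i.
    exact: nonincreasing_lim_lty ud ul.
  exact: ul.
- by move=> j; apply: (smooth_solution_sum omS dVS (psi0 := fun i => f i j) (psi := fun i => f_ i j)) => i; case: (H i).
move=> t x t0 tT; split.
  by apply: (nonincreasing_sum (f := fun i j => f_ i j t)) => i; have [_ _ _ /(_ t (x i) t0 tT)[ud _]] := H i.
rewrite (_ : (fun j => _) = fun j => \sum_i (f_ i j t (x i))%:E)%E; last first.
  by apply/funext => j; rewrite sumEFin.
apply: (cvge_sum (l := fun i => phi i t (x i))) => i; have [_ _ _ /(_ t (x i) t0 tT)[ud ul]] := H i.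
  exact: nonincreasing_lim_lty ud ul.
exact: ul.
Qed.

(** A decreasing limit of continuous functions is upper semicontinuous and
    different from +oo. *)
Lemma maximal_weak_solution_usc (Y : complex_manifold R) (om : diff_form Y 2)
    (dV : diff_form Y (cm_dim Y * 2)) (T : \bar R)
    (phi0 : Y -> \bar R) (phi : R -> Y -> \bar R) t :
  maximal_weak_solution om dV T phi0 phi -> 0 <= t -> (t%:E < T)%E ->
  upper_semicont (phi t) /\ forall y, (phi t y < +oo)%E.
Proof.
move=> [_ [f [f_ [_ _ sol lim]]]] t0 tT.
split=> [x a xa|y]; last by have [ud ul] := lim t y t0 tT; exact: nonincreasing_lim_lty ud ul.
have [ud ul] := lim t x t0 tT.
have [j ja] : exists j, f_ j t x < a.
  apply: contrapT => /forallNP nj; move: xa; apply/negP; rewrite -leNgt.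
  by apply: (cvge_to_ge ul); apply: nearW => j; rewrite lee_fin leNgt; apply/negP.
have [_ cj _ _] := sol j.
have cfj : f_ j t y @[y --> x] --> f_ j t x.
  have tx : continuous (fun y : Y => (t, y)).
    by move=> y; apply: (@cvg_pair _ _ _ _ (nbhs t) (nbhs y)); [exact: cvg_cst|exact: cvg_id].
  have := within_continuous_comp (A := setT) tx _ cj.
  move=> /(_ (fun y _ => conj t0 tT))/subspace_continuousP/(_ x Logic.I).
  by rewrite withinET.
have Fx := nbhs_filter x.
apply: filterS (cvgr_lt _ cfj _ ja) => y ya.
have [udy uly] := lim t y t0 tT.
apply: (@le_lt_trans _ _ (f_ j t y)%:E); last by rewrite lte_fin.
apply: (cvge_to_le uly); exists j => // k /= jk.
by rewrite lee_fin; exact: udy.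
Qed.

End product_flow.

(** * Tonelli for a product of functions of the blocks *)

Section tonelli_blocks.
Context {R : realType}.
Local Notation R_ := (measurableTypeR R).
Local Open Scope ereal_scope.

Section blocks.
Variables (I : finType) (m : nat) (k : I -> nat) (iota : forall i, 'I_(k i) -> 'I_m).
Arguments iota : clear implicits.
Hypothesis iotaP : blocks iota.

Definition restrict i (t : m.-tuple R_) : (k i).-tuple R_ :=
  [tuple tnth t (iota i l) | l < k i].

Lemma measurable_restrict i : measurable_fun setT (restrict i).
Proof.
apply/measurable_fun_tnthP => q.
rewrite (_ : _ \o _ = (fun t => tnth t (iota i q))); first exact: measurable_tnth.
by apply/funext => t; rewrite /= tnth_mktuple.
Qed.

(** Fubini for one block: the constant K depends on h only, so the function f of
    the block may be exchanged for another one. *)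
Lemma integral_split_block i (h : m.-tuple R_ -> \bar R) :
  measurable_fun setT h -> (forall t, 0 <= h t) ->
  (forall t t', (forall j, j != i -> restrict j t = restrict j t') -> h t = h t') ->
  exists2 K, 0 <= K & forall f, measurable_fun setT f -> (forall x, 0 <= f x) ->
    \int[lebesgue_tuple m]_t (f (restrict i t) * h t) =
    \int[lebesgue_tuple (k i)]_x f x * K.
Proof.
move=> mh h0 hE.
have [b [kappa [e [e_iota e_kappa eK]]]] := complement_coordinates (blocks_inj iotaP (i := i)).
pose x0 : (k i).-tuple R_ := [tuple 0%R | _ < k i].
have mg x : measurable_fun setT (fun y => h (merge e x y)).
  rewrite (_ : (fun y => _) = h \o ((fun p => merge e p.1 p.2) \o pair x)); last by [].
  apply: measurableT_comp => //.
  apply: measurableT_comp; first exact: measurable_merge e_iota e_kappa eK.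
  exact: pair1_measurable.
have hm x y : h (merge e x y) = h (merge e x0 y).
  apply: hE => j ji; apply/eq_from_tnth => l; rewrite !tnth_mktuple.
  case E: (e (iota j l)) => [z|//]; have := eK (iota j l); rewrite E => zE.
  by move: ji; rewrite -(block_iota iotaP l) -zE (block_iota iotaP) eqxx.
have K0 : 0 <= \int[lebesgue_tuple b]_y h (merge e x0 y) by apply: integral_ge0.
exists (\int[lebesgue_tuple b]_y h (merge e x0 y)) => // f mf f0.
have mfr := measurableT_comp mf (@measurable_restrict i).
rewrite (ge0_integral_merge e_iota e_kappa eK); last 2 first.
- exact: emeasurable_funM.
- by move=> t; exact: mule_ge0.
rewrite -ge0_integralZr //; apply: eq_integral => x _.
rewrite -ge0_integralZl //; apply: eq_integral => y _; rewrite hm; congr (f _ * _).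
by apply/eq_from_tnth => l; rewrite tnth_mktuple (tnth_merge_l e_iota).
Qed.

Let unit_box n : set (n.-tuple R_) := box (fun=> `]0%R, 1%R[%classic).
Let unit n (t : n.-tuple R_) : \bar R := (\1_(@unit_box n) t)%:E.

Let measurable_unit_box n : measurable (@unit_box n).
Proof. by apply: measurable_box => l; exact: measurable_itv. Qed.

Let measurable_unit_fun n : measurable_fun setT (@unit n).
Proof. by apply/measurable_EFinP; apply: measurable_indic; exact: measurable_unit_box. Qed.

Let unit_ge0 n t : 0 <= @unit n t. Proof. by rewrite lee_fin. Qed.

Let integral_unit n : \int[lebesgue_tuple n]_t unit t = 1.
Proof.
rewrite integral_indic //; last exact: measurable_unit_box.
rewrite setIT; transitivity (\prod_(l < n) @lebesgue_measure R `]0%R, 1%R[%classic).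
  by apply: lebesgue_tuple_box => l; exact: measurable_itv.
apply: big1 => l _; rewrite lebesgue_measure_itv /= lte_fin ltr01.
by rewrite oppr0 adde0.
Qed.

Let integral_blocks_on (s : seq I) (f : forall i, (k i).-tuple R_ -> \bar R) :
  (forall i, measurable_fun setT (f i)) -> (forall i x, 0 <= f i x) ->
  (forall i, i \notin s -> f i = @unit (k i)) ->
  \int[lebesgue_tuple m]_t \prod_i f i (restrict i t) =
  \prod_i \int[lebesgue_tuple (k i)]_x f i x.
Proof.
elim: s f => [|i s IH] f mf f0 fu.
  rewrite [RHS]big1; last by move=> i _; rewrite fu // integral_unit.
  rewrite -[RHS](integral_unit m); apply: eq_integral => t _.
  transitivity (\prod_i (@unit _ (restrict i t))).
    by apply: eq_bigr => i _; rewrite fu.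
  have [tb|tb] := pselect (@unit_box m t).
    rewrite /unit indicE mem_set //; apply: big1 => i _.
    rewrite indicE mem_set // => l; rewrite tnth_mktuple; exact: tb.
  rewrite /unit indicE memNset //.
  have [j tj] : exists j, ~ (`]0%R, 1%R[%classic : set R) (tnth t j).
    by apply/existsNP => h; apply: tb.
  have [l jE] := blockP iotaP j.
  rewrite (bigD1 (block iotaP j)) //= indicE memNset ?mul0e // => /(_ l).
  by rewrite tnth_mktuple -jE.
pose f' j : (k j).-tuple R_ -> \bar R := if j == i then @unit (k j) else f j.
have f'E j : j != i -> f' j = f j by rewrite /f' => /negbTE ->.
have f'i : f' i = @unit (k i) by rewrite /f' eqxx.
have mf' j : measurable_fun setT (f' j) by rewrite /f'; case: ifP.
have f'0 j x : 0 <= f' j x by rewrite /f'; case: ifP.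
pose h t := \prod_(j | j != i) f j (restrict j t).
have mh : measurable_fun setT h.
  rewrite (_ : h = fun t => \prod_(j <- [seq j <- index_enum I | j != i]) f j (restrict j t)).
    elim: [seq _ <- _ | _] => [|j s' IHs].
      by rewrite (_ : (fun t => _) = fun=> 1); [|apply/funext => t; rewrite big_nil].
    rewrite (_ : (fun t => _) = fun t =>
      f j (restrict j t) * \prod_(j <- s') f j (restrict j t)); last first.
      by apply/funext => t; rewrite big_cons.
    by apply: emeasurable_funM => //; exact: measurableT_comp (mf j) (@measurable_restrict j).
  by apply/funext => t; rewrite /h big_filter.
have h0 t : 0 <= h t by apply: prode_ge0.
have hE t t' : (forall j, j != i -> restrict j t = restrict j t') -> h t = h t'.
  by move=> E; apply: eq_bigr => j ji; rewrite E.
have [K K0 HK] := integral_split_block mh h0 hE.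
have KE : K = \prod_j \int[lebesgue_tuple (k j)]_x f' j x.
  rewrite -IH //; last first.
    move=> j js; rewrite /f'; case: eqVneq => // ji; apply: fu.
    by rewrite inE negb_or ji.
  transitivity (\int[lebesgue_tuple (k i)]_x unit x * K); first by rewrite integral_unit mul1e.
  rewrite -HK //; apply: eq_integral => t _.
  rewrite [RHS](bigD1 i) //= f'i; congr (_ * _).
  by rewrite /h; apply: eq_bigr => j ji; rewrite f'E.
transitivity (\int[lebesgue_tuple m]_t (f i (restrict i t) * h t)).
  by apply: eq_integral => t _; rewrite (bigD1 i).
rewrite HK // KE [RHS](bigD1 i) //= (bigD1 i) //= f'i integral_unit mul1e.
by congr (_ * _); apply: eq_bigr => j ji; rewrite f'E.
Qed.

(** Starting from the indicator functions of unit boxes, whose product is the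
    indicator function of the unit box, exchange one factor at a time by
    integral_split_block. The unit box has volume 1, so no constant appears. *)
Lemma integral_blocks (f : forall i, (k i).-tuple R_ -> \bar R) :
  (forall i, measurable_fun setT (f i)) -> (forall i x, 0 <= f i x) ->
  \int[lebesgue_tuple m]_t \prod_i f i (restrict i t) =
  \prod_i \int[lebesgue_tuple (k i)]_x f i x.
Proof.
move=> mf f0; apply: (@integral_blocks_on (enum I)) => // i.
by rewrite mem_enum.
Qed.

End blocks.
End tonelli_blocks.

(** * Singularity exponents *)

Section positive_integrals.
Context {R : realType}.
Local Notation C := R[i].
Local Notation R_ := (measurableTypeR R).
Local Open Scope ereal_scope.

Lemma prode_gt0 (I : Type) (s : seq I) (P : pred I) (f : I -> \bar R) :
  (forall i, P i -> 0 < f i) -> 0 < \prod_(i <- s | P i) f i.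
Proof. by move=> f0; elim/big_ind : _ => // x y; exact: mule_gt0. Qed.

Lemma lebesgue_cube_gt0 n (z : 'rV[C]_n) (d : R) : (0 < d)%R ->
  0 < lebesgue_tuple (n * 2) (@ofreal R n @^-1` cube z d).
Proof.
move=> d0.
rewrite (_ : _ @^-1` _ = box (fun q =>
   `](tnth (toreal z) q - d)%R, (tnth (toreal z) q + d)%R[%classic)); last first.
  apply/seteqP; split=> t /=.
    by move=> /cubeP zt q /=; have := zt q; rewrite toreal_ofreal in_itv /= -ltr_distlC distrC.
  move=> zt; apply/cubeP => q; have := zt q.
  by rewrite toreal_ofreal /= in_itv /= -ltr_distlC distrC.
apply: (@lt_le_trans _ _ (\prod_(q < n * 2) (d + d)%:E)).
  by apply: prode_gt0 => q _; rewrite lte_fin addr_gt0.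
rewrite le_eqVlt; apply/orP; left; apply/eqP/esym; transitivity (\prod_(q < n * 2) @lebesgue_measure R
   `](tnth (toreal z) q - d)%R, (tnth (toreal z) q + d)%R[%classic).
  by apply: lebesgue_tuple_box => q; exact: measurable_itv.
apply: eq_bigr => q _; rewrite lebesgue_measure_itv /= lte_fin ifT; last by lra.
by rewrite -EFinB; congr EFin; ring.
Qed.

(** A nonempty open set contains a cube, which has positive volume. *)
Lemma integral_open_gt0 n (V : set 'rV[C]_n) z (f : (n * 2).-tuple R_ -> \bar R) :
  open V -> V z -> measurable_fun (@ofreal R n @^-1` V) f ->
  (forall t, (@ofreal R n @^-1` V) t -> 0 < f t) ->
  0 < \int[lebesgue_tuple (n * 2)]_(t in @ofreal R n @^-1` V) f t.
Proof.
move=> oV Vz mf f0; have mV := measurable_ofreal_open oV.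
have f0' t : (@ofreal R n @^-1` V) t -> 0 <= f t by move=> /f0/ltW.
rewrite lt_neqAle integral_ge0 // andbT eq_sym; apply/negP => /eqP i0.
have := (ae_eq_integral_abs (lebesgue_tuple (n * 2)) mV mf).1.
rewrite (_ : integral _ _ _ = 0); last first.
  by rewrite -[RHS]i0; apply: eq_integral => t /set_mem Vt; rewrite gee0_abs // f0'.
move=> /(_ erefl) ae0.
have : (lebesgue_tuple (n * 2)).-negligible (@ofreal R n @^-1` V).
  apply: negligibleS ae0 => t Vt /= /(_ Vt) ft0.
  by have := f0 t Vt; rewrite ft0 ltxx.
move=> /(negligibleP _ mV) V0.
have [d d0 dV] := (nbhs_cube z V).1 (open_nbhs_nbhs (conj oV Vz)).
have := lebesgue_cube_gt0 z d0; apply/negP; rewrite -leNgt -V0.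
apply: le_measure; [apply: mem_set|exact: mem_set|].
  by apply: measurable_ofreal_open; exact: open_cube.
by move=> t; exact: dV.
Qed.

Lemma lebesgue_cube_lty n (z : 'rV[C]_n) (d : R) :
  lebesgue_tuple (n * 2) (@ofreal R n @^-1` cube z d) < +oo.
Proof.
pose rho := (\sum_q (`|tnth (toreal z) q| + `|d|))%R.
apply: le_lt_trans (lebesgue_real_box (n * 2) rho).
apply: le_measure; [apply: mem_set|apply: mem_set; exact: measurable_real_box|].
  by apply: measurable_ofreal_open; exact: open_cube.
move=> t /cubeP zt q /=; rewrite in_itv /= -ler_norml.
have := zt q; rewrite toreal_ofreal => tq.
rewrite /rho (bigD1 q) //= ler_wpDr //; first by apply: sumr_ge0 => l _; rewrite addr_ge0.
rewrite -(subrK (tnth (toreal z) q) (tnth t q)) addrC.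
apply: le_trans (ler_normD _ _) _; rewrite lerD2l.
by apply: le_trans (ltW tq) _; exact: ler_norm.
Qed.

Lemma measurable_expeR d (T : measurableType d) (D : set T) (f : T -> \bar R) :
  measurable_fun D f -> measurable_fun D (fun x => expeR (f x)).
Proof.
move=> mf mD; apply: (measurable_fun_gt mD _ mD) => a.
have [a0|a0] := ltP a 0%R.
  rewrite (_ : _ `&` _ = D) //; apply/seteqP; split=> [x []//|x Dx]; split=> //=.
  by apply: lt_le_trans (expeR_ge0 _); rewrite lte_fin.
have [y yE] := expeR_total (a0 : 0 <= a%:E).
rewrite (_ : _ `&` _ = D `&` [set x | y < f x]); first exact: emeasurable_fun_o_infty.
by apply/seteqP; split=> x /=; rewrite -yE lte_expeR.
Qed.

End positive_integrals.

Section singularity_weight.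
Context {R : realType}.
Local Notation C := R[i].
Local Notation R_ := (measurableTypeR R).
Local Open Scope ereal_scope.

(** The exponent of u at x is the supremum of the q > 0 for which this function is
    locally integrable near x. *)
Definition weight (Y : Type) (q : R) (u : Y -> \bar R) (y : Y) := expeR (- (q%:E * u y)).

Section one_manifold.
Variables (Y : complex_manifold R) (u : Y -> \bar R).
Hypothesis uusc : upper_semicont u.
Hypothesis uy : forall y, u y < +oo.
Local Notation n := (cm_dim Y).

(** Upper semicontinuity of u makes the sublevel sets open in charts. *)
Lemma measurable_weight q (a : cm_index Y) (V : set 'rV[C]_n) :
  open V -> V `<=` cm_img a ->
  measurable_fun (@ofreal R n @^-1` V) (weight q u \o cm_inv a \o @ofreal R n).
Proof.
move=> oV Va; have mV := measurable_ofreal_open oV.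
apply: measurable_expeR.
rewrite (_ : (fun t => _) = fun t => q%:E * - u (cm_inv a (ofreal t))); last first.
  by apply/funext => t; rewrite muleN.
apply: measurable_funeM; apply: measurable_fun_gt => // b.
rewrite (_ : _ `&` _ = @ofreal R n @^-1` (V `&` [set z | u (cm_inv a z) < (- b)%:E])); last first.
  by apply/seteqP; split=> t /= [Vt]; rewrite EFinN lteNr.
apply: measurable_ofreal_open; rewrite openE => z [Vz uz].
have Fz := nbhs_filter z.
apply: filterI; first exact: open_nbhs_nbhs.
exact: (cm_inv_cont (Va z Vz) (uusc uz)).
Qed.

Lemma weight_gt0 q y : (0 < q)%R -> 0 < weight q u y.
Proof.
move=> q0; apply: expeR_gt0; have := uy y; case: (u y) => [x||] // _.
  by rewrite -EFinM -EFinN ltNyr.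
by rewrite gt0_muleNy.
Qed.

(** The set of admissible q is an interval: exp(-q'u) <= 1 + exp(-qu) for
    0 < q' <= q, and the constant is integrable on bounded sets. *)
Lemma L1loc_weight_le q q' y : (0 < q')%R -> (q' <= q)%R ->
  L1loc_at (weight q u) y -> L1loc_at (weight q' u) y.
Proof.
move=> q'0 q'q uq a ay; have [W [oW Wy Wa iW]] := uq a ay.
have q0 : (0 < q)%R by exact: lt_le_trans q'q.
set z := cm_chart a y.
have oV : open (W `&` cube z 1) by apply: openI => //; exact: open_cube.
have Va : W `&` cube z 1 `<=` cm_img a by move=> w [Ww _]; exact: Wa.
exists (W `&` cube z 1); split=> //; first by split=> //; exact: cube_center.
have mV := measurable_ofreal_open oV; have mW := measurable_ofreal_open oW.
apply/integrableP; split; first exact: measurable_weight.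
have m1 := measurable_weight q oV Va.
apply: (@le_lt_trans _ _ (\int[lebesgue_tuple (n * 2)]_(t in @ofreal R n @^-1` (W `&` cube z 1))
   (cst 1 t + (weight q u \o cm_inv a \o @ofreal R n) t))).
  apply: ge0_le_integral => //.
  - by apply: measurableT_comp => //; exact: measurable_weight.
  - by apply: emeasurable_funD => //; exact: measurable_cst.
  move=> t _; rewrite /= gee0_abs ?expeR_ge0 //.
  have := uy (cm_inv a (ofreal t)); rewrite /weight; case: (u _) => [x||] // _; last first.
    by rewrite !gt0_muleNy //= ?leey.
  rewrite -!EFinM -!EFinN /= -EFinD lee_fin.
  have [x0|x0] := leP 0%R x.
    by apply: ler_wpDr; [exact: expR_ge0 | rewrite -expR0 ler_expR oppr_le0 mulr_ge0 // ltW].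
  by apply: ler_wpDl => //; rewrite ler_expR lerN2 ler_wnM2r // ltW.
rewrite ge0_integralD //; last by move=> t _; exact: expeR_ge0.
rewrite lte_add_pinfty //.
  rewrite integral_cst // mul1e; apply: le_lt_trans (lebesgue_cube_lty z 1).
  apply: le_measure; [exact: mem_set|apply: mem_set|].
    by apply: measurable_ofreal_open; exact: open_cube.
  by move=> t [].
have /integrableP[m2 fW] := iW.
apply: le_lt_trans fW.
rewrite (_ : integral _ _ _ = \int[lebesgue_tuple (n * 2)]_(t in @ofreal R n @^-1` (W `&` cube z 1))
   `|(weight q u \o cm_inv a \o @ofreal R n) t|); last first.
  by apply: eq_integral => t _; rewrite gee0_abs // expeR_ge0.
apply: ge0_subset_integral => //; first exact: measurableT_comp.
by move=> t [].
Qed.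

End one_manifold.
End singularity_weight.

Section exponents.
Context {R : realType}.
Local Notation C := R[i].
Local Notation R_ := (measurableTypeR R).
Local Open Scope ereal_scope.
Variables (r : nat) (X : 'I_r -> complex_manifold R).
Local Notation n_ i := (cm_dim (X i)).
Local Notation N := (\sum_(i < r) cm_dim (X i))%N.
Local Notation pr i := (@proj R r (fun i => cm_dim (X i)) i).
Local Notation iota_ i := (@iota2 r (fun i => cm_dim (X i)) i).
Local Notation P := (prod_manifold X).
Variable u : forall i, X i -> \bar R.
Arguments u : clear implicits.
Hypothesis uusc : forall i, upper_semicont (u i).
Hypothesis uy : forall i y, u i y < +oo.
Let Phi (x : P) : \bar R := \sum_i u i (x i).

Let Phi_usc : upper_semicont Phi.
Proof.
apply: (@upper_semicont_sum _ _ _ _ (fun i (x : P) => u i (x i))) => // i.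
apply: (@upper_semicont_comp _ _ _ (fun x : P => x i)) => //.
exact: (@proj_continuous 'I_r (fun i => X i : topologicalType) i).
Qed.

Let Phi_lty x : Phi x < +oo. Proof. exact: lte_sum_pinfty. Qed.

Lemma adde_def_lty (y z : \bar R) : y < +oo -> z < +oo -> y +? z.
Proof. by case: y => [?||] //; case: z. Qed.

(** Since no u i takes the value +oo, the exponential of the sum is the product of
    the exponentials also where the sum is -oo. *)
Lemma weight_sum q (x : P) : (0 < q)%R ->
  weight q Phi x = \prod_i weight q (u i) (x i).
Proof.
move=> q0; rewrite /weight /Phi; elim: (index_enum _) => [|i s IH].
  by rewrite !big_nil mule0 oppe0 expeR0.
have qy w : w < +oo -> q%:E * w < +oo.
  by case: w => [w||] // _; rewrite ?gt0_muleNy // -EFinM ltry.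
rewrite !big_cons -IH -expeRD; congr expeR.
have sy : \sum_(j <- s) u j (x j) < +oo by exact: lte_sum_pinfty.
rewrite muleDr //; last exact: adde_def_lty.
by rewrite oppeD //; apply: adde_def_lty; exact: qy.
Qed.

Section product_sets.
Variables (a : prod_index X) (W : forall i, set 'rV[C]_(n_ i)).
Arguments W : clear implicits.
Hypothesis oW : forall i, open (W i).
Hypothesis Wa : forall i, W i `<=` cm_img (a i).

Definition prod_set : set 'rV[C]_N := [set z | forall i, W i (pr i z)].

Lemma open_prod_set : open prod_set.
Proof.
rewrite openE => z Wz.
suff: \forall w \near z, forall i, W i (pr i w) by [].
apply: (@filter_forall _ _ _ _ (nbhs_filter z)) => i.
by apply: (@continuous_proj R r _ i z); apply: open_nbhs_nbhs; split.
Qed.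

Lemma prod_set_img : prod_set `<=` cm_img (X := P) a.
Proof. by move=> z Wz; apply/prod_img_proj => i; exact: Wa (Wz i). Qed.

(** Tonelli on a product of open sets: the weight of the sum is a product of
    functions of separate variables, and so is the indicator function. *)
Lemma integral_weight_sum q : (0 < q)%R ->
  \int[lebesgue_tuple (N * 2)]_(t in @ofreal R N @^-1` prod_set)
    weight q Phi (cm_inv (c := P) a (ofreal t)) =
  \prod_i \int[lebesgue_tuple (n_ i * 2)]_(t in @ofreal R (n_ i) @^-1` W i)
    weight q (u i) (cm_inv (a i) (ofreal t)).
Proof.
move=> q0.
pose f i : (n_ i * 2).-tuple R_ -> \bar R :=
  (weight q (u i) \o cm_inv (a i) \o @ofreal R (n_ i)) \_ (@ofreal R (n_ i) @^-1` W i).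
have mf i : measurable_fun setT (f i).
  have H := (measurable_restrictT (weight q (u i) \o cm_inv (a i) \o @ofreal R (n_ i))
    (measurable_ofreal_open (@oW i))).1.
  by apply: H; exact: measurable_weight.
have f0 i t : 0 <= f i t by rewrite /f patchE; case: ifP => // _; exact: expeR_ge0.
rewrite integral_mkcond.
transitivity (\prod_i \int[lebesgue_tuple (n_ i * 2)]_t f i t); last first.
  by apply: eq_bigr => i _; rewrite [RHS]integral_mkcond.
rewrite -(integral_blocks (blocks_iota2 (fun i => n_ i)) mf f0).
have rE i t : ofreal (restrict (fun i => iota_ i) i t) = pr i (ofreal t).
  rewrite -[RHS]ofreal_toreal; congr ofreal; apply/eq_from_tnth => l.
  by rewrite toreal_proj toreal_ofreal tnth_mktuple.
apply: eq_integral => t _; rewrite patchE.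
have [Wt|nWt] := pselect ((@ofreal R N @^-1` prod_set) t).
  rewrite mem_set // [LHS]weight_sum //; apply: eq_bigr => i _.
  rewrite /f patchE mem_set /=; last by rewrite rE; exact: Wt.
  by rewrite rE.
rewrite memNset //.
have [i ni] : exists i, ~ W i (pr i (ofreal t)) by apply/existsNP.
by rewrite (bigD1 i) //= /f patchE memNset ?mul0e //= rE.
Qed.

Lemma integrable_weight_sum q : (0 < q)%R ->
  (lebesgue_tuple (N * 2)).-integrable (@ofreal R N @^-1` prod_set)
    (weight q Phi \o cm_inv (c := P) a \o @ofreal R N) <->
  \prod_i \int[lebesgue_tuple (n_ i * 2)]_(t in @ofreal R (n_ i) @^-1` W i)
    weight q (u i) (cm_inv (a i) (ofreal t)) < +oo.
Proof.
move=> q0; rewrite -integral_weight_sum //.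
have E : \int[lebesgue_tuple (N * 2)]_(t in @ofreal R N @^-1` prod_set)
    `|(weight q Phi \o cm_inv (c := P) a \o @ofreal R N) t| =
  \int[lebesgue_tuple (N * 2)]_(t in @ofreal R N @^-1` prod_set)
    weight q Phi (cm_inv (c := P) a (ofreal t)).
  by apply: eq_integral => t _; rewrite gee0_abs // expeR_ge0.
split=> [/integrableP[_]|h]; first by rewrite E.
apply/integrableP; split; last by rewrite E.
apply: (measurable_weight (Y := P)) => //; first exact: open_prod_set.
exact: prod_set_img.
Qed.

End product_sets.

(** On product neighbourhoods the integral of the product weight is the product of
    the integrals. All of these are positive, so the product is finite exactly
    when each factor is. To read the exponent of one factor in a given chart, this
    chart is completed to a product chart. *)
Lemma L1loc_weight_sum q (x : P) : (0 < q)%R ->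
  L1loc_at (weight q Phi) x <-> forall i, L1loc_at (weight q (u i)) (x i).
Proof.
move=> q0; split=> [H i b bx|H a ax]; last first.
  have W_ i : {W : set 'rV[C]_(n_ i) | [/\ open W, W (cm_chart (a i) (x i)),
     W `<=` cm_img (a i) & (lebesgue_tuple (n_ i * 2)).-integrable
        (@ofreal R (n_ i) @^-1` W) (weight q (u i) \o cm_inv (a i) \o @ofreal R (n_ i))]}.
    by apply: cid; have [W ?] := H i (a i) (ax i); exists W.
  pose W i := sval (W_ i); have HW i := svalP (W_ i).
  have oW i : open (W i) by case: (HW i).
  have Wa i : W i `<=` cm_img (a i) by case: (HW i).
  exists (prod_set W); split.
  - exact: open_prod_set.
  - by move=> i; rewrite /proj mxrowK; case: (HW i).
  - exact: prod_set_img.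
  apply/(integrable_weight_sum oW Wa q0).
  have F i : \int[lebesgue_tuple (n_ i * 2)]_(t in @ofreal R (n_ i) @^-1` W i)
      weight q (u i) (cm_inv (a i) (ofreal t)) \is a fin_num.
    rewrite ge0_fin_numE; last by apply: integral_ge0 => t _; exact: expeR_ge0.
    have [_ _ _ /integrableP[_]] := HW i; congr (_ < _).
    by apply: eq_integral => t _; rewrite gee0_abs // expeR_ge0.
  have := @prode_fin_num R 'I_r (index_enum _) predT _ (fun i _ => F i).
  by rewrite fin_numElt => /andP[].
(* complete the given chart of one factor to a chart of the product *)
pose a0 j := projT1 (cid (cm_cover (x j))).
have a0x j : cm_dom (a0 j) (x j) := projT2 (cid (cm_cover (x j))).
have [a [ax aib]] : exists a : prod_index X, prod_dom a x /\ a i = b.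
  have c j : {c : cm_index (X j) | cm_dom c (x j) /\ forall e : i = j, c = eq_rect i (fun k => cm_index (X k)) b j e}.
    have [e|ne] := pselect (i = j).
      subst j; exists b; split=> // e; by rewrite (Prop_irrelevance e erefl).
    by exists (a0 j); split=> // e; case: ne.
  exists (fun j => sval (c j)); split; first by move=> j; case: (svalP (c j)).
  by case: (svalP (c i)) => _ /(_ erefl).
subst b.
set z0 : 'rV[C]_N := cm_chart (c := P) a x.
have [U [oU Uz Ua iU]] := H a ax.
have [d d0 dU] := (nbhs_cube z0 U).1 (open_nbhs_nbhs (conj oU Uz)).
pose W j := cube (pr j z0) d `&` cm_img (a j).
have oW j : open (W j) by apply: openI; [exact: open_cube | exact: cm_open_img].
have Wa j : W j `<=` cm_img (a j) by move=> w [].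
have Wz j : W j (pr j z0).
  split; first exact: cube_center.
  by rewrite /proj mxrowK; exists (x j).
have WU : prod_set W `<=` U.
  move=> w Ww; apply: dU; apply/cubeP => p.
  have [l ->] := blockP (blocks_iota2 (fun i => n_ i)) p.
  by have [/cubeP/(_ l) + _] := Ww (block (blocks_iota2 (fun i => n_ i)) p); rewrite !toreal_proj.
have := (integrable_weight_sum oW Wa q0).1 (integrableS
  (measurable_ofreal_open oU) (measurable_ofreal_open (open_prod_set oW))
  (fun t => WU (ofreal t)) iU).
rewrite (bigD1 i) //=; set A := integral _ _ _; set B := \big[_/_]_(_ | _) _ => AB.
have B0 : 0 < B.
  apply: prode_gt0 => j _; apply: (integral_open_gt0 (z := pr j z0)) => //.
    exact: (measurable_weight (@uusc j) q (oW j) (Wa j)).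
  by move=> t _; exact: weight_gt0.
have A0 : 0 <= A by apply: integral_ge0 => t _; exact: expeR_ge0.
have Afin : A < +oo.
  rewrite ltey; apply/negP => /eqP Ay; move: AB.
  by rewrite Ay gt0_mulye.
exists (W i); split=> //.
- by have := Wz i; rewrite {1}/proj mxrowK.
apply/integrableP; split; first exact: (measurable_weight (@uusc i) q (oW i) (Wa i)).
rewrite (_ : integral _ _ _ = A) //.
by apply: eq_integral => t _; rewrite gee0_abs // expeR_ge0.
Qed.

Lemma sing_exponent_ge0 (Y : complex_manifold R) (v : Y -> \bar R) y :
  0 <= sing_exponent v y.
Proof. by apply: ereal_sup_ubound; left. Qed.

(** The admissible q for the sum are those admissible for every factor. As these
    sets are intervals starting at 0, the supremum of their intersection is the
    least of the suprema. *)
Lemma sing_exponent_sum (x : P) :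
  sing_exponent Phi x = \big[Order.min/+oo]_i sing_exponent (u i) (x i).
Proof.
apply/eqP; rewrite eq_le; apply/andP; split.
  apply: le_bigmin; first exact: leey.
  move=> i _; apply: ge_ereal_sup => _ [->|[q [q0 Hq] <-]].
    by apply: ereal_sup_ubound; left.
  apply: ereal_sup_ubound; right; exists q => //; split=> //.
  exact: (L1loc_weight_sum x q0).1 Hq i.
rewrite leNgt; apply/negP => lt_min.
have [q [q0 Pq qm]] : exists q : R, [/\ (0 < q)%R, sing_exponent Phi x < q%:E &
    q%:E < \big[Order.min/+oo]_i sing_exponent (u i) (x i)].
  move: (sing_exponent_ge0 Phi x) lt_min; move: (sing_exponent _ _) => [c||] // c0; last by rewrite ltNge leey.
  move: (\big[_/_]_i _) => [m||] // cm.
    rewrite lte_fin in cm; rewrite lee_fin in c0.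
    by exists ((c + m) / 2)%R; rewrite !lte_fin; split; lra.
  rewrite lee_fin in c0; exists (c + 1)%R.
  by rewrite lte_fin ltry; split=> //; lra.
move: Pq; apply/negP; rewrite -leNgt.
apply: ereal_sup_ubound; right; exists q => //; split=> //.
apply/(L1loc_weight_sum x q0) => i.
have /ereal_sup_gt[_ [->|[q' [q'0 Hq'] <-]]] := lt_le_trans qm (bigmin_le _ i _).
  by rewrite lte_fin ltNge (ltW q0).
by rewrite lte_fin => qq'; apply: L1loc_weight_le Hq' => //; exact: ltW.
Qed.

(** Inversion reverses the order on [0, +oo], and the minimum is attained since
    there is a factor. *)
Lemma arnold_mult_sum (x : P) : (0 < r)%N ->
  arnold_mult Phi x = \big[Order.max/-oo]_i arnold_mult (u i) (x i).
Proof.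
move=> r0; rewrite /arnold_mult sing_exponent_sum.
have [i0 _ E] := @eq_bigmin _ _ _ +oo (Ordinal r0) predT
  (fun i => sing_exponent (u i) (x i)) isT (fun i _ => leey _).
rewrite E; apply/eqP; rewrite eq_le; apply/andP; split.
  exact: (le_bigmax _ (fun i => (sing_exponent (u i) (x i))^-1) i0).
apply: bigmax_le => [|i _]; first exact: leNye.
rewrite lee_pV2 ?inE ?sing_exponent_ge0 // -E.
exact: bigmin_le.
Qed.

End exponents.

(** * The product flow *)

Theorem theorem7p1 (R : realType) (r : nat) (r_ge1 : (1 <= r)%N)
    (X : 'I_r -> complex_manifold R)
    (om : forall i : 'I_r, diff_form (X i) 2)
    (dV : forall i : 'I_r, diff_form (X i) (cm_dim (X i) * 2))
    (T : \bar R)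
    (phi0 : forall i : 'I_r, X i -> \bar R)
    (phi : forall i : 'I_r, R -> X i -> \bar R)
    (T_gt0 : (0 < T)%E)
    (dim_ge1 : forall i : 'I_r, (1 <= cm_dim (X i))%N)
    (kahlerX : forall i : 'I_r, compact_kahler (om i))
    (volumeX : forall i : 'I_r, volume_form (dV i))
    (psh0 : forall i : 'I_r, PSH (om i) (phi0 i))
    (flow : forall i : 'I_r,
      maximal_weak_solution (om i) (dV i) T (phi0 i) (phi i)) :
  let omX := prod_kahler om in
  let dVX := prod_volume dV in
  let Phi0 := fun x : prod_manifold X => (\sum_(i < r) phi0 i (x i))%E in
  let Phi := fun (t : R) (x : prod_manifold X) =>
    (\sum_(i < r) phi i t (x i))%E in
  [/\ compact_kahler omX /\ volume_form dVX,
      PSH omX Phi0,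
      maximal_weak_solution omX dVX T Phi0 Phi &
      forall t : R, 0 <= t -> (t%:E < T)%E ->
      forall x : prod_manifold X,
        sing_exponent (Phi t) x =
          \big[Order.min/+oo%E]_(i < r) sing_exponent (phi i t) (x i) /\
        arnold_mult (Phi t) x =
          \big[Order.max/-oo%E]_(i < r) arnold_mult (phi i t) (x i)].
Proof.
move=> omX dVX Phi0 Phi.
have omS i : smooth_real_form (om i) by have [_ []] := kahlerX i.
have dVS i : smooth_real_form (dV i) by have [] := volumeX i.
split.
- split; last exact: volume_form_prod.
  split; first by apply: compact_prod => i; case: (kahlerX i).
  by apply: kahler_form_prod => i; case: (kahlerX i).
- exact: PSH_sum.
- exact: maximal_weak_solution_sum.
move=> t t0 tT x.
have U i := maximal_weak_solution_usc (flow i) t0 tT.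
have usc i : upper_semicont (phi i t) by have [] := U i.
have lty i y : (phi i t y < +oo)%E by have [_] := U i.
split; first exact: sing_exponent_sum.
exact: arnold_mult_sum.
Qed.
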